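(* Let $\Sigma$ be a bounded smooth $k$-manifold without boundary in $\mathbb{R}^d$ with $2 \le k < d$. Let $\tau = \triangle vv'v''$ be a triangle whose vertices lie on $\Sigma$. Let $R$ be the circumradius of $\tau$. Suppose that $R \leq \kappa\,\mathrm{lfs}(v)$, $R \leq \kappa\,\mathrm{lfs}(v')$, and $R \leq \kappa\,\mathrm{lfs}(v'')$ for some $\kappa \leq 1/2$. Let $x$ be any point on $\tau$, and let $\tilde{x}$ be the point nearest $x$ on $\Sigma$. Then for any angle $\phi \in (0^\circ, 60^\circ]$ for which both expressions in the maximum are defined, $$\angle(N_\tau, N_{\tilde{x}}\Sigma) \leq \max\left\{ \eta(\sqrt{2}\,\kappa) + \arcsin\left( \kappa\cot\frac{\phi}{2} \right),\; \eta(2\kappa) + \arcsin\left( \kappa\cot\left( 45^\circ - \frac{\phi}{4} \right) \right) \right\},$$ where $\eta(\delta) = \eta_1(\delta) = \arccos\left( 1 - \frac{\delta^2}{2\sqrt{1-\delta^2}} \right)$ if $d - k = 1$, and $\eta(\delta) = \eta_2(\delta) = \arccos\sqrt{1 - \frac{\delta^2}{\sqrt{1-\delta^2}}}$ if $d - k \geq 2$.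
   Context: A bounded smooth manifold without boundary in $\mathbb{R}^d$ means a compact smoothly embedded submanifold without boundary. For $p \in \Sigma$, $T_p\Sigma$ is the tangent $k$-flat at $p$ and $N_p\Sigma$ is the $(d-k)$-flat through $p$ orthogonal to $T_p\Sigma$. The medial axis $M$ of $\Sigma$ is the closure of the set of points of $\mathbb{R}^d$ having more than one nearest point on $\Sigma$; the local feature size is $\mathrm{lfs}(p) = \min_{m \in M}|pm|$. For a triangle $\tau$, $N_\tau$ is the $(d-2)$-flat of points of $\mathbb{R}^d$ equidistant to the three vertices of $\tau$ (orthogonal to its affine hull), and the circumradius is the radius of the circle through the three vertices. For flats $F, G$ with $\dim F \le \dim G$, $\angle(F,G) = \angle(G,F) = \max_{\ell_F \subset F}\min_{\ell_G \subset G}\angle(\ell_F,\ell_G) \in [0^\circ,90^\circ]$, where $\ell_F,\ell_G$ range over lines and $\angle(\ell_F,\ell_G)$ is the nonobtuse angle between their directions. The function $\eta_1(\delta)$ is considered for $0 \le \delta < \sqrt{4\sqrt5-8}$ and $\eta_2(\delta)$ for $0 \le \delta < \sqrt{(\sqrt5-1)/2}$. *)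

(* Defs.v *)
From HB Require Import structures.
From mathcomp Require Import all_boot all_order all_algebra.
From mathcomp Require Import all_classical all_reals all_analysis.
Set Implicit Arguments.
Unset Strict Implicit.
Unset Printing Implicit Defensive.
Import Order.TTheory GRing.Theory Num.Theory.
Import numFieldNormedType.Exports.
Local Open Scope classical_set_scope.
Local Open Scope ring_scope.

(* Points of R^d are row vectors. The norm that MathComp-Analysis puts on
   'rV[R]_d is the sup norm: it is used only for topology and
   differentiability, where all norms agree; every metric notion below goes
   through the Euclidean norm defined here. *)
Definition dotv (R : realType) (d : nat) (u w : 'rV[R]_d) : R :=
  \sum_(i < d) u 0 i * w 0 i.

Definition enorm (R : realType) (d : nat) (u : 'rV[R]_d) : R :=
  Num.sqrt (dotv u u).

Definition eucl_dist (R : realType) (d : nat) (p q : 'rV[R]_d) : R :=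
  enorm (p - q).

(* For open U and finite-dimensional V, this is the usual C^n class: f is C^n
   iff it is differentiable and all its directional derivatives are C^(n-1). *)
Fixpoint Cn_on (R : realType) (V W : normedModType R) (n : nat)
    (U : set V) (f : V -> W) : Prop :=
  match n with
  | 0 => forall x, U x -> {for x, continuous f}
  | m.+1 => (forall x, U x -> differentiable f x) /\
            (forall v : V, Cn_on m U (fun x => 'D_v f x))
  end.

Definition smooth_on (R : realType) (V W : normedModType R)
    (U : set V) (f : V -> W) : Prop :=
  forall n, Cn_on n U f.

Definition in_coord_slice (R : realType) (d k : nat) (y : 'rV[R]_d) : Prop :=
  forall i : 'I_d, (k <= i)%N -> y 0 i = 0.

(* Embedded k-submanifold without boundary, through slice charts: around each
   point of S there is a diffeomorphism phi : U -> V between open sets of R^d,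
   with inverse psi, that straightens S `&` U to V `&` (R^k x 0). *)
Definition embedded_submanifold (R : realType) (d k : nat)
    (S : set 'rV[R]_d) : Prop :=
  forall p, S p ->
  exists (U V : set 'rV[R]_d) (phi psi : 'rV[R]_d -> 'rV[R]_d),
    [/\ open U, open V & U p] /\
    [/\ smooth_on U phi, smooth_on V psi,
        (forall x, U x -> V (phi x) /\ psi (phi x) = x),
        (forall y, V y -> U (psi y) /\ phi (psi y) = y) &
        (forall x, U x -> (S x <-> in_coord_slice k (phi x)))].

Definition bounded_smooth_manifold (R : realType) (d k : nat)
    (S : set 'rV[R]_d) : Prop :=
  compact S /\ embedded_submanifold k S.

(* Velocities at p of smooth curves in S passing through p. *)
Definition tangent_vector (R : realType) (d : nat) (S : set 'rV[R]_d)
    (p u : 'rV[R]_d) : Prop :=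
  exists (e : R) (g : R -> 'rV[R]_d),
    [/\ 0 < e, smooth_on `]- e, e[%classic g, g 0 = p,
        (forall t, - e < t < e -> S (g t)) & is_derive (0 : R) (1 : R) g u].

Definition tangent_flat (R : realType) (d : nat) (S : set 'rV[R]_d)
    (p : 'rV[R]_d) : set 'rV[R]_d :=
  [set p + u | u in tangent_vector S p].

Definition normal_flat (R : realType) (d : nat) (S : set 'rV[R]_d)
    (p : 'rV[R]_d) : set 'rV[R]_d :=
  [set q | forall t, tangent_flat S p t -> dotv (q - p) (t - p) = 0].

Definition nearest_point (R : realType) (d : nat) (S : set 'rV[R]_d)
    (x y : 'rV[R]_d) : Prop :=
  S y /\ forall z, S z -> eucl_dist x y <= eucl_dist x z.

Definition medial_axis (R : realType) (d : nat) (S : set 'rV[R]_d) :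
    set 'rV[R]_d :=
  closure [set x | exists y z,
    [/\ nearest_point S x y, nearest_point S x z & y <> z]].

(* The infimum is a minimum, the medial axis being closed (and nonempty for a
   compact manifold without boundary of dimension at least 1). *)
Definition lfs (R : realType) (d : nat) (S : set 'rV[R]_d)
    (p : 'rV[R]_d) : R :=
  inf [set eucl_dist p m | m in medial_axis S].

Definition nondegenerate_triangle (R : realType) (d : nat)
    (v v' v'' : 'rV[R]_d) : Prop :=
  free [:: v' - v; v'' - v].

Definition triangle (R : realType) (d : nat) (v v' v'' : 'rV[R]_d) :
    set 'rV[R]_d :=
  [set x | exists a b c : R,
    [/\ 0 <= a, 0 <= b, 0 <= c, a + b + c = 1
      & x = a *: v + b *: v' + c *: v'']].

Definition triangle_plane (R : realType) (d : nat) (v v' v'' : 'rV[R]_d) :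
    set 'rV[R]_d :=
  [set x | exists a b c : R,
    a + b + c = 1 /\ x = a *: v + b *: v' + c *: v''].

Definition is_circumradius (R : realType) (d : nat) (v v' v'' : 'rV[R]_d)
    (r : R) : Prop :=
  exists o, triangle_plane v v' v'' o /\
    [/\ eucl_dist o v = r, eucl_dist o v' = r & eucl_dist o v'' = r].

Definition triangle_normal_flat (R : realType) (d : nat)
    (v v' v'' : 'rV[R]_d) : set 'rV[R]_d :=
  [set x | eucl_dist x v = eucl_dist x v' /\ eucl_dist x v = eucl_dist x v''].

Definition is_flat (R : realType) (d : nat) (m : nat) (F : set 'rV[R]_d) :
    Prop :=
  exists (p : 'rV[R]_d) (L : {vspace 'rV[R]_d}),
    \dim L = m /\ F = [set p + u | u in [set u | u \in L]].

(* Meaningful only when F is a flat; the default value 0 is junk. *)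
Definition flat_dim (R : realType) (d : nat) (F : set 'rV[R]_d) : nat :=
  xget 0%N [set m | is_flat m F].

(* A line is given by a direction vector u <> 0; only directions matter for
   angles, so "l ranges over the lines contained in F" becomes "u ranges over
   the directions of the lines contained in F". *)
Definition line_direction (R : realType) (d : nat) (F : set 'rV[R]_d) :
    set 'rV[R]_d :=
  [set u | u != 0 /\ exists p, forall t : R, F (p + t *: u)].

Definition line_angle (R : realType) (d : nat) (u w : 'rV[R]_d) : R :=
  acos (`|dotv u w| / (enorm u * enorm w)).

(* Max over lines of F of the min over lines of G (both extrema attained for
   flats of positive dimension). *)
Definition directed_angle (R : realType) (d : nat) (F G : set 'rV[R]_d) : R :=
  sup [set inf [set line_angle u w | w in line_direction G]
      | u in line_direction F].

Definition flat_angle (R : realType) (d : nat) (F G : set 'rV[R]_d) : R :=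
  if (flat_dim F <= flat_dim G)%N then directed_angle F G
  else directed_angle G F.

Definition cot (R : realType) (x : R) : R := cos x / sin x.

Definition eta1 (R : realType) (delta : R) : R :=
  acos (1 - delta ^+ 2 / (2 * Num.sqrt (1 - delta ^+ 2))).

Definition eta2 (R : realType) (delta : R) : R :=
  acos (Num.sqrt (1 - delta ^+ 2 / Num.sqrt (1 - delta ^+ 2))).

(* c is the codimension. *)
Definition eta_bound (R : realType) (c : nat) (delta : R) : R :=
  if c == 1%N then eta1 delta else eta2 delta.

(* Outside these ranges the total functions above return meaningless values. *)
Definition eta_defined (R : realType) (c : nat) (delta : R) : Prop :=
  0 <= delta /\
  delta < (if c == 1%N then Num.sqrt (4 * Num.sqrt 5 - 8)
           else Num.sqrt ((Num.sqrt 5 - 1) / 2)).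

Definition asin_defined (R : realType) (y : R) : Prop := - 1 <= y <= 1.

(* Main.v *)
Require Import Defs.
From HB Require Import structures.
From mathcomp Require Import all_boot all_order all_algebra.
From mathcomp Require Import all_classical all_reals all_analysis.
From mathcomp Require Import ring lra.
Import Order.TTheory GRing.Theory Num.Theory.
Import numFieldNormedType.Exports.
Local Open Scope classical_set_scope.
Local Open Scope ring_scope.
Set Implicit Arguments.
Unset Strict Implicit.
Unset Printing Implicit Defensive.

(* If an empty ball touches the manifold at x and its centre is not on the medial
   axis, the ball can be enlarged; hence for every unit normal n at x and every
   vertex p the balls tangent at x whose centres are within lfs(p) of p are empty.

   Normal variation: scale so that p = 0 and lfs(p) = 1. Among pairs (x, m) with m a
   unit normal at x, consider m . tau + (m . x)^2 / (2 |x|) - (|x| + 0.11 |x|^3),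
   where tau is a unit tangent at 0. At a maximum with positive value, move x
   towards 0 along the manifold and project m onto the new normal space: the empty
   balls on both sides of x bound the rotation of m, and the value increases. So
   m . tau <= |x| + 0.11 |x|^3, which is at most sin eta_1 and sin eta_2.

   Triangle: averaging |w - y|^2 over the vertices w with the barycentric weights of
   x, for y on the ray from the nearest point through x, shows that the empty ball
   can be swept far enough to give |w - xt| <= 2 R for all vertices and
   |w - xt| <= sqrt 2 R for the vertex nearest to x. At a vertex with angle psi the
   normals make with the plane of the triangle an angle whose sine is at most
   kappa max(1, cot(psi / 2)). Either the angle at the nearest vertex is at least phi,
   or another angle is at least 90 - phi / 2 degrees; the two terms of the maximum
   correspond to these cases. *)

(** The rotation of the normals is bounded by a maximum principle instead of an integration along a
    path: one small step from a maximiser is enough, so neither geodesics nor a flow has to be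
    constructed. The obstacle is that the two balls at x have different radii when m . x is not 0,
    and the bound on the rotation then contains a cross term of first order in m . x. The first
    variation of (m . x)^2 / (2 |x|) is proportional to the same cross term; eliminating it leaves a
    concave quadratic in the speed of rotation.

    Constants: with D = delta^2, eta_1 is at most 90 degrees exactly when D <= 2 sqrt 2 - 2 =
    0.828..., hence the range D <= 0.83; beyond it the claimed bound exceeds 90 degrees and holds
    trivially. As sin eta_1 = delta + delta^3 / 8 + ..., with value 1 at delta = 0.910..., the cubic
    coefficient has to stay below 0.12; the value 0.11 respects this and still makes the ascent
    strict on the whole range.

    Angles between flats are reduced to inequalities n . t <= sin theta for unit vectors n normal at
    the nearest point and t in the plane of the triangle, which compose at a vertex like angles in
    the plane. *)

Lemma nbhs_distP {R : realType} {V : normedModType R} (x : V) (A : set V) :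
  nbhs x A <-> exists2 e, 0 < e & forall y, `|y - x| < e -> A y.
Proof.
have P := @nbhs_normP R V x A.
split=> [/P[e /= e0 eA]|[e e0 eA]].
  by exists e => // y yx; apply: eA => /=; rewrite distrC.
by apply/P; exists e => // y /=; rewrite distrC; apply: eA.
Qed.

(** * The Euclidean inner product, its norm and the topology *)

Section Euclid.
Context {R : realType} {d : nat}.
Implicit Types (u v w x y z : 'rV[R]_d) (a b t : R).

Lemma dotvC u w : dotv u w = dotv w u.
Proof. by apply: eq_bigr => i _; rewrite mulrC. Qed.

Lemma dotvDl u v w : dotv (u + v) w = dotv u w + dotv v w.
Proof. by rewrite -big_split; apply: eq_bigr => i _; rewrite mxE mulrDl. Qed.

Lemma dotvZl a u w : dotv (a *: u) w = a * dotv u w.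
Proof. by rewrite mulr_sumr; apply: eq_bigr => i _; rewrite mxE mulrA. Qed.

Lemma dotvDr u v w : dotv u (v + w) = dotv u v + dotv u w.
Proof. by rewrite dotvC dotvDl !(dotvC u). Qed.

Lemma dotvZr a u w : dotv u (a *: w) = a * dotv u w.
Proof. by rewrite dotvC dotvZl dotvC. Qed.

Lemma dotvNl u w : dotv (- u) w = - dotv u w.
Proof. by rewrite -scaleN1r dotvZl mulN1r. Qed.

Lemma dotvNr u w : dotv u (- w) = - dotv u w.
Proof. by rewrite dotvC dotvNl dotvC. Qed.

Lemma dotvBl u v w : dotv (u - v) w = dotv u w - dotv v w.
Proof. by rewrite dotvDl dotvNl. Qed.

Lemma dotvBr u v w : dotv u (v - w) = dotv u v - dotv u w.
Proof. by rewrite dotvDr dotvNr. Qed.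

Lemma dotv0l u : dotv 0 u = 0.
Proof. by rewrite -(scale0r u) dotvZl mul0r. Qed.

Lemma dotv0r u : dotv u 0 = 0.
Proof. by rewrite dotvC dotv0l. Qed.

Definition dotvE := (dotvDl, dotvDr, dotvBl, dotvBr, dotvNl, dotvNr,
  dotvZl, dotvZr, dotv0l, dotv0r).

Lemma dotv_ge0 u : 0 <= dotv u u.
Proof. by apply: sumr_ge0 => i _; rewrite -expr2 sqr_ge0. Qed.

Lemma dotv_eq0 u : (dotv u u == 0) = (u == 0).
Proof.
apply/eqP/eqP => [u0|->]; last by rewrite dotv0l.
apply/rowP => i; rewrite mxE; apply/eqP; rewrite -sqrf_eq0 expr2; apply/eqP.
by apply: (psumr_eq0P _ u0) => // j _; rewrite -expr2 sqr_ge0.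
Qed.

Lemma enorm_ge0 u : 0 <= enorm u.
Proof. exact: sqrtr_ge0. Qed.
Hint Resolve enorm_ge0 : core.

Lemma enorm_sqr u : enorm u ^+ 2 = dotv u u.
Proof. by rewrite sqr_sqrtr // dotv_ge0. Qed.

Lemma enorm_eq0 u : (enorm u == 0) = (u == 0).
Proof. by rewrite -dotv_eq0 -enorm_sqr sqrf_eq0. Qed.

Lemma enorm_gt0 u : (0 < enorm u) = (u != 0).
Proof. by rewrite lt_neqAle enorm_ge0 eq_sym enorm_eq0 andbT. Qed.

Lemma enorm0 : enorm (0 : 'rV[R]_d) = 0.
Proof. by apply/eqP; rewrite enorm_eq0. Qed.

Lemma enormZ a u : enorm (a *: u) = `|a| * enorm u.
Proof.
by rewrite /enorm !dotvE mulrA -expr2 sqrtrM ?sqr_ge0 // sqrtr_sqr.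
Qed.

Lemma enormN u : enorm (- u) = enorm u.
Proof. by rewrite -scaleN1r enormZ normrN1 mul1r. Qed.

Lemma enormB u v : enorm (u - v) = enorm (v - u).
Proof. by rewrite -enormN opprB. Qed.

Lemma enorm_le u a : 0 <= a -> (enorm u <= a) = (dotv u u <= a ^+ 2).
Proof. by move=> a0; rewrite -enorm_sqr ler_pXn2r ?nnegrE. Qed.

Lemma enorm_ge u a : 0 <= a -> (a <= enorm u) = (a ^+ 2 <= dotv u u).
Proof. by move=> a0; rewrite -enorm_sqr ler_pXn2r ?nnegrE. Qed.

Lemma enorm_eq u a : 0 <= a -> dotv u u = a ^+ 2 -> enorm u = a.
Proof. by move=> a0; rewrite /enorm => ->; rewrite sqrtr_sqr ger0_norm. Qed.

Lemma enorm_eqP u v : (enorm u = enorm v) <-> (dotv u u = dotv v v).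
Proof. by split=> [uv|]; [rewrite -!enorm_sqr uv|rewrite /enorm => ->]. Qed.

Lemma dotv_le u w : dotv u w <= enorm u * enorm w.
Proof.
have [->|u0] := eqVneq u 0; first by rewrite dotv0l enorm0 mul0r.
have [->|w0] := eqVneq w 0; first by rewrite dotv0r enorm0 mulr0.
have := dotv_ge0 (enorm w *: u - enorm u *: w).
rewrite !dotvE -!enorm_sqr (dotvC w u).
move: u0 w0; rewrite -!enorm_gt0.
move: (enorm u) (enorm w) (dotv u w) => p q s p0 q0.
move=> h; have : 0 <= (2 * p * q) * (p * q - s) by lra.
by rewrite pmulr_rge0 ?subr_ge0 // !mulr_gt0.
Qed.

Lemma dotv_norm_le u w : `|dotv u w| <= enorm u * enorm w.
Proof.
by rewrite ler_norml dotv_le andbT lerNl -dotvNl -(enormN u) dotv_le.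
Qed.

Lemma enormD_le u v : enorm (u + v) <= enorm u + enorm v.
Proof.
rewrite enorm_le ?addr_ge0 // !dotvE -!enorm_sqr (dotvC v u).
have := dotv_le u v; nra.
Qed.

Lemma enormB_le u v : enorm (u - v) <= enorm u + enorm v.
Proof. by rewrite -(enormN v) enormD_le. Qed.

Lemma enormB_ge u v : enorm u - enorm v <= enorm (u - v).
Proof. by rewrite lerBlDr -{1}(subrK v u) enormD_le. Qed.

Lemma eucl_distC x y : eucl_dist x y = eucl_dist y x.
Proof. exact: enormB. Qed.

Lemma eucl_dist_ge0 x y : 0 <= eucl_dist x y.
Proof. exact: enorm_ge0. Qed.

Lemma eucl_dist_triangle y x z :
  eucl_dist x z <= eucl_dist x y + eucl_dist y z.
Proof.
by rewrite /eucl_dist -{1}(subrK y x) -addrA enormD_le.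
Qed.

Lemma norm_le_enorm u : `|u| <= enorm u.
Proof.
rewrite -[`|u|]/(mx_norm u) mx_normrE; apply/bigmax_leP; split=> // -[i j] _ /=.
rewrite -(ler_pXn2r (ltn0Sn 1)) ?nnegrE ?enorm_ge0 // enorm_sqr.
rewrite (ord1 i) /dotv (bigD1 j) //= real_normK ?num_real // expr2 lerDl.
by apply: sumr_ge0 => k _; rewrite -expr2 sqr_ge0.
Qed.

Lemma enorm_le_norm u : enorm u <= d%:R * `|u|.
Proof.
rewrite enorm_le ?mulr_ge0 // exprMn.
apply: (@le_trans _ _ (\sum_(i < d) `|u| ^+ 2)).
  apply: ler_sum => i _; rewrite -expr2 -real_normK ?num_real //.
  rewrite ler_pXn2r ?nnegrE // -[`|u|]/(mx_norm u).
  by rewrite mx_normrE (le_bigmax _ (fun ij => `|u ij.1 ij.2|) (0, i)).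
rewrite sumr_const card_ord -[leLHS]mulr_natl ler_wpM2r ?sqr_ge0 //.
by rewrite -natrX ler_nat; case: (d) => // n; rewrite leq_pmulr.
Qed.

Lemma nbhs_enormP x (A : set 'rV[R]_d) :
  nbhs x A <-> exists2 e, 0 < e & forall y, enorm (y - x) < e -> A y.
Proof.
split=> [/nbhs_distP[e e0 eA]|[e e0 eA]].
  exists e => // y yx; apply: eA.
  by apply: le_lt_trans (norm_le_enorm _) yx.
(* [d.+1] instead of [d] keeps the quotient positive when d = 0. *)
apply/nbhs_distP; exists (e / d.+1%:R) => [|y].
  by rewrite divr_gt0.
rewrite ltr_pdivlMr ?ltr0n // => yx; apply: eA.
apply: le_lt_trans (enorm_le_norm _) _.
apply: le_lt_trans yx; rewrite mulrC ler_wpM2l // ler_nat; exact: leqnSn.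
Qed.

Lemma closureE_enorm (A : set 'rV[R]_d) x :
  closure A x <-> forall e, 0 < e -> exists2 y, A y & enorm (y - x) < e.
Proof.
split=> [clA e e0|h B /nbhs_enormP[e e0 eB]].
  have /clA[y [Ay ye]] : nbhs x [set y | enorm (y - x) < e].
    by apply/nbhs_enormP; exists e.
  by exists y.
by have [y Ay ye] := h e e0; exists y; split=> //; exact: eB.
Qed.

Lemma continuous_enormP (f : 'rV[R]_d -> R) x :
  (forall e, 0 < e -> exists2 del, 0 < del &
    forall y, enorm (y - x) < del -> `|f y - f x| < e) ->
  {for x, continuous f}.
Proof.
move=> h A /(@nbhs_distP R R)[e e0 eA]; have [del del0 hd] := h e e0.
by apply/nbhs_enormP; exists del => // y /hd /eA.
Qed.

Lemma lipschitz_continuous_enorm (f : 'rV[R]_d -> R) (C : R) :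
  (forall x y, `|f y - f x| <= C * enorm (y - x)) -> continuous f.
Proof.
move=> h x; apply: continuous_enormP => e e0.
exists (e / (`|C| + 1)); first by rewrite divr_gt0 // ltr_wpDl.
move=> y; rewrite ltr_pdivlMr ?ltr_wpDl // => yx.
apply: le_lt_trans (h x y) _; apply: le_lt_trans yx.
rewrite mulrC ler_wpM2l //; apply: le_trans (ler_norm C) _.
by rewrite lerDl.
Qed.

Lemma continuous_dotvl w : continuous (fun u => dotv u w).
Proof.
apply: (@lipschitz_continuous_enorm _ (enorm w)) => x y.
by rewrite -dotvBl mulrC dotv_norm_le.
Qed.

Lemma enormBB x y z : `|enorm (y - z) - enorm (x - z)| <= enorm (y - x).
Proof.
rewrite ler_norml lerBlDr lerNl opprB lerBlDr; apply/andP; split.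
  rewrite (enormB y x); have := enormD_le (x - y) (y - z).
  by rewrite addrA subrK.
by have := enormD_le (y - x) (x - z); rewrite addrA subrK.
Qed.

Lemma continuous_enorm_dist z : continuous (fun x => enorm (x - z)).
Proof.
apply: (@lipschitz_continuous_enorm _ 1) => x y; rewrite mul1r; exact: enormBB.
Qed.

End Euclid.
#[export] Hint Resolve enorm_ge0 : core.

(** * Empty balls touching a compact set, and its medial axis *)

Section Medial.
Context {R : realType} {d : nat} (S : set 'rV[R]_d).
Implicit Types (u v w x y z : 'rV[R]_d) (a b t : R).

(** Expanding the squares makes emptiness of a ball tangent at x an inequality linear in t. In this
    form it passes to smaller radii and to suprema. *)
Lemma nearest_pointE x u t :
  nearest_point S (x + t *: u) x <->
  S x /\ forall z, S z -> 2 * t * dotv u (z - x) <= dotv (z - x) (z - x).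
Proof.
have E z : (eucl_dist (x + t *: u) x <= eucl_dist (x + t *: u) z) =
    (2 * t * dotv u (z - x) <= dotv (z - x) (z - x)).
  rewrite /eucl_dist addrAC subrr add0r enorm_le ?enorm_ge0 // enorm_sqr.
  rewrite !dotvE (dotvC x u) (dotvC z u) (dotvC z x).
  by apply/idP/idP => h; lra.
by split=> -[Sx h]; split=> // z /h; rewrite E.
Qed.

Hypothesis cS : compact S.

Lemma nearest_point_exists y : S !=set0 -> exists z, nearest_point S y z.
Proof.
move=> S0; have [|z Sz zmin] := @compact_EVT_min _ R (fun z => enorm (z - y)) S S0 cS.
  exact/continuous_subspaceT/continuous_enorm_dist.
exists z; split; first by rewrite inE in Sz.
by move=> w Sw; rewrite /eucl_dist !(enormB y) zmin // inE.
Qed.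

Definition unique_nearest y :=
  forall z w, nearest_point S y z -> nearest_point S y w -> z = w.

Lemma not_medial_axisP y : ~ medial_axis S y ->
  exists2 e, 0 < e & forall z, enorm (z - y) < e -> unique_nearest z.
Proof.
move=> yM; apply: contrapT => H; apply: yM; apply/closureE_enorm => e e0.
apply: contrapT => H'; apply: H; exists e => // z ze p q np nq.
by apply: contrapT => pq; apply: H'; exists z => //; exists p, q.
Qed.

Lemma nearest_point_stable y p e : nearest_point S y p -> unique_nearest y ->
  0 < e -> exists2 del, 0 < del & forall z q, enorm (z - y) < del ->
    nearest_point S z q -> enorm (q - p) < e.
Proof.
move=> [Sp np] uy e0; pose K := [set z | S z /\ e <= enorm (z - p)].
have cK : compact K.
  apply: (@subclosed_compact _ K S) => // [|z []//].
  have -> : K = S `&` [set z | e <= enorm (z - p)] by [].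
  apply: closedI; first exact: (compact_closed (@norm_hausdorff _ _) cS).
  apply: (@preimage_closed _ R (fun z => enorm (z - p)) [set t | e <= t]).
    by move=> z _; exact: continuous_enorm_dist.
  exact: closed_ge.
have [[w Kw]|K0] := pselect (K !=set0); last first.
  exists 1 => // z q _ [Sq _]; rewrite ltNge; apply/negP => qe.
  by apply: K0; exists q.
have [||z Kz zmin] := @compact_EVT_min _ R (fun z => enorm (z - y)) K _ cK.
- by exists w.
- exact/continuous_subspaceT/continuous_enorm_dist.
rewrite inE in Kz; case: Kz => Sz ez.
have lt : eucl_dist y p < eucl_dist y z.
  rewrite lt_neqAle np // andbT; apply/eqP => E.
  have zp : z = p by apply: uy; split=> // q /np; rewrite E.
  by move: ez; rewrite zp subrr enorm0 leNgt e0.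
exists ((eucl_dist y z - eucl_dist y p) / 2) => [|x q xy [Sq nq]].
  by rewrite divr_gt0 ?subr_gt0.
rewrite ltNge; apply/negP => qe.
have := zmin q; rewrite inE => /(_ (conj Sq qe)).
have := nq p Sp; have := eucl_dist_triangle x y q.
have := eucl_dist_triangle y x p.
move: lt xy; rewrite /eucl_dist !(enormB y); lra.
Qed.

Lemma distance_lipschitz y z p q : nearest_point S y p -> nearest_point S z q ->
  eucl_dist y p <= enorm (y - z) + eucl_dist z q.
Proof.
move=> [Sp np] [Sq nq]; apply: le_trans (np q Sq) _.
exact: eucl_dist_triangle.
Qed.

(* By stability of nearest points the foot q stays close to p, so the distance to S
   has slope 1 in the direction away from p. *)
Lemma distance_slope y p eta : nearest_point S y p -> unique_nearest y ->
  0 < eucl_dist y p -> 0 < eta ->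
  exists2 tau, 0 < tau & forall h q, 0 < h < tau ->
    nearest_point S (y + h *: ((eucl_dist y p)^-1 *: (y - p))) q ->
    eucl_dist y p + h * (1 - eta) <=
      eucl_dist (y + h *: ((eucl_dist y p)^-1 *: (y - p))) q.
Proof.
move=> np uy; set D := eucl_dist y p; set g := D^-1 *: (y - p) => D0 eta0.
have g1 : enorm g = 1 by rewrite enormZ gtr0_norm ?invr_gt0 // mulVf ?gt_eqF.
have e0 : 0 < eta * D / 2 by rewrite divr_gt0 // mulr_gt0.
have [del del0 hdel] := nearest_point_stable np uy e0.
exists del => // h q /andP[h0 hd] nq.
have {hdel} qp : enorm (q - p) < eta * D / 2.
  apply: hdel nq; rewrite addrAC subrr add0r enormZ g1 mulr1 gtr0_norm //.
have [Sp mp] := np; have [Sq mq] := nq.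
have Dq : D <= eucl_dist y q by apply: mp.
have Dq' : eucl_dist y q <= D + enorm (q - p).
  by rewrite -[enorm (q - p)]/(eucl_dist q p) (eucl_distC q); exact: eucl_dist_triangle.
have gq : D - enorm (q - p) <= dotv g (y - q).
  have -> : y - q = D *: g - (q - p).
    by rewrite scalerA divff ?gt_eqF // scale1r opprB addrA subrK.
  rewrite dotvBr dotvZr -enorm_sqr g1 expr1n mulr1 lerD2l lerN2.
  by have := dotv_le g (q - p); rewrite g1 mul1r.
(* The component along y - q bounds the new distance from below; dividing by |y - q|, which lies
   between D and D + |q - p|, gives the slope. *)
have := dotv_le (y + h *: g - q) (y - q).
rewrite -[enorm (y - q)]/(eucl_dist y q) -/(eucl_dist _ q) addrAC dotvDl -enorm_sqr.
rewrite -[enorm (y - q)]/(eucl_dist y q) dotvZl.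
move: (eucl_dist (y + h *: g) q) gq Dq Dq' qp (eucl_dist_ge0 y q).
move: (eucl_dist y q) (dotv g (y - q)) (enorm (q - p)) (enorm_ge0 (q - p)).
move=> w s r r0 X gq Dq Dq' qp w0 HX.
have w1 : 0 < w by apply: lt_le_trans Dq.
rewrite -(ler_pM2r w1); apply: le_trans HX.
have : h * ((1 - eta) * w) <= h * s.
  rewrite ler_pM2l //; nra.
have : D * w <= w ^+ 2 by rewrite expr2 ler_pM2r.
lra.
Qed.

(** The maximum of the distance D to S over a small ball around c exceeds D c by the full radius s.
    Equality in the triangle inequality then puts the maximiser on the ray from x through c and
    makes x nearest to it. This replaces following the gradient flow of D. *)
Lemma nearest_point_extend c x : nearest_point S c x -> c != x ->
  ~ medial_axis S c ->
  exists2 s, 0 < s & nearest_point S (c + s *: (c - x)) x.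
Proof.
move=> ncx cx /not_medial_axisP[e0 e00 uniq].
have S0 : S !=set0 by exists x; case: ncx.
have [pi_ npi] : {f | forall y, nearest_point S y (f y)}.
  by exists (fun y => projT1 (cid (nearest_point_exists y S0))) => y; case: cid.
have [D DE] : {D : 'rV[R]_d -> R | forall y, D y = eucl_dist y (pi_ y)}.
  by exists (fun y => eucl_dist y (pi_ y)).
have Dlip y z : D y <= enorm (y - z) + D z.
  by rewrite !DE; exact: distance_lipschitz.
have Dle y p : nearest_point S y p -> D y = eucl_dist y p.
  move=> [Sp np]; apply/eqP; rewrite DE eq_le np; last by case: (npi y).
  by rewrite andbT; case: (npi y) => _; apply.
have Dcont : continuous D.
  apply: (@lipschitz_continuous_enorm _ _ _ 1) => y z; rewrite mul1r.
  rewrite ler_norml; have := Dlip y z; have := Dlip z y.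
  rewrite (enormB y z); lra.
have Dc : D c = eucl_dist c x by apply: Dle.
have Dc0 : 0 < D c by rewrite Dc /eucl_dist enorm_gt0 subr_eq0.
have [s s0 se] : exists2 s, 0 < s & s < e0 by exists (e0 / 2); lra.
pose B := [set y | enorm (y - c) <= s].
have cB : compact B.
  apply: bounded_closed_compact.
    exists (s + enorm c); split=> [|M sM y By /=]; first exact: num_real.
    apply: le_trans (norm_le_enorm _) _; apply: le_trans (ltW sM).
    rewrite -{1}(subrK c y); apply: le_trans (enormD_le _ _) _.
    by rewrite lerD2r.
  apply: (@preimage_closed _ R (fun z => enorm (z - c)) [set t | t <= s]).
    by move=> z _; exact: continuous_enorm_dist.
  exact: closed_le.
have Bc : B c by rewrite /B /= subrr enorm0 ltW.
have B0 : B !=set0 by exists c.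
(* A maximiser of [Phi] inside the open ball could be improved by [distance_slope], whose slope 1 -
   eta / 2 beats the penalty 1 - eta; so it lies on the sphere. *)
have growth eta : 0 < eta -> eta < 1 -> exists2 y, B y & D c + (1 - eta) * s <= D y.
  move=> eta0 eta1; pose Phi y := D y - (1 - eta) * enorm (y - c).
  have [|y By ymax] := @compact_EVT_max _ R Phi B B0 cB.
    apply/continuous_subspaceT/(@lipschitz_continuous_enorm _ _ _ 2) => z w.
    have := enormBB z w c; have := Dlip z w; have := Dlip w z.
    rewrite /Phi (enormB z w).
    have : `|(1 - eta) * (enorm (w - c) - enorm (z - c))| <=
           `|enorm (w - c) - enorm (z - c)|.
      by rewrite normrM ler_piMl // ger0_norm; lra.
    move=> H1 H2 H3 H4; have {H1 H4} := le_trans H1 H4.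
    rewrite mulrBr !ler_norml => /andP[H1 H1']; apply/andP; split; lra.
  rewrite inE in By; exists y => //.
  have := ymax c; rewrite inE => /(_ Bc); rewrite /Phi subrr enorm0 mulr0 subr0.
  move=> Dcy; have [ys|ys] := leP s (enorm (y - c)).
    have -> : s = enorm (y - c) by apply/eqP; rewrite eq_le ys.
    lra.
  exfalso.
  have Dy0 : 0 < D y.
    have : 0 <= (1 - eta) * enorm (y - c).
      by apply: mulr_ge0; [lra|exact: enorm_ge0].
    lra.
  have Dy1 : 0 < eucl_dist y (pi_ y) by rewrite -DE.
  have uy : unique_nearest y.
    by apply: uniq; exact: lt_trans se.
  have eta20 : 0 < eta / 2 by rewrite divr_gt0.
  have [tau tau0 slope] := distance_slope (npi y) uy Dy1 eta20.
  pose h := Num.min (tau / 2) (s - enorm (y - c)).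
  have h0 : 0 < h by rewrite lt_min divr_gt0 // subr_gt0.
  have htau : h < tau.
    by apply: le_lt_trans (_ : tau / 2 < _); [rewrite ge_min lexx|lra].
  have hs : h <= s - enorm (y - c) by rewrite ge_min lexx orbT.
  set z := y + h *: ((eucl_dist y (pi_ y))^-1 *: (y - pi_ y)).
  have := slope h (pi_ z); rewrite h0 htau => /(_ isT (npi z)).
  rewrite -/z -!DE => Dz.
  have zy : enorm (z - y) = h.
    rewrite /z addrAC subrr add0r !enormZ !gtr0_norm ?invr_gt0 //.
    by rewrite -/(eucl_dist y _) mulVf ?mulr1 // gt_eqF.
  have zc : enorm (z - c) <= h + enorm (y - c).
    by rewrite -zy; exact: (eucl_dist_triangle y).
  have Bz : B z by rewrite /B /=; lra.
  have := ymax z; rewrite inE => /(_ Bz); rewrite /Phi.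
  have : (1 - eta) * enorm (z - c) <= (1 - eta) * (h + enorm (y - c)).
    by apply: ler_wpM2l => //; lra.
  have : 0 < h * eta by apply: mulr_gt0.
  lra.
have [|y By ymax] := @compact_EVT_max _ R D B B0 cB.
  exact/continuous_subspaceT.
rewrite inE in By.
have Dys : D c + s <= D y.
  rewrite leNgt; apply/negP => lt.
  (* Makes eta * s at most half of the supposed shortfall, which contradicts [growth]. *)
  pose eta := Num.min (1 / 2) ((D c + s - D y) / (2 * s)).
  have eta0 : 0 < eta by rewrite lt_min !divr_gt0 ?mulr_gt0 ?subr_gt0.
  have eta1 : eta < 1.
    by apply: le_lt_trans (_ : 1 / 2 < _); [rewrite ge_min lexx|lra].
  have etas : eta * s <= (D c + s - D y) / 2.
    apply: le_trans (_ : (D c + s - D y) / (2 * s) * s <= _).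
      by rewrite ler_pM2r // ge_min lexx orbT.
    rewrite le_eqVlt; apply/orP; left; apply/eqP; field.
    by rewrite gt_eqF.
  have [z Bz zD] := growth _ eta0 eta1.
  have := ymax z; rewrite inE => /(_ Bz); lra.
have Sx : S x by case: ncx.
have yx : D y <= eucl_dist y x by rewrite DE; case: (npi y) => _; apply.
have yx' : eucl_dist y x <= enorm (y - c) + D c.
  by rewrite Dc; exact: eucl_dist_triangle.
have nyx : nearest_point S y x.
  split=> // z Sz; apply: le_trans (_ : D y <= _).
    by rewrite /B /= in By; lra.
  by rewrite DE; case: (npi y) => _; apply.
exists (s / D c); first exact: divr_gt0.
(* Now |y - c| = s and |y - x| = s + |c - x|, which is the equality case of the triangle
   inequality. *)
suff E : y - c = (s / D c) *: (c - x) by rewrite -E addrC subrK.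
apply/eqP; rewrite -subr_eq0 -dotv_eq0; apply/eqP.
have yc : enorm (y - c) ^+ 2 = s ^+ 2.
  by congr (_ ^+ 2); move: By; rewrite /B /=; lra.
have yx2 : eucl_dist y x ^+ 2 = (s + D c) ^+ 2.
  by congr (_ ^+ 2); move: By; rewrite /B /=; lra.
have cx2 : dotv (c - x) (c - x) = D c ^+ 2 by rewrite Dc enorm_sqr.
move: yx2 yc cx2; rewrite /eucl_dist !enorm_sqr.
have -> : y - x = (y - c) + (c - x) by rewrite addrA subrK.
move: (y - c) (c - x) => A C; rewrite !dotvE (dotvC C A) => H AA CC.
have AC : dotv A C = s * D c by lra.
rewrite AA AC CC; field; by rewrite gt_eqF.
Qed.

(** The radii of empty balls contain their supremum T; if T < t0, the centre is off the medial axis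
    and [nearest_point_extend] passes beyond T. *)
Lemma nearest_point_sweep x u h t0 : dotv u u = 1 -> 0 < h -> 0 <= t0 ->
  nearest_point S (x + h *: u) x ->
  (forall t, h <= t < t0 -> ~ medial_axis S (x + t *: u)) ->
  nearest_point S (x + t0 *: u) x.
Proof.
move=> u1 h0 t00 nh noM.
have mono t t' : t' <= t -> 0 <= t' -> nearest_point S (x + t *: u) x ->
    nearest_point S (x + t' *: u) x.
  move=> tt t'0 /nearest_pointE[Sx H]; apply/nearest_pointE; split=> // z Sz.
  have [a0|a0] := leP 0 (dotv u (z - x)).
    apply: le_trans (H z Sz); rewrite ler_wpM2r // ler_wpM2l //.
  apply: le_trans (dotv_ge0 _); apply: mulr_ge0_le0; last exact: ltW.
  exact: mulr_ge0.
have [t0h|ht0] := leP t0 h; first exact: mono nh.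
pose E := [set t | h <= t <= t0 /\ nearest_point S (x + t *: u) x].
have Eh : E h by split=> //; rewrite lexx ltW.
have E0 : E !=set0 by exists h.
have Eub : ubound E t0 by move=> t [/andP[]].
have sE : has_sup E by split=> //; exists t0.
pose T := sup E.
have hT : h <= T by apply: ub_le_sup => //; exists t0.
have Tt0 : T <= t0 by apply: ge_sup.
have Sx : S x by case: nh.
have nT : nearest_point S (x + T *: u) x.
  apply/nearest_pointE; split=> // z Sz.
  have [a0|a0] := leP (dotv u (z - x)) 0.
    apply: le_trans (dotv_ge0 _); apply: mulr_ge0_le0 => //.
    by apply: mulr_ge0 => //; apply: le_trans hT; exact: ltW.
  rewrite -ler_pdivlMr // -ler_pdivlMl //; apply: ge_sup => // t [_].
  move=> /nearest_pointE[_ /(_ z Sz)].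
  by rewrite ler_pdivlMl // ler_pdivlMr.
move: Tt0; rewrite le_eqVlt => /predU1P[<- //|Tlt].
have T0 : 0 < T by apply: lt_le_trans hT.
have cx : x + T *: u != x.
  rewrite -subr_eq0 addrAC subrr add0r scaler_eq0 gt_eqF //=.
  by apply: contra_eq_neq u1 => ->; rewrite dotv0l eq_sym oner_eq0.
have [|s s0] := nearest_point_extend nT cx; first by apply: noM; rewrite hT.
have -> : x + T *: u + s *: (x + T *: u - x) = x + (T + s * T) *: u.
  by rewrite (addrAC x _ (- x)) subrr add0r scalerDl scalerA addrA.
move=> nTs.
have TsT : T < T + s * T by rewrite ltrDl mulr_gt0.
pose t1 := Num.min (T + s * T) t0.
have : E t1.
  split; last by apply: mono nTs; rewrite ?ge_min ?lexx // le_min !ltW // (lt_trans T0).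
  by rewrite le_min ge_min lexx orbT (ltW ht0) (le_trans hT) // ltW.
move=> /(ub_le_sup sE.2); rewrite -/T leNgt => /negP; case.
by rewrite lt_min TsT.
Qed.

End Medial.

(** * Differentials and maps of class C^n *)

Section Differentials.
Context {R : realType}.

Lemma differentiable_expansion (V W : normedModType R) (f : V -> W) x :
  differentiable f x -> forall e, 0 < e -> exists2 del, 0 < del &
    forall y, `|y - x| < del -> `|f y - f x - 'd f x (y - x)| <= e * `|y - x|.
Proof.
move=> df e e0; have /diff_locallyP[_ E] := df.
have /eqaddoP/(_ e e0) := E.
move=> /(@nbhs_distP R V)[del del0 H]; exists del => // y yx.
have := H (y - x); rewrite subr0 => /(_ yx) /=.
rewrite !fctE /= opprD addrA subrK. exact.
Qed.

Lemma diff_bounded (V W : normedModType R) (f : V -> W) x :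
  differentiable f x ->
  exists2 C, 0 < C & forall v, `|'d f x v| <= C * `|v|.
Proof.
move=> df; have [C C0 H] := linear_lipschitz (diff_continuous df).
by exists C.
Qed.

Lemma differentiable_lipschitz (V W : normedModType R) (f : V -> W) x :
  differentiable f x -> exists C del, [/\ 0 < C, 0 < del &
    forall y, `|y - x| < del -> `|f y - f x| <= C * `|y - x|].
Proof.
move=> df; have [C C0 HC] := diff_bounded df.
have [del del0 H] := differentiable_expansion df ltr01.
exists (C + 1), del; split=> // [|y /H yx]; first by rewrite addr_gt0.
rewrite -(subrK ('d f x (y - x)) (f y - f x)).
by apply: le_trans (ler_normD _ _) _; rewrite mulrDl addrC lerD.
Qed.

Lemma is_derive_line (V W : normedModType R) (f : V -> W) (a v : V) (s : R) :
  differentiable f (a + s *: v) ->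
  is_derive s (1 : R) (fun t : R => f (a + t *: v)) ('d f (a + s *: v) v).
Proof.
move=> df.
have dl : is_diff s (fun t : R => a + t *: v) (fun t => t *: v).
  have := @is_diffD R R^o V _ _ _ _ s (is_diff_cst a s) (is_diff_scalel s v).
  by rewrite add0r.
have dg : differentiable (f \o (fun t : R => a + t *: v)) s.
  exact: differentiable_comp.
apply: DeriveDef; first exact/diff_derivable.
rewrite [LHS]deriveE // diff_comp //=.
by rewrite diff_val scale1r.
Qed.

Lemma derive_affine (V0 V W : normedModType R) (f : V -> W) (L : {linear V0 -> V})
    (c : V) (z v : V0) :
  'D_v (fun z => f (c + L z)) z = 'D_(L v) f (c + L z).
Proof.
rewrite /derive; set g := (X in lim (X @ _)); set g' := (X in _ = lim (X @ _)).
suff -> : g = g' by [].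
by apply/funext => h; rewrite /g /g' /= (linearD L) (linearZ_LR L) /= addrCA.
Qed.

(** A directional derivative of the composite is a directional derivative of f composed with the
    same affine map, so the induction on n closes. It supplies the smooth curves that witness
    tangent vectors. *)
Lemma Cn_on_affine (V0 V W : normedModType R) (L : {linear V0 -> V}) (c : V) n
    (U : set V) (f : V -> W) : continuous L -> Cn_on n U f ->
  Cn_on n [set z | U (c + L z)] (fun z => f (c + L z)).
Proof.
move=> cL; have dL z : differentiable (fun z => c + L z) z.
  apply: differentiableD; first exact: differentiable_cst.
  exact: linear_differentiable.
elim: n f => [|n IH] f /=.
  move=> Hf z Uz; apply: (@continuous_comp _ _ _ (fun z => c + L z) f).
    exact: differentiable_continuous.
  exact: Hf.
move=> [df Df]; split=> [z Uz|v].
  by apply: (@differentiable_comp _ _ _ _ (fun z => c + L z) f) => //; exact: df.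
have -> : (fun z => 'D_v (fun z => f (c + L z)) z) =
    (fun z => (fun x => 'D_(L v) f x) (c + L z)).
  by apply/funext => z; rewrite derive_affine.
exact: (IH (fun x => 'D_(L v) f x) (Df (L v))).
Qed.

Lemma smooth_on_differentiable (V W : normedModType R) (U : set V) (f : V -> W) x :
  smooth_on U f -> U x -> differentiable f x.
Proof. by move=> /(_ 1%N)[+ _]; apply. Qed.

Lemma smooth_on_differentiable_derive (V W : normedModType R) (U : set V)
    (f : V -> W) x v :
  smooth_on U f -> U x -> differentiable (fun x => 'D_v f x) x.
Proof. by move=> /(_ 2%N)[_ /(_ v)[+ _]]; apply. Qed.

Lemma Cn_on_subset (V W : normedModType R) n (U U' : set V) (f : V -> W) :
  U' `<=` U -> Cn_on n U f -> Cn_on n U' f.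
Proof.
move=> UU; elim: n f => [|n IH] f /=; first by move=> H x /UU; exact: H.
by move=> [H1 H2]; split=> [x /UU|v]; [exact: H1|exact: IH].
Qed.

End Differentials.

(** * Local parametrizations of an embedded submanifold *)

Section LocalParametrization.
Context {R : realType}.

Lemma diff_local_id (V : normedModType R) (f : V -> V) x v :
  differentiable f x -> (\forall y \near x, f y = y) -> 'd f x v = v.
Proof.
move=> df /(@nbhs_distP R V)[r r0 fid]; apply/eqP; rewrite -subr_eq0 -normr_le0.
apply/ler_addgt0Pl => e e0; rewrite addr0.
have v1 : 0 < `|v| + 1 by rewrite ltr_wpDl.
have [del del0 H] := differentiable_expansion df (divr_gt0 e0 v1).
pose t := Num.min r del / 2 / (`|v| + 1).
have t0 : 0 < t by rewrite !divr_gt0 // lt_min r0.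
have tv : `|x + t *: v - x| < Num.min r del.
  rewrite addrAC subrr add0r normrZ gtr0_norm // /t mulrAC ltr_pdivrMr //.
  rewrite mulrAC ltr_pdivrMr // -mulrA ltr_pM2l ?lt_min ?r0 //.
  by rewrite mulr_natr mulr2n -addrA ltrDl addr_gt0 // ltr_wpDl.
clearbody t; have fx : f x = x by apply: fid; rewrite subrr normr0.
move: tv; rewrite lt_min => /andP[/fid E /H].
rewrite E fx (addrAC x _ (- x)) subrr add0r linearZ -scalerBr.
rewrite !normrZ !gtr0_norm // mulrCA ler_pM2l // distrC => /le_trans; apply.
by rewrite mulrAC ler_pdivrMr // mulrDr mulr1 lerDl ltW.
Qed.

Lemma linear_rV_bound m (W : normedModType R) (L : {linear 'rV[R]_m -> W}) z :
  `|L z| <= (\sum_i `|L (delta_mx 0 i)|) * `|z|.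
Proof.
rewrite [z in L z]row_sum_delta linear_sum /= mulr_suml.
apply: le_trans (ler_norm_sum _ _ _) _; apply: ler_sum => i _.
rewrite linearZ /= normrZ mulrC ler_wpM2l //.
rewrite -[`|z|]/(mx_norm z) mx_normrE.
exact: (le_bigmax _ (fun ij => `|z ij.1 ij.2|) (0, i)).
Qed.

Lemma linear_rV_continuous m (W : normedModType R) (L : {linear 'rV[R]_m -> W}) :
  continuous L.
Proof.
move=> z A /(@nbhs_distP R W)[e e0 eA]; apply/(@nbhs_distP R).
set C := \sum_i `|L (delta_mx 0 i)|.
have C0 : 0 <= C by apply: sumr_ge0.
have C1 : 0 < C + 1 by rewrite ltr_wpDl.
exists (e / (C + 1)) => [|y]; first exact: divr_gt0.
rewrite ltr_pdivlMr // => yz; apply: eA; rewrite -linearB.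
apply: le_lt_trans (linear_rV_bound _ _) _; apply: le_lt_trans yz.
by rewrite mulrC ler_wpM2l // lerDl.
Qed.

(** The inverse of a slice chart restricted to R^k. Of its smoothness only two derivatives are
    recorded; the linear bound in [lp_onto] turns errors in the parameter into errors in the
    distance to x, and tangent spaces are described at all nearby points because the normals will be
    compared there. *)
Record local_param (d k : nat) (S : set 'rV[R]_d) (x : 'rV[R]_d)
    (F : 'rV[R]_k -> 'rV[R]_d) (rad : R) : Prop := LocalParam {
  lp_rad : 0 < rad;
  lp_base : F 0 = x;
  lp_mem : forall z, `|z| < rad -> S (F z);
  lp_diff : forall z, `|z| < rad -> differentiable F z;
  lp_diff2 : forall z v, `|z| < rad -> differentiable (fun z => 'D_v F z) z;
  lp_onto : exists C del, [/\ 0 < C, 0 < del & forall y, S y -> `|y - x| < del ->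
    exists z, [/\ `|z| < rad, `|z| <= C * `|y - x| & F z = y]];
  lp_tangent : forall z u, `|z| < rad ->
    tangent_vector S (F z) u <-> exists v, u = 'd F z v;
  lp_inj : forall v, 'd F 0 v = 0 -> v = 0 }.

Lemma in_coord_sliceP d k (y : 'rV[R]_d) : (k <= d)%N ->
  in_coord_slice k y <-> exists z : 'rV[R]_k, y = z *m pid_mx k.
Proof.
move=> kd; split=> [yk|[z ->] i ki].
  exists (y *m pid_mx k); rewrite -mulmxA pid_mx_id //.
  apply/rowP => i; rewrite mxE (bigD1 i) //= !mxE eqxx /=.
  rewrite big1 ?addr0 => [|j ji].
    by have [ik|/yk ->] := ltnP i k; rewrite ?mulr1 ?mul0r.
  by rewrite !mxE -[X in X && _]/(j == i) (negbTE ji) mulr0.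
rewrite mxE big1 // => j _; rewrite !mxE.
have -> : (nat_of_ord j == i) = false.
  by apply/eqP => ji; move: (ltn_ord j); rewrite ji ltnNge ki.
by rewrite mulr0.
Qed.

(** Linearises f along a curve in S with velocity u; it serves to show that the slice chart sends
    tangent vectors into R^k. *)
Lemma tangent_vector_diff d (S : set 'rV[R]_d) (W : normedModType R)
    (f : 'rV[R]_d -> W) p u (A : set 'rV[R]_d) :
  tangent_vector S p u -> differentiable f p -> nbhs p A -> forall e, 0 < e ->
  exists2 r, 0 < r & forall t, 0 < t < r ->
    exists2 y, S y /\ A y & `|f y - f p - t *: 'd f p u| <= e * t.
Proof.
move=> [r [g [r0 _ <- gS [dg Dg]]]] df nA e e0.
have dg0 : differentiable g (0 : R) by apply/derivable1_diffP.
have dfg : differentiable (f \o g) (0 : R) by apply: differentiable_comp.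
have [del del0 H] := differentiable_expansion dfg e0.
have : nbhs (0 : R) [set t | A (g t)].
  exact: (differentiable_continuous dg0).
move=> /(@nbhs_distP R R)[s s0 sA].
exists (Num.min s (Num.min r del)) => [|t /andP[t0]].
  by rewrite !lt_min s0 r0.
rewrite !lt_min => /andP[ts /andP[tr tdel]]; exists (g t).
  split; last by apply: sA; rewrite subr0 gtr0_norm.
  by apply: gS; rewrite tr (lt_trans _ t0) // oppr_lt0.
have := H t; rewrite subr0 gtr0_norm // => /(_ tdel).
rewrite diff_comp //= -[X in 'd g 0 X]mulr1 -[t * 1]/(t *: 1) linearZ /=.
by rewrite -(deriveE _ dg0) Dg linearZ.
Qed.

Lemma local_param_exists d k (S : set 'rV[R]_d) x : (k <= d)%N ->
  embedded_submanifold k S -> S x -> exists F rad, @local_param d k S x F rad.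
Proof.
move=> kd + Sx => /(_ x Sx)[U [V [phi [psi [[oU oV Ux]]]]]].
move=> [sphi spsi phiU psiV slice].
have [L [L' [LK sliceP]]] : exists (L : {linear 'rV[R]_k -> 'rV[R]_d})
    (L' : {linear 'rV[R]_d -> 'rV[R]_k}), (forall z, L' (L z) = z) /\
    (forall y, in_coord_slice k y <-> exists z, y = L z).
  exists (mulmxr (pid_mx k : 'M[R]_(k, d))), (mulmxr (pid_mx k : 'M[R]_(d, k))).
  split; first by move=> z /=; rewrite -mulmxA pid_mx_id // pid_mx_1 mulmx1.
  by move=> y; exact: in_coord_sliceP.
have cL : continuous L by exact: linear_rV_continuous.
pose c := phi x; pose F z := psi (c + L z).
have Vc : V c by case: (phiU x Ux).
have [rad rad0 radV] : exists2 rad, 0 < rad & forall z, `|z| < rad -> V (c + L z).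
  have : nbhs (0 : 'rV[R]_k) [set z | V (c + L z)].
    have : {for 0, continuous (fun z => c + L z)}.
      apply: differentiable_continuous; apply: differentiableD.
        exact: differentiable_cst.
      exact: linear_differentiable.
    by apply; apply: open_nbhs_nbhs; split=> //=; rewrite linear0 addr0.
  move=> /(@nbhs_distP R)[r r0 H]; exists r => // z zr.
  by apply: H; rewrite subr0.
have [zc Ec] : exists z, c = L z by apply/sliceP/(slice _ Ux).
have FU z : `|z| < rad -> U (F z) by move=> /radV /psiV[].
have phiF z : `|z| < rad -> phi (F z) = c + L z by move=> /radV /psiV[].
have dpsi z : `|z| < rad -> differentiable psi (c + L z).
  by move=> /radV; exact: smooth_on_differentiable.
have dphi y : U y -> differentiable phi y by exact: smooth_on_differentiable.
have dA z : differentiable (fun z => c + L z) z.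
  by apply: differentiableD; [exact: differentiable_cst|exact: linear_differentiable].
have dF z : `|z| < rad -> differentiable F z.
  by move=> zr; apply: (@differentiable_comp _ _ _ _ (fun z => c + L z) psi) => //; exact: dpsi.
have dFE z v : `|z| < rad -> 'd F z v = 'd psi (c + L z) (L v).
  move=> zr; rewrite -!deriveE; [|exact: dpsi|exact: dF].
  exact: derive_affine.
have SF z : `|z| < rad -> S (F z).
  move=> zr; apply/(slice _ (FU _ zr)); rewrite phiF //; apply/sliceP.
  by exists (zc + z); rewrite linearD Ec.
have psiphi z u : `|z| < rad -> 'd psi (c + L z) ('d phi (F z) u) = u.
  move=> zr; have d1 := dphi _ (FU z zr).
  have d2 : differentiable psi (phi (F z)) by rewrite phiF //; exact: dpsi.
  rewrite -(phiF z zr) -[LHS]/(('d psi (phi (F z)) \o 'd phi (F z)) u).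
  rewrite -(diff_comp d1 d2); apply: diff_local_id.
    exact: differentiable_comp.
  have : nbhs (F z) U by apply: open_nbhs_nbhs; split=> //; exact: FU.
  by apply: filterS => y /phiU[].
have phipsi z u : `|z| < rad -> 'd phi (F z) ('d psi (c + L z) u) = u.
  move=> zr; have d1 := dpsi z zr; have d2 := dphi _ (FU z zr).
  rewrite -[LHS]/(('d phi (psi (c + L z)) \o 'd psi (c + L z)) u).
  rewrite -(diff_comp d1 d2); apply: diff_local_id.
    exact: differentiable_comp.
  have : nbhs (c + L z) V by apply: open_nbhs_nbhs; split=> //; exact: radV.
  by apply: filterS => y /psiV[].
exists F, rad; split=> //.
- by rewrite /F linear0 addr0; case: (phiU x Ux).
- move=> z v zr.
  have -> : (fun z => 'D_v F z) = (fun z => 'D_(L v) psi (c + L z)).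
    by apply/funext => y; exact: derive_affine.
  apply: (@differentiable_comp _ _ _ _ (fun z => c + L z) (fun y => 'D_(L v) psi y)).
    exact: dA.
  by apply: smooth_on_differentiable_derive spsi _; exact: radV.
- have [C [del [C0 del0 H]]] := differentiable_lipschitz (dphi x Ux).
  have [C' C'0 H'] := linear_lipschitz (@linear_rV_continuous _ _ L').
  have : nbhs x U by exact: open_nbhs_nbhs.
  move=> /(@nbhs_distP R)[r r0 rU].
  exists (C' * C), (Num.min (Num.min r del) (rad / (C' * C))).
  split; [exact: mulr_gt0|by rewrite !lt_min r0 del0 divr_gt0 // mulr_gt0|].
  move=> y Sy; rewrite !lt_min => /andP[/andP[/rU Uy /H yl] yr].
  have [zy Ey] : exists z, phi y = L z by apply/sliceP/(slice _ Uy).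
  have zE : `|zy - zc| <= C' * C * `|y - x|.
    rewrite -(LK (zy - zc)) -mulrA; apply: le_trans (H' _) _.
    by rewrite ler_pM2l // linearB -Ey -Ec.
  exists (zy - zc); split=> //.
    by apply: le_lt_trans zE _; rewrite mulrC -ltr_pdivlMr // mulr_gt0.
  by rewrite /F linearB -Ec -Ey addrC subrK; case: (phiU y Uy).
- move=> z u zr; split=> [tu|[v ->]].
    suff /sliceP[v Ev] : in_coord_slice k ('d phi (F z) u).
      by exists v; rewrite dFE // -Ev psiphi.
    (* The last coordinates of phi vanish on S, so those of its differential vanish on tangent
       vectors up to an arbitrary e. *)
    move=> i ki; apply/eqP; rewrite -normr_le0.
    apply/ler_addgt0Pl => e e0; rewrite addr0.
    have nU : nbhs (F z) U by apply: open_nbhs_nbhs; split=> //; exact: FU.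
    have [r r0 H] := tangent_vector_diff tu (dphi _ (FU _ zr)) nU e0.
    have r20 : 0 < r / 2 by rewrite divr_gt0.
    have [|y [Sy Uy]] := H (r / 2).
      by rewrite r20 gtr_pMr // invf_lt1 // ltr1n.
    set w := 'd phi (F z) u; set X := (X in `|X| <= _) => HX.
    have : `|X 0 i| <= e * (r / 2).
      apply: le_trans HX; rewrite -[leRHS]/(mx_norm X) mx_normrE.
      exact: (le_bigmax _ (fun ij => `|X ij.1 ij.2|) (0, i)).
    have slice0 y' : U y' -> S y' -> phi y' 0 i = 0.
      by move=> Uy' Sy'; apply: ((slice _ Uy').1 Sy').
    rewrite /X !mxE !slice0 //; [|exact: FU|exact: SF].
    by rewrite subrr add0r normrN normrM gtr0_norm // mulrC ler_pM2r.
  have v1 : 0 < `|v| + 1 by rewrite ltr_wpDl.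
  (* For times below e in absolute value the parameter z + t v stays in the domain; the [+ 1] covers
     v = 0. *)
  pose e := (rad - `|z|) / (`|v| + 1).
  have e0 : 0 < e by rewrite divr_gt0 // subr_gt0.
  have eP t : - e < t < e -> `|z + t *: v| < rad.
    rewrite -ltr_norml /e ltr_pdivlMr // => te.
    apply: le_lt_trans (ler_normD _ _) _; rewrite normrZ -ltrBrDl.
    by apply: le_lt_trans te; rewrite ler_wpM2l // lerDl.
  have EF t : F (z + t *: v) = psi (c + L z + t *: L v).
    by rewrite /F linearD addrA (linearZ_LR L).
  exists e, (fun t => F (z + t *: v)); split=> //.
  + have lin : linear (fun t : R^o => t *: L v).
      by move=> a t1 t2; rewrite scalerDl scalerA.
    pose M := HB.pack_for {linear R^o -> 'rV[R]_d} (fun t : R^o => t *: L v)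
      (GRing.isLinear.Build _ _ _ _ _ lin).
    move=> n; have -> : (fun t : R => F (z + t *: v)) =
        (fun t : R^o => psi ((c + L z) + M t)).
      by apply/funext => t; rewrite EF.
    apply: (@Cn_on_subset _ R^o _ n [set t : R^o | V (c + L z + M t)]).
      move=> t /= te; have /eP/radV : - e < t < e by move: te; rewrite in_itv.
      by rewrite linearD addrA (linearZ_LR L).
    by apply: Cn_on_affine => //; exact: scalel_continuous.
  + by rewrite scale0r addr0.
  + by move=> t /eP /SF.
  + have := @is_derive_line R _ _ F z v 0; rewrite scale0r addr0.
    by apply; exact: dF.
- have n0 : `|0 : 'rV[R]_k| < rad by rewrite normr0.
  move=> v; rewrite (dFE _ _ n0) => H.
  have Lv := etrans (esym (phipsi 0 (L v) n0)) (congr1 ('d phi (F 0)) H).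
  have {}Lv : L v = 0 by apply: etrans Lv _; exact: raddf0.
  by rewrite -(LK v) Lv; exact: raddf0.
Qed.

End LocalParametrization.

(** * Second-order expansion of the parametrization *)

Section LocalTaylor.
Context {R : realType}.

(** In the sup norm each coordinate may use its own intermediate point of the scalar mean value
    theorem. *)
Lemma mean_value_inequality d (f f' : R -> 'rV[R]_d) (B : R) :
  (forall s : R, 0 <= s <= 1 -> is_derive s (1 : R) f (f' s)) ->
  (forall s : R, 0 <= s <= 1 -> `|f' s| <= B) -> `|f 1 - f 0| <= B.
Proof.
move=> df fB.
have B0 : 0 <= B by apply: le_trans (fB 0 _); rewrite // lexx ler01.
rewrite -[leLHS]/(mx_norm _) mx_normrE; apply/bigmax_leP; split=> // -[i j] _ /=.
pose g (s : R) := f s i j.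
have dg (s : R) : 0 <= s <= 1 -> is_derive s (1 : R) g (f' s i j).
  move=> /df [ds Ds]; have /derivable_mxP dgs := ds.
  apply: DeriveDef; first exact: dgs.
  by rewrite -Ds derive_mx // mxE.
have [s|s|s /[!in_itv] s01 E] := @MVT_segment _ g (fun s => f' s i j) 0 1 ler01.
- by rewrite in_itv => /andP[s0 s1]; apply: dg; rewrite !ltW.
- apply: derivable_within_continuous => t; rewrite in_itv => t01.
  by have [] := dg t t01.
rewrite !mxE -/(g 1) -/(g 0) E subr0 mulr1; apply: le_trans (fB s s01).
rewrite -[leRHS]/(mx_norm _) mx_normrE.
exact: (le_bigmax _ (fun ij => `|f' s ij.1 ij.2|) (i, j)).
Qed.

Lemma second_difference_bound d (A B C D E G : 'rV[R]_d) (b : R) :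
  `|A - D - (E + G)| <= b -> `|B - D - (E - G)| <= b -> `|C - D - E| <= b ->
  `|A + B - 2 *: C| <= 4 * b.
Proof.
move=> HA HB HC.
have -> : A + B - 2 *: C =
    (A - D - (E + G)) + (B - D - (E - G)) - 2 *: (C - D - E).
  by apply/rowP => i; rewrite !mxE; ring.
apply: le_trans (ler_normB _ _) _; rewrite normrZ ger0_norm //.
apply: le_trans (lerD (ler_normD _ _) (lexx _)) _; lra.
Qed.

Lemma first_difference_bound d (A C D E G : 'rV[R]_d) (b : R) :
  `|A - D - (E + G)| <= b -> `|C - D - E| <= b ->
  `|A - C| <= 2 * b + `|G|.
Proof.
move=> HA HC.
have -> : A - C = (A - D - (E + G)) - (C - D - E) + G.
  by apply/rowP => i; rewrite !mxE; ring.
apply: le_trans (ler_normD _ _) _.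
apply: le_trans (lerD (ler_normB _ _) (lexx _)) _; lra.
Qed.

Variables (d k : nat) (S : set 'rV[R]_d) (x : 'rV[R]_d).
Variables (F : 'rV[R]_k -> 'rV[R]_d) (rad : R).
Hypothesis lp : local_param S x F rad.

(** The second differential of F at 0, assembled from the differentials of the partial derivatives,
    which is the form in which [lp_diff2] provides it. *)
Let hess (z v : 'rV[R]_k) : 'rV[R]_d :=
  \sum_i v 0 i *: 'd (fun z => 'D_(delta_mx 0 i) F z) 0 z.

Lemma param_diff_expansion : exists2 C, 0 < C &
  forall e, 0 < e -> exists del, [/\ 0 < del, del <= rad & forall z v, `|z| < del ->
    `|'d F z v - 'd F 0 v - hess z v| <= e * `|z| * `|v| /\
    `|hess z v| <= C * `|z| * `|v|].
Proof.
have r0 := lp_rad lp.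
have n0 : `|0 : 'rV[R]_k| < rad by rewrite normr0.
pose G i z := 'D_(delta_mx 0 i) F z.
have dG i : differentiable (G i) 0 by exact: (lp_diff2 lp).
have coord (v : 'rV[R]_k) i : `|v 0 i| <= `|v|.
  rewrite -[leRHS]/(mx_norm _) mx_normrE.
  exact: (le_bigmax _ (fun ij => `|v ij.1 ij.2|) (0, i)).
have dFE z v : `|z| < rad -> 'd F z v = \sum_i v 0 i *: G i z.
  move=> zr; rewrite [v in LHS]row_sum_delta linear_sum; apply: eq_bigr => i _.
  by rewrite linearZ /G deriveE //; exact: (lp_diff lp).
have /choice[C HC] i : exists c : R, 0 < c /\
    forall z, `|'d (G i) 0 z| <= c * `|z|.
  by have [c c0 H] := diff_bounded (dG i); exists c.
exists (\sum_i C i + 1).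
  by rewrite ltr_wpDl // sumr_ge0 // => i _; case: (HC i) => /ltW.
move=> e e0; have e'0 : 0 < e / k.+1%:R by rewrite divr_gt0.
have /choice[D HD] i : exists c : R, 0 < c /\ forall z, `|z| < c ->
    `|G i z - G i 0 - 'd (G i) 0 z| <= e / k.+1%:R * `|z|.
  have [c c0 H] := differentiable_expansion (dG i) e'0.
  by exists c; split=> // z zc; have := H z; rewrite subr0; exact.
exists (\big[Num.min/rad]_i D i); split.
- by apply/bigmin_gtP; split=> // i _; case: (HD i).
- exact: bigmin_le_id.
move=> z v zD.
have zr : `|z| < rad by apply: lt_le_trans zD _; exact: bigmin_le_id.
split.
  have -> : 'd F z v - 'd F 0 v - hess z v =
      \sum_i v 0 i *: (G i z - G i 0 - 'd (G i) 0 z).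
    apply: etrans (congr2 (fun a b => a - b - hess z v) (dFE z v zr) (dFE 0 v n0)) _.
    rewrite -!sumrB.
    by apply: eq_bigr => i _; rewrite -!scalerBr.
  apply: le_trans (ler_norm_sum _ _ _) _.
  apply: (@le_trans _ _ (\sum_(i < k) (e / k.+1%:R * `|z| * `|v|))).
    apply: ler_sum => i _; rewrite normrZ mulrC ler_pM //.
    by case: (HD i) => _; apply; apply: lt_le_trans zD _; exact: bigmin_le.
  rewrite sumr_const card_ord -[leLHS]mulr_natl 2!mulrA ler_wpM2r // ler_wpM2r //.
  rewrite mulrCA ger_pMr // ler_pdivrMr // mul1r ler_nat; exact: leqnSn.
apply: le_trans (ler_norm_sum _ _ _) _.
apply: (@le_trans _ _ (\sum_(i < k) (C i * `|z| * `|v|))).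
  apply: ler_sum => i _; rewrite normrZ mulrC ler_pM //.
  by case: (HC i).
by rewrite -!mulr_suml !ler_wpM2r // lerDl.
Qed.

Lemma param_diff_lipschitz : exists C del, [/\ 0 < C, 0 < del, del <= rad &
  forall z v, `|z| < del -> `|'d F z v - 'd F 0 v| <= C * `|z| * `|v|].
Proof.
have [C C0 HC] := param_diff_expansion.
have [del [del0 delr H]] := HC 1 ltr01.
exists (C + 1), del; split=> // [|z v zd]; first by rewrite addr_gt0.
have [H1 H2] := H z v zd.
move: H1 H2; move: ('d F z v - 'd F 0 v) (hess z v) => a b H1 H2.
rewrite -(subrK b a); apply: le_trans (ler_normD _ _) _.
by rewrite !mulrDl addrC lerD.
Qed.

(** Along the segment the derivative is affine in s up to a small error. In the symmetric difference
    the quadratic terms cancel, so any e is allowed; the one-sided difference keeps them and has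
    only a fixed constant. *)
Lemma param_taylor : exists2 C, 0 < C &
  forall e, 0 < e -> exists del, [/\ 0 < del, del <= rad &
    forall z w, `|z| + `|w| < del ->
    `|F (z + w) - F (z - w) - 2 *: 'd F z w| <= e * (`|z| + `|w|) * `|w| /\
    `|F (z + w) - F z - 'd F z w| <= C * (`|z| + `|w|) * `|w|].
Proof.
have [C C0 HC] := param_diff_expansion.
exists (2 * (C + 1)); first by rewrite mulr_gt0 // addr_gt0.
(* The symmetric estimate collects four errors; the bound 1 serves the one-sided estimate. *)
move=> e e0; pose e' := Num.min 1 (e / 4).
have e'0 : 0 < e' by rewrite lt_min ltr01 divr_gt0.
have e'1 : e' <= 1 by rewrite ge_min lexx.
have e'e : 4 * e' <= e by rewrite mulrC -ler_pdivlMr // ge_min lexx orbT.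
clearbody e'.
have [del [del0 delr H]] := HC e' e'0.
exists del; split=> // z w zw.
have small (s : R) : `|s| <= 1 -> `|z + s *: w| <= `|z| + `|w|.
  move=> s1; apply: le_trans (ler_normD _ _) _; rewrite lerD2l normrZ.
  by rewrite ler_piMl.
have dl (s : R) : `|s| <= 1 -> `|z + s *: w| < del.
  by move=> /small; move/le_lt_trans; exact.
have dd (s : R) : `|s| <= 1 -> differentiable F (z + s *: w).
  by move=> /dl zs; apply: (lp_diff lp); exact: lt_le_trans delr.
have z0 : `|z| < del by have := dl 0; rewrite scale0r addr0 normr0; exact.
have dline (s : R) : `|s| <= 1 ->
    is_derive s (1 : R) (fun t : R => F (z + t *: w)) ('d F (z + s *: w) w).
  by move=> s1; apply: is_derive_line; exact: dd.
have dlineN (s : R) : `|s| <= 1 ->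
    is_derive s (1 : R) (fun t : R => F (z - t *: w)) (- 'd F (z - s *: w) w).
  move=> s1.
  have -> : (fun t : R => F (z - t *: w)) = (fun t : R => F (z + t *: (- w))).
    by apply/funext => t; rewrite scalerN.
  rewrite -linearN -scalerN; apply: is_derive_line; rewrite scalerN -scaleNr.
  by apply: dd; rewrite normrN.
have dlin (c s : R) : is_derive s (1 : R) (fun t : R => (c * t) *: 'd F z w)
    (c *: 'd F z w).
  have -> : (fun t : R => (c * t) *: 'd F z w) =
      (fun t : R => id (0 + t *: (c *: 'd F z w))).
    by apply/funext => t /=; rewrite add0r scalerA mulrC.
  have := @is_derive_line R _ _ id 0 (c *: 'd F z w) s.
  by rewrite diff_val; apply.
have hessD (s : R) : hess (z + s *: w) w = hess z w + s *: hess w w.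
  rewrite /hess scaler_sumr -big_split; apply: eq_bigr => i _ /=.
  by rewrite linearD linearZ scalerDr scalerA mulrC -scalerA.
have exp (s : R) : `|s| <= 1 ->
    `|'d F (z + s *: w) w - 'd F 0 w - (hess z w + s *: hess w w)|
    <= e' * (`|z| + `|w|) * `|w|.
  move=> s1; rewrite -hessD.
  have [+ _] := H _ w (dl s s1); move=> /le_trans; apply.
  by rewrite ler_wpM2r // ler_pM2l //; exact: small.
have zw0 : 0 <= `|z| + `|w| by rewrite addr_ge0.
have hw : `|hess w w| <= C * (`|z| + `|w|) * `|w|.
  have wd : `|w| < del by apply: le_lt_trans zw; rewrite lerDr.
  have [_ /le_trans] := H w w wd; apply.
  by rewrite ler_wpM2r // ler_pM2l // lerDr.
have expz' : `|'d F z w - 'd F 0 w - hess z w| <= e' * (`|z| + `|w|) * `|w|.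
  by have := exp 0; rewrite !scale0r !addr0 normr0; exact.
split.
  have := @mean_value_inequality d
    (fun t => F (z + t *: w) - F (z - t *: w) - (2 * t) *: 'd F z w)
    (fun t => 'd F (z + t *: w) w + 'd F (z - t *: w) w - 2 *: 'd F z w)
    (e * (`|z| + `|w|) * `|w|).
  rewrite /= !scale1r !scale0r !mulr1 mulr0 scale0r addr0 !subr0 subrr subr0.
  apply=> s /andP[s0 s1].
    have s1' : `|s| <= 1 by rewrite ger0_norm.
    have := is_deriveB (is_deriveB (dline s s1') (dlineN s s1')) (dlin 2 s).
    by rewrite opprK.
  have s1' : `|s| <= 1 by rewrite ger0_norm.
  have sN1 : `|- s| <= 1 by rewrite normrN.
  have expN : `|'d F (z - s *: w) w - 'd F 0 w - (hess z w - s *: hess w w)|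
      <= e' * (`|z| + `|w|) * `|w|.
    by have := exp (- s) sN1; rewrite !scaleNr.
  apply: le_trans (second_difference_bound (exp s s1') expN expz') _.
  have : 4 * e' * ((`|z| + `|w|) * `|w|) <= e * ((`|z| + `|w|) * `|w|).
    by rewrite ler_wpM2r // mulr_ge0.
  lra.
have := @mean_value_inequality d
  (fun t => F (z + t *: w) - (1 * t) *: 'd F z w)
  (fun t => 'd F (z + t *: w) w - 'd F z w)
  (2 * (C + 1) * (`|z| + `|w|) * `|w|).
rewrite /= !scale1r !scale0r !mulr1 mulr0 scale0r addr0 !subr0 scale1r.
have -> : F (z + w) - F z - 'd F z w = F (z + w) - 'd F z w - F z.
  by rewrite addrAC.
apply=> s /andP[s0 s1].
  have s1' : `|s| <= 1 by rewrite ger0_norm.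
  have := is_deriveB (dline s s1') (dlin 1 s).
  by rewrite scale1r.
have s1' : `|s| <= 1 by rewrite ger0_norm.
apply: le_trans (first_difference_bound (exp s s1') expz') _.
have : `|s *: hess w w| <= C * (`|z| + `|w|) * `|w|.
  by rewrite normrZ; apply: le_trans hw; rewrite ler_piMl.
have : e' * ((`|z| + `|w|) * `|w|) <= 1 * ((`|z| + `|w|) * `|w|).
  by rewrite ler_wpM2r // mulr_ge0.
have : 0 <= C * ((`|z| + `|w|) * `|w|) by rewrite mulr_ge0 ?(ltW C0) // mulr_ge0.
lra.
Qed.

End LocalTaylor.

(** * Tangent spaces and curves near a point *)

Section LocalGeometry.
Context {R : realType}.
Variables (d k : nat) (S : set 'rV[R]_d).
Hypothesis kd : (k <= d)%N.
Hypothesis eS : embedded_submanifold k S.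
Implicit Types (x y u n : 'rV[R]_d).

Lemma tangent_basis x : S x -> exists2 A : 'M[R]_(k, d), row_free A &
  forall u, tangent_vector S x u <-> exists z : 'rV[R]_k, u = z *m A.
Proof.
move=> Sx; have [F [rad lp]] := local_param_exists kd eS Sx.
have n0 : `|0 : 'rV[R]_k| < rad by rewrite normr0; exact: lp_rad lp.
exists (lin1_mx ('d F 0)) => [|u].
  apply: inj_row_free => v; rewrite mul_rV_lin1; exact: (lp_inj lp).
have := lp_tangent lp u n0; rewrite (lp_base lp) => ->.
by split=> -[z ->]; exists z; rewrite mul_rV_lin1.
Qed.

Lemma lp_tangent_diff x (F : 'rV[R]_k -> 'rV[R]_d) rad z v :
  local_param S x F rad -> `|z| < rad -> tangent_vector S (F z) ('d F z v).
Proof.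
move=> lp zr; have := @lp_tangent _ _ _ _ _ _ _ lp z ('d F z v) zr.
move=> [_ H]; apply: H; exact: (ex_intro _ v erefl).
Qed.

(** The Jacobian at 0 has a left inverse; for |z| < 1 / (2 c C) the change of the differential costs
    at most half of |v|. *)
Lemma param_lower_bound x (F : 'rV[R]_k -> 'rV[R]_d) rad :
  local_param S x F rad ->
  exists c del, [/\ 0 < c, 0 < del, del <= rad & forall z v, `|z| < del ->
    `|v| <= c * `|'d F z v| /\ `|'d F z v - 'd F 0 v| <= c * `|z| * `|v|].
Proof.
move=> lp.
have [c c0 Hc] : exists2 c, 0 < c & forall v, `|v| <= c * `|'d F 0 v|.
  have /row_freeP[B AB] : row_free (lin1_mx ('d F 0)).
    by apply: inj_row_free => v; rewrite mul_rV_lin1; exact: (lp_inj lp).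
  have [c c0 H] := linear_lipschitz (@linear_rV_continuous _ _ _ (mulmxr B)).
  exists c => // v; have := H (v *m lin1_mx ('d F 0)).
  by rewrite /= -mulmxA AB mulmx1 mul_rV_lin1.
have [C [del [C0 del0 delr H]]] := param_diff_lipschitz lp.
exists (2 * c + C), (Num.min del ((2 * c * C)^-1)); split.
- by rewrite addr_gt0 // mulr_gt0.
- by rewrite lt_min del0 invr_gt0 !mulr_gt0.
- by rewrite ge_min delr.
move=> z v; rewrite lt_min => /andP[zd zs].
have D := H z v zd.
split; last first.
  apply: le_trans D _; rewrite -!mulrA ler_wpM2r ?mulr_ge0 //.
  by rewrite lerDr mulr_ge0 // ltW.
have cD : 2 * (c * (C * `|z| * `|v|)) <= `|v|.
  have -> : 2 * (c * (C * `|z| * `|v|)) = `|z| * (2 * c * C) * `|v| by ring.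
  by rewrite ler_piMl // -ler_pdivlMr ?mul1r ?ltW // !mulr_gt0.
have : `|v| <= c * (`|'d F z v| + C * `|z| * `|v|).
  apply: le_trans (Hc v) _; rewrite ler_pM2l // -lerBlDl.
  by apply: le_trans D; rewrite distrC; exact: lerB_dist.
have : 0 <= C * `|'d F z v| by rewrite mulr_ge0 // ltW.
lra.
Qed.

(** Lower semicontinuity of the tangent spaces: the parameter vector of u is pushed forward at the
    nearby point. *)
Lemma local_tangent x u e : S x -> tangent_vector S x u -> 0 < e ->
  exists2 h0, 0 < h0 & forall y, S y -> enorm (y - x) <= h0 ->
    exists2 u', tangent_vector S y u' & enorm (u' - u) <= e.
Proof.
move=> Sx tu e0; have [F [rad lp]] := local_param_exists kd eS Sx.
have n0 : `|0 : 'rV[R]_k| < rad by rewrite normr0; exact: lp_rad lp.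
have [v uE] : exists v, u = 'd F 0 v.
  by apply/(lp_tangent lp u n0); rewrite (lp_base lp).
have [c [del [c0 del0 delr Hc]]] := param_lower_bound lp.
have [C [del' [C0 del'0 onto]]] := lp_onto lp.
pose K := c * C * (`|v| + 1) * d.+1%:R.
have K0 : 0 < K by rewrite !mulr_gt0 // ltr_wpDl.
exists (Num.min (Num.min (del' / 2) (del / 2 / C)) (e / K)).
  by rewrite !lt_min !divr_gt0.
move=> y Sy; rewrite !le_min => /andP[/andP[yd yd'] ye].
have yx := norm_le_enorm (y - x).
have [|z [zr zC Fz]] := onto y Sy.
  by apply: le_lt_trans yx _; apply: le_lt_trans yd _; lra.
have zCy : `|z| <= C * enorm (y - x).
  by apply: le_trans zC _; rewrite ler_pM2l.
have zd : `|z| < del.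
  apply: le_lt_trans zCy _; apply: (@le_lt_trans _ _ (del / 2)); last lra.
  by rewrite mulrC -ler_pdivlMr.
exists ('d F z v).
  by have := lp_tangent_diff v lp zr; rewrite Fz.
rewrite uE; apply: le_trans (enorm_le_norm _) _.
have [_ H] := Hc z v zd.
apply: (@le_trans _ _ (d.+1%:R * (c * (C * enorm (y - x)) * (`|v| + 1)))).
  apply: ler_pM => //; first by rewrite ler_nat.
  apply: le_trans H _; apply: ler_pM => //; first by rewrite mulr_ge0 // ltW.
    by rewrite ler_pM2l.
  by rewrite lerDl.
have -> : d.+1%:R * (c * (C * enorm (y - x)) * (`|v| + 1)) = K * enorm (y - x).
  by rewrite /K; ring.
by rewrite mulrC -ler_pdivlMr.
Qed.

(** The points are F (z + w) and F (z - w) with w = h v. The last error must be small against h^2: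
    normals turn by an amount of order h, so the normal component of s - s', from which this turning
    is read off, is itself of order h^2. *)
Lemma local_curves x e : S x -> 0 < e ->
  exists2 h0, 0 < h0 & forall h y u, 0 < h <= h0 -> S y -> enorm (y - x) <= h ->
    tangent_vector S y u -> enorm u <= 1 ->
    exists s s', [/\ S s, S s', enorm (s - (y + h *: u)) <= e * h,
      enorm (s' - (y - h *: u)) <= e * h & enorm (s - s' - (2 * h) *: u) <= e * h ^+ 2].
Proof.
move=> Sx e0; have [F [rad lp]] := local_param_exists kd eS Sx.
have [c [del [c0 del0 delr Hc]]] := param_lower_bound lp.
have [C [del' [C0 del'0 onto]]] := lp_onto lp.
have [T T0 HT] := param_taylor lp.
pose K := (C + c) * c * d.+1%:R.
have K0 : 0 < K by rewrite !mulr_gt0 // addr_gt0.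
have [del2 [del20 del2r H2]] := HT (e / K) (divr_gt0 e0 K0).
have Cc0 : 0 < C + c by rewrite addr_gt0.
exists (Num.min (Num.min (del' / 2) (del / 2 / C))
          (Num.min (del2 / 2 / (C + c)) (e / (T * K)))).
  by rewrite !lt_min !divr_gt0 // mulr_gt0.
move=> h y u /andP[h0]; rewrite !le_min.
move=> /andP[/andP[hd' hd] /andP[hd2 he]] Sy yh tu u1.
have yx : `|y - x| <= h by exact: le_trans (norm_le_enorm _) yh.
have [|z [zr zC Fz]] := onto y Sy.
  by apply: le_lt_trans yx _; apply: le_lt_trans hd' _; lra.
have zCh : `|z| <= C * h by apply: le_trans zC _; rewrite ler_pM2l.
have zd : `|z| < del.
  apply: le_lt_trans zCh _; rewrite mulrC -ltr_pdivlMr //.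
  by apply: le_lt_trans hd _; rewrite ltr_pM2r ?invr_gt0 //; lra.
have [v uE] : exists v, u = 'd F z v.
  by apply/(lp_tangent lp u zr); rewrite Fz.
have [vc _] := Hc z v zd; rewrite -uE in vc.
have vC : `|v| <= c.
  apply: le_trans vc _; rewrite ger_pMr //.
  exact: le_trans (norm_le_enorm _) u1.
pose w := h *: v.
have wh : `|w| <= c * h by rewrite normrZ gtr0_norm // mulrC ler_pM2r.
have zw : `|z| + `|w| <= (C + c) * h by rewrite mulrDl lerD.
have zwd : `|z| + `|w| < del2.
  apply: le_lt_trans zw _; rewrite mulrC -ltr_pdivlMr //.
  by apply: le_lt_trans hd2 _; rewrite ltr_pM2r ?invr_gt0 //; lra.
have zwd' : `|z| + `|- w| < del2 by rewrite normrN.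
have inr w' : `|z| + `|w'| < del2 -> `|z + w'| < rad.
  move=> zw'; apply: le_lt_trans (ler_normD _ _) _.
  exact: lt_le_trans del2r.
have [A1 A2] := H2 z w zwd; have [_ A3] := H2 z (- w) zwd'.
have dw : 'd F z w = h *: u by rewrite uE linearZ.
have prod : (`|z| + `|w|) * `|w| <= (C + c) * c * h ^+ 2.
  have -> : (C + c) * c * h ^+ 2 = ((C + c) * h) * (c * h) by ring.
  by apply: ler_pM => //; rewrite addr_ge0.
have bound (a : 'rV[R]_d) (q : R) : 0 <= q -> `|a| <= q * (`|z| + `|w|) * `|w| ->
    enorm a <= q * K * h ^+ 2.
  move=> q0 aq; apply: le_trans (enorm_le_norm _) _.
  have -> : q * K * h ^+ 2 = d.+1%:R * (q * ((C + c) * c * h ^+ 2)).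
    by rewrite /K; ring.
  apply: ler_pM => //; first by rewrite ler_nat.
  by apply: le_trans aq _; rewrite -mulrA ler_wpM2l.
have Te : T * K * h ^+ 2 <= e * h.
  rewrite expr2 mulrA ler_pM2r // mulrC -ler_pdivlMr // mulr_gt0 //.
exists (F (z + w)), (F (z - w)); split.
- by apply: (lp_mem lp); exact: inr.
- by apply: (lp_mem lp); exact: inr.
- rewrite -Fz opprD addrA -dw; apply: le_trans Te; apply: bound => //.
  exact: ltW.
- rewrite -Fz opprB addrA (addrC _ (- F z)) addrA (addrC (- F z)) -dw.
  apply: le_trans Te; apply: bound; first exact: ltW.
  by move: A3; rewrite raddfN opprK normrN.
- have -> : e = e / K * K by rewrite divfK // gt_eqF.
  rewrite -scalerA -dw; apply: bound => //.
  by rewrite ltW // divr_gt0.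
Qed.

(** The first-order part of y - x is tangent at x, so n sees only the second-order remainder of the
    parametrization. *)
Lemma local_quadratic x n : S x ->
  (forall u, tangent_vector S x u -> dotv n u = 0) ->
  exists C del, [/\ 0 < C, 0 < del & forall y, S y -> enorm (y - x) < del ->
    `|dotv n (y - x)| <= C * dotv (y - x) (y - x)].
Proof.
move=> Sx nx; have [F [rad lp]] := local_param_exists kd eS Sx.
have n0 : `|0 : 'rV[R]_k| < rad by rewrite normr0; exact: lp_rad lp.
have [C [del' [C0 del'0 onto]]] := lp_onto lp.
have [T T0 HT] := param_taylor lp.
have [del2 [del20 del2r H2]] := HT 1 ltr01.
pose K := (enorm n + 1) * (d.+1%:R * (T * (C * C))).
have n1 : 0 < enorm n + 1 by rewrite ltr_wpDl // enorm_ge0.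
have K0 : 0 < K by rewrite !mulr_gt0.
exists K, (Num.min del' (del2 / C)); split=> //.
  by rewrite lt_min del'0 divr_gt0.
move=> y Sy; rewrite lt_min => /andP[yd' yd2].
have yx := norm_le_enorm (y - x).
have [|z [zr zC Fz]] := onto y Sy; first exact: le_lt_trans yd'.
have zCy : `|z| <= C * enorm (y - x) by apply: le_trans zC _; rewrite ler_pM2l.
have zd : `|0 : 'rV[R]_k| + `|z| < del2.
  rewrite normr0 add0r; apply: le_lt_trans zCy _.
  by rewrite mulrC -ltr_pdivlMr.
have [_] := H2 0 z zd; rewrite add0r normr0 add0r Fz (lp_base lp) => B.
have -> : dotv n (y - x) = dotv n (y - x - 'd F 0 z).
  rewrite (dotvBr n (y - x)) (nx ('d F 0 z)) ?subr0 //.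
  by have := lp_tangent_diff z lp n0; rewrite (lp_base lp).
apply: le_trans (dotv_norm_le _ _) _.
rewrite -enorm_sqr /K -mulrA; apply: ler_pM; rewrite ?enorm_ge0 ?lerDl //.
apply: le_trans (enorm_le_norm _) _; rewrite -mulrA.
apply: ler_pM; rewrite ?ler_nat //; apply: le_trans B _.
rewrite -!mulrA ler_pM2l // expr2.
have -> : C * (C * (enorm (y - x) * enorm (y - x))) =
  (C * enorm (y - x)) * (C * enorm (y - x)) by ring.
by apply: ler_pM.
Qed.

End LocalGeometry.

(** * Empty balls tangent to the manifold *)

Section EmptyBalls.
Context {R : realType}.
Variables (d k : nat) (S : set 'rV[R]_d).
Hypothesis kd : (k <= d)%N.
Hypothesis cS : compact S.
Hypothesis eS : embedded_submanifold k S.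
Implicit Types (x y u n : 'rV[R]_d).

Definition normal_vector x n := forall u, tangent_vector S x u -> dotv n u = 0.

Lemma tangent_vectorZ x a u : S x -> tangent_vector S x u ->
  tangent_vector S x (a *: u).
Proof.
move=> Sx; have [A _ H] := tangent_basis kd eS Sx.
by move=> /H[z ->]; apply/H; exists (a *: z); rewrite scalemxAl.
Qed.

Lemma tangent_vectorD x u v : S x -> tangent_vector S x u ->
  tangent_vector S x v -> tangent_vector S x (u + v).
Proof.
move=> Sx; have [A _ H] := tangent_basis kd eS Sx.
by move=> /H[z ->] /H[w ->]; apply/H; exists (z + w); rewrite mulmxDl.
Qed.

(** A small ball is empty near x by [local_quadratic], and away from x because its diameter is at
    most [del]; sweeping then enlarges it. *)
Lemma empty_tangent_ball x n t0 : S x -> normal_vector x n -> dotv n n = 1 ->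
  0 <= t0 -> (forall t, 0 <= t < t0 -> ~ medial_axis S (x + t *: n)) ->
  forall s, S s -> 2 * t0 * dotv n (s - x) <= dotv (s - x) (s - x).
Proof.
move=> Sx nx n1 t00 noM.
have [C [del [C0 del0 Hq]]] := local_quadratic kd eS Sx nx.
pose h := Num.min (del / 2) ((2 * C)^-1).
have h0 : 0 < h by rewrite lt_min divr_gt0 // invr_gt0 mulr_gt0.
have hd : 2 * h <= del by rewrite mulrC -ler_pdivlMr // ge_min lexx.
have hC : h * (2 * C) <= 1.
  by rewrite -ler_pdivlMr ?mulr_gt0 // mul1r ge_min lexx orbT.
clearbody h.
suff : nearest_point S (x + t0 *: n) x by move=> /nearest_pointE[].
apply: (nearest_point_sweep cS n1 h0) => // [|t /andP[ht tt]]; last first.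
  by apply: noM; rewrite tt (le_trans _ ht) // ltW.
apply/nearest_pointE; split=> // s Ss.
have En : enorm n = 1 by apply: enorm_eq; rewrite // expr1n.
have [sd|sd] := ltP (enorm (s - x)) del.
  have := Hq s Ss sd; rewrite ler_norml => /andP[_ H].
  have : 2 * h * dotv n (s - x) <= 2 * h * (C * dotv (s - x) (s - x)).
    by rewrite ler_pM2l // mulr_gt0.
  have : h * (2 * C) * dotv (s - x) (s - x) <= 1 * dotv (s - x) (s - x).
    by rewrite ler_wpM2r // dotv_ge0.
  lra.
have := dotv_le n (s - x); rewrite En mul1r => H.
rewrite -enorm_sqr expr2.
have : 2 * h * dotv n (s - x) <= 2 * h * enorm (s - x).
  by rewrite ler_pM2l // mulr_gt0.
move/le_trans; apply; rewrite ler_wpM2r ?enorm_ge0 //.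
exact: le_trans sd.
Qed.

Lemma lfs_le p m : medial_axis S m -> lfs S p <= eucl_dist p m.
Proof.
move=> Mm; apply: ge_inf; last by exists m.
by exists 0 => _ [q _ <-]; exact: eucl_dist_ge0.
Qed.

(** Both ends of the segment of centres are within lfs(p) of p, the first strictly, so by convexity
    no centre before the last meets the medial axis. *)
Lemma empty_ball_lfs p x n t0 s : S x -> normal_vector x n -> dotv n n = 1 ->
  0 <= t0 -> enorm (x - p) < lfs S p -> enorm (x + t0 *: n - p) <= lfs S p ->
  S s -> 2 * t0 * dotv n (s - x) <= dotv (s - x) (s - x).
Proof.
move=> Sx nx n1 t00 xp tp; apply: empty_tangent_ball => // t /andP[t1 tt].
move=> /(lfs_le p); apply/negP; rewrite -ltNge eucl_distC.
have t0p : 0 < t0 by apply: le_lt_trans tt.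
pose a := t / t0.
have a0 : 0 <= a by rewrite divr_ge0.
have a1 : a < 1 by rewrite ltr_pdivrMr // mul1r.
have tE : t = a * t0 by rewrite /a divfK // gt_eqF.
have -> : eucl_dist (x + t *: n) p =
    enorm ((1 - a) *: (x - p) + a *: (x + t0 *: n - p)).
  rewrite /eucl_dist tE; congr enorm; apply/rowP => i; rewrite !mxE; ring.
apply: le_lt_trans (enormD_le _ _) _; rewrite !enormZ !ger0_norm //; last lra.
have : (1 - a) * enorm (x - p) < (1 - a) * lfs S p by rewrite ltr_pM2l //; lra.
have : a * enorm (x + t0 *: n - p) <= a * lfs S p by rewrite ler_wpM2l.
lra.
Qed.

End EmptyBalls.

(** * Real inequalities for one step of the ascent *)

Section NormalVariationEstimates.
Context {R : realFieldType}.
Implicit Types (rho q b s sg T B e h : R).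

(* With [G = 1 + 33/100 D + b^2/(2D)], eliminating [T] by completing the square
   leaves [2 mu^2 (1 - D) (G - 1/2) <= sg^2], up to multiples of [e]. *)
Lemma ascent_slack rho q b s sg T B e :
  0 < rho -> rho ^+ 2 <= 83 / 100 -> 0 < q -> q <= rho ->
  rho ^+ 2 - rho ^+ 4 / 4 <= q ^+ 2 ->
  b ^+ 2 <= rho ^+ 4 / 4 -> s ^+ 2 + sg ^+ 2 = 1 ->
  rho + 11 / 100 * rho ^+ 3 - b ^+ 2 / (2 * rho) <= s ->
  0 <= e -> e <= rho ^+ 2 / 200 ->
  (1 - rho ^+ 2) * T ^+ 2 - 2 * b * B <= 1 + e ->
  q / rho * (1 + 33 / 100 * rho ^+ 2 + b ^+ 2 / (2 * rho ^+ 2)) <=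
    T * sg - b * q * B / rho + e -> False.
Proof.
move=> rho0 D83 q0 qr qD bD ssg sge e0 eD HT HG.
have rn : rho != 0 by rewrite gt_eqF.
set mu := q / rho in HG; set D := rho ^+ 2 in D83 eD HT HG *.
have D0 : 0 < D by rewrite exprn_gt0.
have D1 : 0 <= 1 - D by clear -D83; lra.
have D1' : 1 - D <= 1 by clear -D0; lra.
have mu0 : 0 < mu by rewrite divr_gt0.
have mu1 : mu <= 1 by rewrite ler_pdivrMr // mul1r.
have muD : 1 - D / 4 <= mu ^+ 2.
  rewrite exprMn exprVn ler_pdivlMr // /D; move: qD; lra.
have {}HG : mu * (1 + 33 / 100 * D) <= T * sg - b * mu * B + e.
  apply: (@le_trans _ _ (mu * (1 + 33 / 100 * D + b ^+ 2 / (2 * D)))).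
    rewrite ler_pM2l // lerDl divr_ge0 ?sqr_ge0 // mulr_ge0 // ltW //.
  apply: le_trans HG _; rewrite le_eqVlt; apply/orP; left; apply/eqP.
  by rewrite /mu; ring.
(* The correction b^2 / (2 rho) is at most rho^3 / 8, and 11/100 - 1/8 = -15/1000. *)
have sD : rho * (1 - 15 / 1000 * D) <= s.
  apply: le_trans sge.
  have -> : rho * (1 - 15 / 1000 * D) = rho + 11 / 100 * rho ^+ 3 - rho ^+ 3 / 8.
    by rewrite /D; field.
  rewrite lerD2l lerN2 ler_pdivrMr ?mulr_gt0 //.
  have -> : rho ^+ 3 / 8 * (2 * rho) = rho ^+ 4 / 4 by field.
  exact: bD.
have s2 : D * (1 - 3 / 100 * D) <= s ^+ 2.
  have r0 : 0 <= rho * (1 - 15 / 1000 * D).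
    by apply: mulr_ge0 (ltW rho0) _; clear -D83; lra.
  apply: (@le_trans _ _ ((rho * (1 - 15 / 1000 * D)) ^+ 2)).
    rewrite exprMn -/D ler_pM2l //.
    by have := sqr_ge0 D; clear; lra.
  by rewrite ler_pXn2r // nnegrE // (le_trans r0).
have mBn : 2 * (- b * mu * B) <= mu * (1 + e - (1 - D) * T ^+ 2).
  have -> : 2 * (- b * mu * B) = mu * (- 2 * b * B) by ring.
  by rewrite ler_pM2l //; clear -HT; lra.
have key : 2 * mu * (1 - D) * (mu * (1 + 33 / 100 * D)) <=
    2 * mu * (1 - D) * (T * sg) + mu ^+ 2 * (1 - D) * (1 + e - (1 - D) * T ^+ 2) +
    2 * mu * (1 - D) * e.
  have c0 : 0 <= mu * (1 - D) by exact: mulr_ge0 (ltW mu0) D1.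
  by have := ler_wpM2l c0 mBn; have := ler_wpM2l c0 HG; clear; lra.
(* The right side of [key] is largest at T = sg / (mu (1 - D)). *)
have sq := sqr_ge0 (mu * (1 - D) * T - sg).
have E1 : mu ^+ 2 * (1 - D) * e <= e.
  apply: ler_piMl => //; rewrite mulr_ile1 ?sqr_ge0 //.
  by rewrite expr2 mulr_ile1 // ltW.
have E2 : mu * (1 - D) * e <= e.
  by apply: ler_piMl => //; rewrite mulr_ile1 // ltW.
have c0 : 0 <= (1 - D) * (1 + 66 / 100 * D).
  by apply: mulr_ge0 D1 _; clear -D0; lra.
(* What remains is a cubic inequality in D on [0, 83/100]; the next products certify it by linear
   arithmetic. *)
have P := ler_wpM2r c0 muD.
have D2 : D * D <= 83 / 100 * D by rewrite ler_pM2r.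
have D3 : 0 <= D * (D - 83 / 100) ^+ 2 by rewrite mulr_ge0 ?sqr_ge0 // ltW.
clearbody mu D; clear -P D2 D3 E1 E2 s2 ssg key sq eD D0; lra.
Qed.

(** The function b^2 / (2 rho) is the perspective of a square, hence convex for rho > 0, and lies
    above its tangent plane. *)
Lemma convex_quotient_bound b b1 rho rho1 : 0 < rho -> 0 < rho1 ->
  b ^+ 2 / (2 * rho) + b * (b1 - b) / rho - b ^+ 2 * (rho1 - rho) / (2 * rho ^+ 2)
  <= b1 ^+ 2 / (2 * rho1).
Proof.
move=> r0 r1; rewrite -subr_ge0.
have -> : b1 ^+ 2 / (2 * rho1) - (b ^+ 2 / (2 * rho) + b * (b1 - b) / rho -
    b ^+ 2 * (rho1 - rho) / (2 * rho ^+ 2)) =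
    (b1 / rho1 - b / rho) ^+ 2 * rho1 / 2.
  by field; rewrite !gt_eqF.
by rewrite divr_ge0 // mulr_ge0 ?sqr_ge0 // ltW.
Qed.

(** The first-order condition at a maximum of the potential, obtained by dividing a non-increasing
    step by its length h. In the application T is the speed at which the normal turns, B the part of
    it along the step, and q the length of the tangential part of x. *)
Lemma ascent_step rho rho1 q b b1 s s1 sg T B h e :
  0 < rho -> rho <= 1 -> 0 < rho1 -> rho1 <= 1 -> 0 < h -> h <= e ->
  b ^+ 2 <= rho ^+ 4 / 4 ->
  s - h * (T * sg) - h * e <= s1 ->
  h * (b * q * B - e) <= b * (b1 - b) ->
  rho1 <= rho - h * (q - e) / rho -> `|rho1 - rho| <= 2 * h ->
  s1 + b1 ^+ 2 / (2 * rho1) - (rho1 + 11 / 100 * rho1 ^+ 3) <=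
    s + b ^+ 2 / (2 * rho) - (rho + 11 / 100 * rho ^+ 3) ->
  q / rho * (1 + 33 / 100 * rho ^+ 2 + b ^+ 2 / (2 * rho ^+ 2)) <=
    T * sg - b * q * B / rho + 6 * e / rho.
Proof.
move=> r0 rle1 r1 r1le1 h0 he b4 Hs Hb Hr Hr2 Hpsi.
have cq := convex_quotient_bound b b1 r0 r1.
set r := rho - rho1.
have rr : r ^+ 2 <= 4 * h ^+ 2.
  have -> : r ^+ 2 = `|rho1 - rho| ^+ 2 by rewrite real_normK ?num_real // /r; ring.
  have -> : 4 * h ^+ 2 = (2 * h) ^+ 2 by ring.
  by rewrite ler_pXn2r // nnegrE mulr_ge0 // ltW.
have cube : 3 * rho ^+ 2 * r - 12 * h ^+ 2 <= rho ^+ 3 - rho1 ^+ 3.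
  have -> : rho ^+ 3 - rho1 ^+ 3 = 3 * rho ^+ 2 * r - r ^+ 2 * (2 * rho + rho1).
    by rewrite /r; ring.
  rewrite lerD2l lerN2; apply: (@le_trans _ _ (r ^+ 2 * 3)); last lra.
  rewrite ler_wpM2l ?sqr_ge0 //; lra.
(* The derivative in rho of rho + 11/100 rho^3 - b^2 / (2 rho). *)
set M := 1 + 33 / 100 * rho ^+ 2 + b ^+ 2 / (2 * rho ^+ 2).
have M0 : 0 <= M.
  have : 0 <= b ^+ 2 / (2 * rho ^+ 2).
    by rewrite divr_ge0 ?sqr_ge0 // mulr_ge0 // sqr_ge0.
  by have := sqr_ge0 rho; rewrite /M; lra.
have bq : b ^+ 2 / (2 * rho ^+ 2) <= 1 / 8.
  rewrite ler_pdivrMr ?mulr_gt0 ?exprn_gt0 //; apply: le_trans b4 _.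
  have -> : 1 / 8 * (2 * rho ^+ 2) = rho ^+ 2 / 4 by field.
  rewrite ler_pM2r // (_ : 4%N = 2 + 2)%N // exprD ger_pMr ?exprn_gt0 //.
  by rewrite expr2 mulr_ile1 // ltW.
have M2 : M <= 2.
  have : rho ^+ 2 <= 1 by rewrite expr2 mulr_ile1 // ltW.
  by rewrite /M; lra.
have Hr' : h * (q - e) / rho <= r by rewrite /r; lra.
have main : h * ((q - e) / rho * M + (b * q * B - e) / rho) <=
    h * (T * sg) + h * e + 2 * h ^+ 2.
  have E1 : h * ((q - e) / rho * M) <= M * r.
    have -> : h * ((q - e) / rho * M) = M * (h * (q - e) / rho) by ring.
    exact: (ler_wpM2l M0 Hr').
  have E2 : h * ((b * q * B - e) / rho) <= b * (b1 - b) / rho.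
    by rewrite mulrA ler_pM2r // invr_gt0.
  have E3 : M * r = r + 33 / 100 * rho ^+ 2 * r - b ^+ 2 * (rho1 - rho) / (2 * rho ^+ 2).
    by rewrite /M /r; field; rewrite gt_eqF.
  have E4 : r = rho - rho1 by [].
  have h20 := sqr_ge0 h.
  rewrite mulrDr; clearbody r M; clear -E1 E2 E3 E4 cube cq Hs Hpsi h20; lra.
have he2 : 2 * h ^+ 2 <= h * (2 * e) by rewrite expr2 mulrCA ler_pM2l // ler_pM2l.
have {}main : h * ((q - e) / rho * M + (b * q * B - e) / rho) <=
    h * (T * sg + e + 2 * e).
  by rewrite !mulrDr -mulrDr; move: main he2; rewrite !mulrDr; lra.
move: main; rewrite ler_pM2l // => main.
have e0 : 0 <= e by apply: le_trans he; exact: ltW.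
have er : 3 * e <= 3 * e / rho.
  rewrite ler_pdivlMr // ler_piMr // mulr_ge0 //.
have eM : e / rho * M <= 2 * (e / rho).
  by rewrite mulrC ler_wpM2r // divr_ge0 // ltW.
have X1 : (q - e) / rho * M = q / rho * M - e / rho * M by ring.
have X2 : (b * q * B - e) / rho = b * q * B / rho - e / rho by ring.
have X3 : 3 * e / rho = 3 * (e / rho) by ring.
have X4 : 6 * e / rho = 6 * (e / rho) by ring.
clearbody M; clear -main er eM X1 X2 X3 X4; lra.
Qed.

End NormalVariationEstimates.

(** * The rescaled manifold and one step of the ascent *)

Definition orthogonal_to {R : realType} {d : nat} (P : 'rV[R]_d -> Prop) n :=
  forall u, P u -> dotv n u = 0.

(* The geometry of a manifold near one of its points, moved to the origin and
   scaled so that its local feature size is 1. *)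
Record unit_ball_model {R : realType} {d : nat} (S : set 'rV[R]_d)
    (Tan : 'rV[R]_d -> 'rV[R]_d -> Prop) : Prop := UnitBallModel {
  ubm_compact : compact S;
  ubm_origin : S 0;
  ubm_tangentZ : forall x a u, S x -> Tan x u -> Tan x (a *: u);
  ubm_tangentD : forall x u v, S x -> Tan x u -> Tan x v -> Tan x (u + v);
  ubm_projection : forall x m, S x ->
    exists2 t, Tan x t & orthogonal_to (Tan x) (m - t);
  ubm_tangent_near : forall x u (e : R), S x -> Tan x u -> 0 < e ->
    exists2 h0, 0 < h0 & forall y, S y -> enorm (y - x) <= h0 ->
      exists2 u', Tan y u' & enorm (u' - u) <= e;
  ubm_curves : forall x (e : R), S x -> 0 < e ->
    exists2 h0, 0 < h0 & forall h y u, 0 < h <= h0 -> S y -> enorm (y - x) <= h ->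
      Tan y u -> enorm u <= 1 ->
      exists s s', [/\ S s, S s', enorm (s - (y + h *: u)) <= e * h,
        enorm (s' - (y - h *: u)) <= e * h &
        enorm (s - s' - (2 * h) *: u) <= e * h ^+ 2];
  ubm_balls : forall x n (t : R) s, S x -> orthogonal_to (Tan x) n ->
    dotv n n = 1 -> enorm x < 1 -> 0 <= t -> enorm (x + t *: n) <= 1 -> S s ->
    2 * t * dotv n (s - x) <= dotv (s - x) (s - x) }.

Section NormalVariation.
Context {R : realType} {d : nat}.
Variables (S : set 'rV[R]_d) (Tan : 'rV[R]_d -> 'rV[R]_d -> Prop).
Implicit Types (x y u m n s : 'rV[R]_d).
Hypothesis model : unit_ball_model S Tan.
Let S0 := ubm_origin model.
Let TanZ := ubm_tangentZ model.
Let TanD := ubm_tangentD model.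
Let Tan_proj := ubm_projection model.
Let Tan_near := ubm_tangent_near model.
Let Tan_curves := ubm_curves model.
Let unit_balls := ubm_balls model.

(** [Sg - b] and [Sg + b] are the distances from x to the unit sphere along m and -m; their product
    is 1 - D. Thus H + M and H - M are the curvatures of the largest empty balls provided on the two
    sides. Testing both balls on the origin, a point of S, gives |b| <= D / 2. *)
Lemma two_sided_ball_bound x m : S x -> orthogonal_to (Tan x) m -> dotv m m = 1 ->
  dotv x x <= 83 / 100 ->
  dotv m x ^+ 2 <= dotv x x ^+ 2 / 4 /\
  exists H M : R, [/\ 0 <= H <= 4, `|M| <= 5 / 2, (1 - dotv x x) * M = dotv m x,
    (1 - dotv x x) * (H ^+ 2 - M ^+ 2) = 1 &
    forall s, S s ->
      2 * dotv m (s - x) <= (H + M) * dotv (s - x) (s - x) /\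
      - (2 * dotv m (s - x)) <= (H - M) * dotv (s - x) (s - x)].
Proof.
move=> Sx mx m1 D83; set D := dotv x x; set b := dotv m x.
have D0 : 0 <= D by exact: dotv_ge0.
have x1 : enorm x < 1.
  rewrite ltNge enorm_ge // expr1n -ltNge; apply: le_lt_trans D83 _; lra.
have X0 : 0 <= b ^+ 2 + 1 - D by have := sqr_ge0 b; rewrite /D; lra.
set Sg := Num.sqrt (b ^+ 2 + 1 - D).
have Sg0 : 0 <= Sg by exact: sqrtr_ge0.
have Sg2 : Sg ^+ 2 = b ^+ 2 + 1 - D by rewrite sqr_sqrtr.
have bSg : `|b| <= Sg.
  rewrite -(ler_pXn2r (ltn0Sn 1)) ?nnegrE //= real_normK ?num_real // Sg2.
  by rewrite /D; lra.
have [bSg1 bSg2] : - b <= Sg /\ b <= Sg.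
  by move: bSg; rewrite ler_norml => /andP[]; split; lra.
have ball s : S s -> 2 * (Sg - b) * dotv m (s - x) <= dotv (s - x) (s - x) /\
    - (2 * (Sg + b) * dotv m (s - x)) <= dotv (s - x) (s - x).
  move=> Ss; split.
    apply: unit_balls => //; first lra.
    rewrite enorm_le // !dotvE (dotvC x m) m1 -/b -/D expr1n; move: Sg2; lra.
  rewrite -mulrN -dotvNl; apply: unit_balls => //; last first.
  - by rewrite enorm_le // !dotvE (dotvC x m) m1 -/b -/D expr1n; move: Sg2; lra.
  - lra.
  - by rewrite !dotvE opprK.
  - by move=> u Tu; rewrite dotvNl mx // oppr0.
have b2 : b ^+ 2 <= D ^+ 2 / 4.
  have [] := ball 0 S0; rewrite sub0r !dotvE opprK -/b -/D => B1 B2.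
  have : 2 * Sg * `|b| <= D - 2 * b ^+ 2.
    by have [b0|b0] := leP 0 b; [rewrite ger0_norm|rewrite ltr0_norm]; lra.
  move=> Hb; have {Hb} : (2 * Sg * `|b|) ^+ 2 <= (D - 2 * b ^+ 2) ^+ 2.
    rewrite ler_pXn2r // nnegrE.
      by rewrite !mulr_ge0.
    by apply: le_trans Hb; rewrite !mulr_ge0.
  by rewrite exprMn real_normK ?num_real // exprMn Sg2; lra.
split=> //; have D1 : 0 < 1 - D by rewrite /D; lra.
have D1n : 1 - D != 0 by rewrite gt_eqF.
have M52 : `|b / (1 - D)| <= 5 / 2.
  rewrite normrM (gtr0_norm (x := _^-1)) ?invr_gt0 // ler_pdivrMr //.
  apply: (@le_trans _ _ (D / 2)); last by rewrite /D; lra.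
  rewrite -(ler_pXn2r (ltn0Sn 1)) ?nnegrE ?divr_ge0 //.
  by rewrite real_normK ?num_real //; move: b2; lra.
have HM : (1 - D) * ((Sg / (1 - D)) ^+ 2 - (b / (1 - D)) ^+ 2) = 1.
  have -> : (1 - D) * ((Sg / (1 - D)) ^+ 2 - (b / (1 - D)) ^+ 2) =
    (Sg ^+ 2 - b ^+ 2) / (1 - D) by field.
  by rewrite Sg2; field.
exists (Sg / (1 - D)), (b / (1 - D)); split=> //; first 1 last.
- by rewrite mulrC divfK.
- move=> s /ball[B1 B2]; set Q := dotv (s - x) (s - x) in B1 B2 *.
  set p := dotv m (s - x) in B1 B2 *.
  have P : (Sg - b) * (Sg + b) = 1 - D by rewrite -subr_sqr Sg2; ring.
  split; rewrite -(ler_pM2l D1).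
    have -> : (1 - D) * ((Sg / (1 - D) + b / (1 - D)) * Q) = (Sg + b) * Q by field.
    rewrite -{1}P.
    have -> : (Sg - b) * (Sg + b) * (2 * p) = (Sg + b) * (2 * (Sg - b) * p) by ring.
    by rewrite ler_wpM2l //; lra.
  have -> : (1 - D) * ((Sg / (1 - D) - b / (1 - D)) * Q) = (Sg - b) * Q by field.
  rewrite -{1}P.
  have -> : (Sg - b) * (Sg + b) * (- (2 * p)) = (Sg - b) * - (2 * (Sg + b) * p) by ring.
  by rewrite ler_wpM2l //; lra.
- apply/andP; split; first exact: divr_ge0 Sg0 (ltW D1).
  rewrite ler_pdivrMr //.
  rewrite -(ler_pXn2r (ltn0Sn 1)) ?nnegrE ?mulr_ge0 // ?ltW //.
  rewrite Sg2 exprMn.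
  have : 0 <= (83 / 100 - D) * (1 - D) by apply: mulr_ge0 (ltW D1); rewrite /D; lra.
  move: b2 D83; rewrite -/D; nra.
Qed.

Lemma displaced_sqr_bound x s xi u (h e a : R) : 0 < h -> 0 <= e -> e <= 1 ->
  dotv xi xi = 1 -> dotv u u = 1 -> a ^+ 2 = 1 ->
  enorm (s - (x + h *: (xi + a *: u))) <= 3 * e * h ->
  dotv (s - x) (s - x) <= h ^+ 2 * (2 + 2 * a * dotv xi u + 21 * e).
Proof.
move=> h0 e0 e1 xi1 u1 a2; set w := s - _ => Hw.
have -> : s - x = h *: (xi + a *: u) + w.
  by apply/rowP => i; rewrite /w !mxE; ring.
set v := xi + a *: u.
have vv : dotv v v = 2 + 2 * a * dotv xi u.
  rewrite /v !dotvE (dotvC u xi) xi1 u1 mulr1.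
  by move: a2; move: (dotv xi u) => c; lra.
have v2 : enorm v <= 2.
  apply: le_trans (enormD_le _ _) _; rewrite enormZ.
  have -> : `|a| = 1 by apply/eqP; rewrite -sqrp_eq1 // real_normK ?num_real // a2.
  by rewrite !(@enorm_eq _ _ _ 1) ?expr1n //; lra.
clearbody v w; rewrite !dotvE (dotvC w v) vv -(enorm_sqr w).
have vw : dotv v w <= 2 * (3 * e * h).
  exact: le_trans (dotv_le _ _) (ler_pM (enorm_ge0 _) (enorm_ge0 _) v2 Hw).
have hvw : h * dotv v w <= h * (2 * (3 * e * h)) by rewrite ler_pM2l.
have ww : enorm w ^+ 2 <= (3 * e * h) ^+ 2.
  by rewrite ler_pXn2r ?nnegrE ?enorm_ge0 // !mulr_ge0 // ltW.
have ee : 9 * h ^+ 2 * e ^+ 2 <= 9 * h ^+ 2 * e.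
  have e2 : e ^+ 2 <= e by rewrite expr2 ler_piMl.
  have h2 : 0 <= 9 * h ^+ 2 by rewrite mulr_ge0 // sqr_ge0.
  exact: (ler_wpM2l h2 e2).
lra.
Qed.

(* Adding the two one-sided quadratic bounds along [y + h u] and [y - h u] leaves
   a bound on the first-order term, uniformly in the tangent direction at y. *)
Lemma tangent_normal_bound x y n xi u s s' (H M h e : R) :
  dotv n n = 1 -> dotv xi xi = 1 -> dotv u u = 1 ->
  0 < h -> 0 <= e -> e <= 1 -> `|M| <= H -> H <= 4 ->
  (forall s, S s ->
      2 * dotv n (s - x) <= (H + M) * dotv (s - x) (s - x) /\
      - (2 * dotv n (s - x)) <= (H - M) * dotv (s - x) (s - x)) ->
  enorm (y - (x + h *: xi)) <= 2 * e * h -> S s -> S s' ->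
  enorm (s - (y + h *: u)) <= e * h -> enorm (s' - (y - h *: u)) <= e * h ->
  enorm (s - s' - (2 * h) *: u) <= e * h ^+ 2 ->
  dotv n u <= h * (H + M * dotv xi u + 50 * e).
Proof.
move=> n1 xi1 u1 h0 e0 e1 + H4 ball yx Ss Ss' Hs Hs' Hss.
rewrite ler_norml => /andP[HM1 HM2].
have [B1 _] := ball s Ss; have [_ B2] := ball s' Ss'.
have Q1 : dotv (s - x) (s - x) <= h ^+ 2 * (2 + 2 * 1 * dotv xi u + 21 * e).
  apply: displaced_sqr_bound; rewrite ?expr1n // scale1r.
  have -> : s - (x + h *: (xi + u)) = (s - (y + h *: u)) + (y - (x + h *: xi)).
    by apply/rowP => i; rewrite !mxE; ring.
  by apply: le_trans (enormD_le _ _) _; lra.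
have Q2 : dotv (s' - x) (s' - x) <= h ^+ 2 * (2 + 2 * (-1) * dotv xi u + 21 * e).
  apply: displaced_sqr_bound; rewrite ?sqrrN ?expr1n // scaleN1r.
  have -> : s' - (x + h *: (xi - u)) = (s' - (y - h *: u)) + (y - (x + h *: xi)).
    by apply/rowP => i; rewrite !mxE; ring.
  by apply: le_trans (enormD_le _ _) _; lra.
have P1 : (H + M) * dotv (s - x) (s - x) <=
    (H + M) * (h ^+ 2 * (2 + 2 * 1 * dotv xi u + 21 * e)).
  by rewrite ler_wpM2l //; lra.
have P2 : (H - M) * dotv (s' - x) (s' - x) <=
    (H - M) * (h ^+ 2 * (2 + 2 * (-1) * dotv xi u + 21 * e)).
  by rewrite ler_wpM2l //; lra.
have En : enorm n = 1 by apply: enorm_eq; rewrite ?expr1n.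
have P3 : - dotv n (s - s' - (2 * h) *: u) <= e * h ^+ 2.
  rewrite -dotvNr; apply: le_trans (dotv_le _ _) _.
  by rewrite En mul1r enormN.
have P4 : dotv n (s - s' - (2 * h) *: u) =
    dotv n (s - x) - dotv n (s' - x) - 2 * h * dotv n u.
  by rewrite !dotvE; ring.
have heH : h ^+ 2 * e * H <= h ^+ 2 * e * 4.
  by rewrite ler_wpM2l // mulr_ge0 // sqr_ge0.
have he0 : 0 <= h ^+ 2 * e by rewrite mulr_ge0 // sqr_ge0.
rewrite -(ler_pM2l h0); clear -P4 P3 B1 B2 P1 P2 heH he0; lra.
Qed.

Definition two_sided x n (H M : R) := forall s, S s ->
  2 * dotv n (s - x) <= (H + M) * dotv (s - x) (s - x) /\
  - (2 * dotv n (s - x)) <= (H - M) * dotv (s - x) (s - x).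

(** The point y is chosen before n, so that a single step serves several normals at x: both m and
    the normal part of x are needed later. *)
Lemma displaced_point x xi (e h1 : R) : S x -> Tan x xi -> dotv xi xi = 1 ->
  0 < e -> e < 1 -> 0 < h1 ->
  exists (h : R) y, [/\ 0 < h <= h1, S y, enorm (y - (x + h *: xi)) <= 2 * e * h,
    enorm (y - x) <= h /\ (exists2 xi', Tan y xi' & enorm (xi' - xi) <= e) &
    forall n (H M : R), dotv n n = 1 -> `|M| <= H -> H <= 4 -> two_sided x n H M ->
      forall u, Tan y u -> dotv u u = 1 ->
      dotv n u <= h * (H + M * dotv xi u + 50 * e)].
Proof.
move=> Sx Txi xi1 e0 e1 h10.
have [hn hn0 Hn] := Tan_near Sx Txi e0; have [hc hc0 Hc] := Tan_curves Sx e0.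
have [h [h0 hh1 hhn hhc]] : exists h : R, [/\ 0 < h, h <= h1, h <= hn & h <= hc].
  by exists (Num.min h1 (Num.min hn hc)); rewrite !lt_min !ge_min !lexx h10 hn0 hc0 !orbT.
have En : enorm xi = 1 by apply: enorm_eq; rewrite ?expr1n.
have e1' : 0 < 1 - e by lra.
have g0 : 0 < h * (1 - e) by rewrite mulr_gt0.
have hh : h * (1 - e) <= h by rewrite ger_pMr //; lra.
have eh0 : 0 < e * h by rewrite mulr_gt0.
have ehh : e * (h * (1 - e)) <= e * h by rewrite ler_pM2l.
(* Going h (1 - e) instead of h guarantees |y - x| <= h, as [ubm_curves] requires of a base
   point. *)
have [|||y [_ [Sy _ Hy _ _]]] := Hc (h * (1 - e)) x xi _ Sx _ Txi.
- by rewrite g0 (le_trans hh).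
- by rewrite subrr enorm0 ltW.
- by rewrite En.
have yx : enorm (y - x) <= h.
  have -> : y - x = (y - (x + (h * (1 - e)) *: xi)) + (h * (1 - e)) *: xi.
    by apply/rowP => i; rewrite !mxE; ring.
  apply: le_trans (enormD_le _ _) _; rewrite enormZ En gtr0_norm // mulr1; lra.
have yxi : enorm (y - (x + h *: xi)) <= 2 * e * h.
  have -> : y - (x + h *: xi) = (y - (x + (h * (1 - e)) *: xi)) - (h * e) *: xi.
    by apply/rowP => i; rewrite !mxE; ring.
  apply: le_trans (enormB_le _ _) _; rewrite enormZ En gtr0_norm ?mulr_gt0 //.
  by rewrite mulr1; lra.
exists h, y; split=> //; first by rewrite h0.
  by split=> //; apply: Hn => //; exact: le_trans yx hhn.
move=> n H M n1 MH H4 ts u Tu u1.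
have [||s [s' [Ss Ss' Hs Hs' Hss]]] := Hc h y u _ Sy yx Tu.
- by rewrite h0.
- by rewrite (@enorm_eq _ _ _ 1) ?expr1n.
by apply: (tangent_normal_bound (xi := xi) (y := y) n1 xi1 u1 h0 _ _ MH H4 ts yxi Ss Ss') => //; exact: ltW.
Qed.

(** For unit u tangent at y, m . u = t . u, so the hypothesis says that t - h M xi has length at
    most h H up to errors; squaring gives the second estimate. The vector xi' stands in for xi since
    only tangent vectors at y can be tested. *)
Lemma displaced_projection y m t xi xi' (H M h e : R) : S y -> 0 < h -> 0 < e -> e <= 1 / 100 ->
  dotv xi xi = 1 -> Tan y xi' -> enorm (xi' - xi) <= e ->
  0 <= H <= 4 -> `|M| <= 5 / 2 ->
  (forall u, Tan y u -> dotv u u = 1 -> dotv m u <= h * (H + M * dotv xi u + 50 * e)) ->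
  Tan y t -> orthogonal_to (Tan y) (m - t) ->
  enorm t <= 10 * h /\
  dotv t t - 2 * h * M * dotv xi t + h ^+ 2 * (M ^+ 2 - H ^+ 2) <= 600 * e * h ^+ 2.
Proof.
move=> Sy h0 e0 e1 xi1 Txi' xx /andP[H0 H4] M52 bnd Tt mt.
have En : enorm xi = 1 by apply: enorm_eq; rewrite ?expr1n.
set w := t - (h * M) *: xi'.
have Tw : Tan y w by rewrite /w -scaleNr; apply: TanD => //; exact: TanZ.
have Exi' : enorm xi' <= 1 + e.
  have := enormD_le (xi' - xi) xi; rewrite subrK En; lra.
have wb : enorm w <= h * (H + 53 * e).
  have [->|w0] := eqVneq w 0.
    by rewrite enorm0 mulr_ge0 ?addr_ge0 ?mulr_ge0 // ltW.
  have {}w0 : 0 < enorm w by rewrite enorm_gt0.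
  set u := (enorm w)^-1 *: w.
  have Tu : Tan y u by exact: TanZ.
  have u1 : dotv u u = 1.
    by rewrite /u dotvZl dotvZr -enorm_sqr; field; rewrite gt_eqF.
  have Eu : enorm u = 1 by apply: enorm_eq; rewrite ?expr1n.
  have -> : enorm w = dotv w u.
    by rewrite /u dotvZr -enorm_sqr; field; rewrite gt_eqF.
  have mu : dotv m u = dotv t u.
    by have := mt u Tu; rewrite dotvBl => /eqP; rewrite subr_eq0 => /eqP.
  have -> : dotv w u = dotv m u - h * M * dotv xi u - h * (M * dotv (xi' - xi) u).
    by rewrite mu /w !dotvBl dotvZl; ring.
  have := bnd u Tu u1.
  have : `|M * dotv (xi' - xi) u| <= 5 / 2 * e.
    rewrite normrM ler_pM //; apply: le_trans (dotv_norm_le _ _) _.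
    by rewrite Eu mulr1.
  rewrite ler_norml => /andP[+ _]; rewrite -(ler_pM2l h0) => Y X.
  have : 0 < h * e by rewrite mulr_gt0.
  lra.
have xih : `|h * M| <= h * (5 / 2) by rewrite normrM gtr0_norm // ler_pM2l.
have tE : t = w + (h * M) *: xi' by rewrite subrK.
have tb : enorm t <= 10 * h.
  rewrite tE; apply: le_trans (enormD_le _ _) _; rewrite enormZ.
  have : `|h * M| * enorm xi' <= h * (5 / 2) * (1 + e).
    by apply: ler_pM => //; exact: enorm_ge0.
  have : h * e <= h * (1 / 100) by rewrite ler_pM2l.
  have : h * H <= h * 4 by rewrite ler_pM2l.
  lra.
split=> //.
have ww : dotv w w <= (h * (H + 53 * e)) ^+ 2.
  by rewrite -enorm_sqr ler_pXn2r ?nnegrE ?enorm_ge0 // (le_trans _ wb) ?enorm_ge0.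
have wE : dotv w w = dotv t t - 2 * h * M * dotv xi t - 2 * (h * M * dotv (xi' - xi) t)
    + (h * M) ^+ 2 * dotv xi' xi'.
  by rewrite /w !dotvE (dotvC t xi'); ring.
have c1 : h * M * dotv (xi' - xi) t <= h * (5 / 2) * (e * (10 * h)).
  apply: le_trans (ler_norm _) _; rewrite normrM ler_pM //.
  apply: le_trans (dotv_norm_le _ _) _; apply: ler_pM => //; exact: enorm_ge0.
have c2 : 1 - 2 * e <= dotv xi' xi'.
  have : 1 - e <= enorm xi'.
    have := enormB_ge xi xi'; rewrite En enormB; lra.
  move=> X; rewrite -enorm_sqr.
  have : (1 - e) ^+ 2 <= enorm xi' ^+ 2.
    by rewrite ler_pXn2r ?nnegrE ?enorm_ge0 //; lra.
  have := sqr_ge0 e; lra.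
have hM : (h * M) ^+ 2 <= (h * (5 / 2)) ^+ 2.
  rewrite -real_normK ?num_real // ler_pXn2r ?nnegrE //.
  by rewrite mulr_ge0 // ltW.
have c3 : (h * M) ^+ 2 * (1 - 2 * e) <= (h * M) ^+ 2 * dotv xi' xi'.
  by rewrite ler_wpM2l // sqr_ge0.
have c4 : (h * M) ^+ 2 * e <= (h * (5 / 2)) ^+ 2 * e by rewrite ler_pM2r.
have he : 0 < h ^+ 2 * e by rewrite mulr_gt0 // exprn_gt0.
have c5 : h ^+ 2 * e * e <= h ^+ 2 * e * (1 / 100) by rewrite ler_pM2l.
have c6 : h ^+ 2 * e * H <= h ^+ 2 * e * 4 by rewrite ler_pM2l.
clear -ww wE c1 c3 c4 c5 c6 he; lra.
Qed.

Definition potential tau (p : 'rV[R]_d * 'rV[R]_d) : R :=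
  dotv p.2 tau + dotv p.2 p.1 ^+ 2 / (2 * enorm p.1)
  - (enorm p.1 + 11 / 100 * enorm p.1 ^+ 3).

Lemma orthogonal_toZ P a n : orthogonal_to P n -> orthogonal_to P (a *: n).
Proof. by move=> Pn u /Pn; rewrite dotvZl => ->; rewrite mulr0. Qed.

Lemma unit_scaled n : n != 0 -> dotv ((enorm n)^-1 *: n) ((enorm n)^-1 *: n) = 1.
Proof.
by move=> n0; rewrite dotvZl dotvZr -enorm_sqr; field; rewrite enorm_eq0.
Qed.

(** The normal part n of x satisfies n . x = n . n, so the bound |b| <= D / 2 for the unit normal n
    / |n| bounds |n| itself. *)
Lemma tangential_part x : S x -> x != 0 -> dotv x x <= 83 / 100 ->
  exists p, [/\ Tan x p, orthogonal_to (Tan x) (x - p), dotv x p = dotv p p &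
    dotv x x - dotv x x ^+ 2 / 4 <= dotv p p].
Proof.
move=> Sx x0 D83; have [p Tp xp] := Tan_proj x Sx.
have xpp : dotv x p = dotv p p.
  by have := xp p Tp; rewrite dotvBl => /eqP; rewrite subr_eq0 => /eqP.
exists p; split=> //; set n := x - p.
have nn : dotv n n = dotv x x - dotv p p.
  by rewrite /n !dotvE (dotvC p x) xpp; ring.
have nx : dotv n x = dotv n n.
  by rewrite nn /n dotvBl (dotvC p x) xpp.
have [n0|n0] := eqVneq n 0.
  move: nn; rewrite n0 dotv0l => nn.
  by have := sqr_ge0 (dotv x x); lra.
have [+ _] := two_sided_ball_bound Sx (orthogonal_toZ (enorm n)^-1 xp) (unit_scaled n0) D83.
rewrite dotvZl nx -{1}enorm_sqr.
have -> : (enorm n)^-1 * enorm n ^+ 2 = enorm n by field; rewrite enorm_eq0.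
by rewrite enorm_sqr nn; lra.
Qed.

(** Both t - |t|^2 m and tau - s m are orthogonal to m, of norms at most |t| and exactly sqrt (1 -
    s^2); their product is the first-order loss. Normalising costs only |t|^2, because |m - t|^2 = 1
    - |t|^2. *)
Lemma rotated_normal_bounds m t tau (c := enorm (m - t)) (m1 := c^-1 *: (m - t)) :
  dotv m m = 1 -> dotv tau tau = 1 -> dotv (m - t) t = 0 -> enorm t < 1 ->
  [/\ 0 < c, dotv m1 m1 = 1,
    dotv m tau - enorm t * Num.sqrt (1 - dotv m tau ^+ 2) - 2 * dotv t t <= dotv m1 tau &
    forall y, enorm y <= 1 -> `|dotv m1 y - dotv (m - t) y| <= dotv t t].
Proof.
move=> mm tt mt t1.
have mt' : dotv m t = dotv t t.
  by move: mt; rewrite dotvBl => /eqP; rewrite subr_eq0 => /eqP.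
have c2 : c ^+ 2 = 1 - dotv t t.
  by rewrite enorm_sqr !dotvE (dotvC t m) mt' mm; ring.
have tt1 : dotv t t < 1.
  by rewrite -enorm_sqr expr2 mulr_ilt1 ?enorm_ge0.
have c0 : 0 < c.
  by rewrite lt_def enorm_ge0 andbT -sqrf_eq0 c2 gt_eqF // subr_gt0.
have cn : m - t != 0 by rewrite -enorm_gt0.
have m11 : dotv m1 m1 = 1 by exact: unit_scaled.
have tt0 := dotv_ge0 t.
have c1 : c <= 1.
  by rewrite -(ler_pXn2r (ltn0Sn 1)) ?nnegrE ?(ltW c0) // c2 expr1n; lra.
have cc : 1 - dotv t t <= c by rewrite -c2 expr2 ger_pMr.
have m1E : m - t = c *: m1 by rewrite scalerA divff ?gt_eqF // scale1r.
clearbody m1.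
have near y : enorm y <= 1 -> `|dotv m1 y - dotv (m - t) y| <= dotv t t.
  move=> y1; rewrite m1E dotvZl -{1}[dotv m1 y]mul1r -mulrBl normrM.
  have cc' : `|1 - c| <= dotv t t by rewrite ger0_norm ?subr_ge0 // lerBlDl -lerBlDr.
  rewrite -[leRHS]mulr1; apply: ler_pM => //.
  apply: le_trans (dotv_norm_le _ _) _.
  by rewrite (@enorm_eq _ _ m1 1) ?expr1n // mul1r.
split=> //; have Et : enorm tau = 1 by apply: enorm_eq; rewrite ?expr1n.
have := near tau; rewrite Et => /(_ (lexx 1)); rewrite ler_norml => /andP[+ _].
set s := dotv m tau; set sg := Num.sqrt _.
have sg2 : sg ^+ 2 = 1 - s ^+ 2.
  rewrite sqr_sqrtr // subr_ge0 -real_normK ?num_real // exprn_ile1 //.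
  apply: le_trans (dotv_norm_le _ _) _.
  by rewrite Et (@enorm_eq _ _ m 1) ?expr1n // mulr1.
have Esg : enorm (tau - s *: m) = sg.
  apply: enorm_eq; first exact: sqrtr_ge0.
  by rewrite sg2 !dotvE (dotvC tau m) -/s mm tt; ring.
have Ew : enorm (t - dotv t t *: m) <= enorm t.
  rewrite enorm_le // enorm_sqr !dotvE (dotvC t m) mt' mm.
  by have := sqr_ge0 (dotv t t); lra.
have := dotv_le (t - dotv t t *: m) (tau - s *: m); rewrite Esg => X.
have {}X := le_trans X (ler_wpM2r (sqrtr_ge0 _) Ew).
have wE : dotv (t - dotv t t *: m) (tau - s *: m) = dotv t tau - dotv t t * s.
  by rewrite !dotvE (dotvC t m) mt' mm -/s; ring.
have s1 : dotv t t * s <= dotv t t * 1.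
  rewrite ler_wpM2l //; apply: le_trans (dotv_le _ _) _.
  by rewrite Et (@enorm_eq _ _ m 1) ?expr1n // mulr1.
move: X; rewrite wE dotvBl -/s -/sg; lra.
Qed.

End NormalVariation.

Lemma tangential_component_bound (R : realType) (d : nat) (S : set 'rV[R]_d)
    (Tan : 'rV[R]_d -> 'rV[R]_d -> Prop) (y n t : 'rV[R]_d) (K : R) :
  unit_ball_model S Tan -> S y -> Tan y t -> 0 <= K ->
  (forall u, Tan y u -> dotv u u = 1 -> dotv n u <= K) ->
  `|dotv n t| <= K * enorm t.
Proof.
move=> model Sy Tt K0 bnd; have [->|t0] := eqVneq t 0.
  by rewrite dotv0r normr0 enorm0 mulr0.
have E a : dotv n (a *: ((enorm t)^-1 *: t)) * enorm t = a * dotv n t.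
  by rewrite !dotvZr; field; rewrite enorm_eq0.
have t00 : 0 < enorm t by rewrite enorm_gt0.
have B a : a ^+ 2 = 1 -> a * dotv n t <= K * enorm t.
  move=> a2; rewrite -E ler_pM2r //; apply: bnd; first by do 2!apply: (ubm_tangentZ model) => //.
  by rewrite dotvZl dotvZr unit_scaled // mulr1 -expr2.
have := B 1; have := B (-1); rewrite sqrrN expr1n => /(_ erefl) X /(_ erefl) Y.
by rewrite ler_norml; apply/andP; split; lra.
Qed.

(** Without such a pair [ascent_step] gives a first-order inequality which [ascent_slack] refutes.
    The control of the loss by eta keeps the new pair inside the compact set of the maximum
    argument. *)
Lemma potential_increase (R : realType) (d : nat) (S : set 'rV[R]_d)
    (Tan : 'rV[R]_d -> 'rV[R]_d -> Prop) (x m tau : 'rV[R]_d) (eta : R) :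
  unit_ball_model S Tan -> S x -> x != 0 -> dotv x x <= 83 / 100 ->
  orthogonal_to (Tan x) m -> dotv m m = 1 -> dotv tau tau = 1 ->
  0 < potential tau (x, m) -> 0 < eta ->
  exists y m1, [/\ S y, orthogonal_to (Tan y) m1, dotv m1 m1 = 1,
    enorm y <= enorm x &
    dotv m tau - eta <= dotv m1 tau /\ potential tau (x, m) < potential tau (y, m1)].
Proof.
move=> model Sx x0 D83 mx m1 tau1 pot0 eta0; apply: contrapT => noinc.
set rho := enorm x.
have r0 : 0 < rho by rewrite enorm_gt0.
have rD : rho ^+ 2 = dotv x x by rewrite enorm_sqr.
have rle1 : rho <= 1.
  by rewrite -(ler_pXn2r (ltn0Sn 1)) ?nnegrE ?(ltW r0) // rD expr1n; lra.
have rn : rho != 0 by rewrite gt_eqF.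
have D1 : 0 < 1 - dotv x x by clear -D83; lra.
have [p [Tp xp xpp pD]] := tangential_part model Sx x0 D83.
have D0 : 0 < dotv x x by rewrite -rD exprn_gt0.
set q := enorm p; have qD : q ^+ 2 = dotv p p by rewrite enorm_sqr.
have pp0 : 0 < dotv p p.
  apply: lt_le_trans pD; have : dotv x x * dotv x x <= dotv x x * 1.
    by rewrite ler_pM2l //; lra.
  by rewrite expr2; lra.
have q0 : 0 < q by rewrite enorm_gt0 -dotv_eq0 gt_eqF.
have qr : q <= rho.
  rewrite -(ler_pM2l q0) -expr2 qD -xpp mulrC; exact: dotv_le.
(* The unit tangent direction that decreases |x| fastest. *)
set xi := - q^-1 *: p.
have Txi : Tan x xi by exact: (ubm_tangentZ model).
have xi1 : dotv xi xi = 1 by rewrite /xi dotvZl dotvZr -qD; field; rewrite gt_eqF.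
have xxi : dotv x xi = - q by rewrite /xi dotvZr xpp -qD; field; rewrite gt_eqF.
have pE : p = - q *: xi.
  by rewrite /xi scalerA mulrNN divff ?scale1r // gt_eqF.
clearbody xi.
have [b2 [H [M [H04 M52 HM HM2 ts]]]] := two_sided_ball_bound model Sx mx m1 D83.
set b := dotv m x in b2 HM *.
have MH : `|M| <= H.
  have /andP[H0 _] := H04.
  rewrite -(ler_pXn2r (ltn0Sn 1)) ?nnegrE // real_normK ?num_real //.
  by rewrite -subr_ge0 -(pmulr_rge0 _ D1) HM2 ler01.
set s := dotv m tau; set sg := Num.sqrt (1 - s ^+ 2).
(* The total error 1200 e / rho must not exceed rho^2 / 200, hence the cube. *)
have [e eE] : exists e, e = rho ^+ 3 / 10 ^+ 6 by exists (rho ^+ 3 / 10 ^+ 6).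
have e0 : 0 < e by rewrite eE divr_gt0 ?exprn_gt0.
have r3 : rho ^+ 3 <= rho ^+ 2 by rewrite exprS ger_pMl // exprn_gt0.
have e1 : e <= 1 / 100.
  rewrite eE; clear -r3 D83 rD; lra.
have h10 : 0 < Num.min e (eta / 300) by rewrite lt_min e0 divr_gt0 ?ltr0n.
have [|h [y [/andP[h0 +] Sy yxi [yx [xi' Txi' xixi']] tang]]] :=
  displaced_point model Sx Txi xi1 e0 _ h10; first by clear -e1; lra.
rewrite le_min => /andP[he heta].
have [t Tt mt] := ubm_projection model m Sy.
have [tb quad] := displaced_projection model Sy h0 e0 e1 xi1 Txi' xixi' H04 M52
  (fun u => tang m H M m1 MH (proj2 (andP H04)) ts u) Tt mt.
have he' : h <= 1 / 10 ^+ 6.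
  by apply: le_trans he _; rewrite eE; clear -r3 D83 rD; lra.
have t1 : enorm t < 1 by apply: le_lt_trans tb _; clear -he'; lra.
have [c0 m11 Hs1 near] := rotated_normal_bounds m1 tau1 (mt t Tt) t1.
set m' := (_ *: _) in m11 Hs1 near.
have m'y : orthogonal_to (Tan y) m' by exact: orthogonal_toZ.
have tt : dotv t t <= 100 * h ^+ 2.
  have -> : 100 * h ^+ 2 = (10 * h) ^+ 2 by ring.
  by rewrite -enorm_sqr ler_pXn2r ?nnegrE ?enorm_ge0 // mulr_ge0 // ltW.
(* From |x + h xi|^2 = rho^2 - 2 h q + h^2: the norm decreases at rate q / rho. *)
have ry : enorm y <= rho - h * (q - 200 * e) / rho.
  apply: (@le_trans _ _ (enorm (x + h *: xi) + 2 * e * h)).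
    rewrite -lerBlDl; apply: le_trans (enormB_ge _ _) yxi.
  set r' := enorm (x + h *: xi).
  have r'2 : r' ^+ 2 = rho ^+ 2 - 2 * h * q + h ^+ 2.
    by rewrite enorm_sqr !dotvE (dotvC xi x) xxi xi1 rD; ring.
  rewrite -(ler_pM2r r0).
  have -> : (rho - h * (q - 200 * e) / rho) * rho = rho ^+ 2 - h * (q - 200 * e).
    by field.
  have A1 := sqr_ge0 (r' - rho).
  have A2 : h * h <= h * e by rewrite ler_pM2l.
  have A3 : h * e * rho <= h * e * 1 by rewrite ler_pM2l // mulr_gt0.
  have A4 : 0 < h * e by rewrite mulr_gt0.
  by rewrite mulrDl; clearbody r' rho q; clear -r'2 A1 A2 A3 A4; lra.
have eq : 200 * e <= q.
  have : rho / 2 <= q.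
    rewrite -(ler_pXn2r (ltn0Sn 1)) ?nnegrE ?(ltW q0) ?divr_ge0 ?(ltW r0) //.
    rewrite qD; apply: le_trans pD; rewrite -rD.
    have : rho ^+ 2 * rho ^+ 2 <= rho ^+ 2 * 1.
      by rewrite ler_pM2l ?exprn_gt0 // rD; clear -D83; lra.
    by have := sqr_ge0 rho; clear; lra.
  have : rho ^+ 3 <= rho.
    by apply: le_trans r3 _; rewrite expr2 ger_pMr.
  by rewrite eE; clear -r0; lra.
have yr : enorm y <= rho.
  by apply: le_trans ry _; rewrite gerBl divr_ge0 ?mulr_ge0 ?subr_ge0 // ltW.
have y1 : enorm y <= 1 by exact: le_trans rle1.
have yrh : `|enorm y - rho| <= h.
  by apply: le_trans yx; have := enormBB x y 0; rewrite !subr0.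
have y0 : 0 < enorm y.
  have : rho ^+ 3 <= rho by apply: le_trans r3 _; rewrite expr2 ger_pMr.
  move: yrh; rewrite ler_norml => /andP[+ _]; move: he; rewrite eE.
  by clear -r0; lra.
have hh2 : h ^+ 2 <= h * e by rewrite expr2 ler_pM2l.
have Tsg : enorm t * sg = h * (enorm t / h * sg) by field; rewrite gt_eqF.
have Hs : s - h * (enorm t / h * sg) - h * (200 * e) <= dotv m' tau.
  by move: Hs1; rewrite -/s -/sg Tsg; clear -hh2 tt; lra.
set B := dotv xi t / h.
have hB : h * B = dotv xi t by rewrite /B; field; rewrite gt_eqF.
set xN := x - p in xp.
(* [xN] is itself normal at x, so its unit multiple has components at most 7 h along unit tangents
   at y, while |t| <= 10 h. *)
have xNt : `|dotv xN t| <= 70 * h ^+ 2.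
  have [->|n0] := eqVneq xN 0.
    by rewrite dotv0l normr0 mulr_ge0 // sqr_ge0.
  have nx : orthogonal_to (Tan x) ((enorm xN)^-1 *: xN) by exact: orthogonal_toZ.
  have [_ [H' [M' [/andP[H'0 H'4] M'52 _ HM2' ts']]]] :=
    two_sided_ball_bound model Sx nx (unit_scaled n0) D83.
  have MH' : `|M'| <= H'.
    rewrite -(ler_pXn2r (ltn0Sn 1)) ?nnegrE // real_normK ?num_real //.
    by rewrite -subr_ge0 -(pmulr_rge0 _ D1) HM2' ler01.
  have K0 : 0 <= h * 7 by rewrite mulr_ge0 // ltW.
  have X := tangential_component_bound model Sy Tt K0 (n := (enorm xN)^-1 *: xN).
  have Nx0 : 0 < enorm xN by rewrite enorm_gt0.
  have -> : `|dotv xN t| = enorm xN * `|dotv ((enorm xN)^-1 *: xN) t|.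
    by rewrite dotvZl normrM gtr0_norm ?invr_gt0 // mulrA divff ?mul1r // gt_eqF.
  apply: (@le_trans _ _ (1 * (h * 7 * (10 * h)))); last by clear; lra.
  apply: ler_pM => //; first exact: ltW.
    rewrite -(ler_pXn2r (ltn0Sn 1)) ?nnegrE ?(ltW Nx0) // enorm_sqr expr1n.
    have -> : dotv xN xN = dotv x x - dotv p p.
      by rewrite /xN !dotvE (dotvC p x) xpp; ring.
    by clear -D83 pp0; lra.
  apply: le_trans (X _) _; last by rewrite ler_wpM2l.
  move=> u Tu u1; apply: le_trans (tang _ H' M' _ MH' H'4 ts' u Tu u1) _.
    exact: unit_scaled.
  rewrite ler_pM2l //.
  have : `|M' * dotv xi u| <= 5 / 2 * 1.
    rewrite normrM ler_pM //; apply: le_trans (dotv_norm_le _ _) _.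
    by rewrite !(@enorm_eq _ _ _ 1) ?expr1n // mulr1.
  by rewrite ler_norml => /andP[_]; clear -H'4 e1; lra.
(* To first order m . x changes by -p . t = q (xi . t) = h q B; the contribution of the normal part
   of x is of second order. *)
have bb : `|dotv m' y - b - h * (q * B)| <= 182 * e * h.
  have E : dotv (m - t) y = b + h * (q * B) + dotv (m - t) (y - (x + h *: xi))
      - dotv xN t - h * dotv xi t.
    have -> : h * (q * B) = - dotv p t.
      by rewrite pE mulrCA hB dotvZl; ring.
    rewrite /xN /b !dotvE (mx xi Txi) (dotvC xi t) (dotvC x t) (dotvC p t); ring.
  have N1 : `|dotv (m - t) (y - (x + h *: xi))| <= 1 * (2 * e * h).
    apply: le_trans (dotv_norm_le _ _) _; apply: ler_pM; rewrite ?enorm_ge0 //.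
    rewrite enorm_le // !dotvE (dotvC t m).
    have -> : dotv m t = dotv t t.
      by have := mt t Tt; rewrite dotvBl => /eqP; rewrite subr_eq0 => /eqP.
    by rewrite m1 expr1n; have := dotv_ge0 t; clear; lra.
  have N2 : `|dotv xi t| <= 10 * h.
    apply: le_trans (dotv_norm_le _ _) _.
    by rewrite (@enorm_eq _ _ xi 1) ?expr1n // mul1r.
  have := near y y1; rewrite E.
  move: N1 N2 xNt; rewrite !ler_norml.
  move=> /andP[N1 N1'] /andP[N2 N2'] /andP[N3 N3'] /andP[N4 N4'].
  have N5 : h * dotv xi t <= h * (10 * h) by rewrite ler_pM2l.
  have N6 : h * - (10 * h) <= h * dotv xi t by rewrite ler_pM2l.
  clear -tt hh2 N1 N1' N3 N3' N4 N4' N5 N6; clearbody q b.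
  by apply/andP; split; lra.
have b1 : `|b| <= 1.
  rewrite /b; apply: le_trans (dotv_norm_le _ _) _.
  by rewrite (@enorm_eq _ _ m 1) ?expr1n // mul1r.
have Hb : h * (b * q * B - 200 * e) <= b * (dotv m' y - b).
  have : `|b * (dotv m' y - b - h * (q * B))| <= 1 * (182 * e * h).
    by rewrite normrM ler_pM.
  rewrite ler_norml => /andP[+ _].
  have : 0 < e * h by rewrite mulr_gt0.
  by clear; lra.
have pots : dotv m' tau + dotv m' y ^+ 2 / (2 * enorm y) - (enorm y + 11 / 100 * enorm y ^+ 3)
    <= s + b ^+ 2 / (2 * rho) - (rho + 11 / 100 * rho ^+ 3).
  rewrite leNgt; apply/negP => lt; apply: noinc; exists y, m'; split=> //; split=> //.
  have sg1 : sg <= 1.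
    by rewrite -(sqrtr1 R) ler_wsqrtr // gerBl sqr_ge0.
  have := Hs1; rewrite -/s -/sg.
  have : enorm t * sg <= 10 * h * 1 by exact: (ler_pM (enorm_ge0 _) (sqrtr_ge0 _) tb sg1).
  have : h ^+ 2 <= h * 1 by rewrite expr2 ler_pM2l //; clear -he'; lra.
  by clear -tt heta h0; lra.
have b4 : b ^+ 2 <= rho ^+ 4 / 4 by rewrite (_ : 4 = 2 * 2)%N // exprM rD.
have yrh2 : `|enorm y - rho| <= 2 * h by clear -yrh h0; lra.
have h200 : h <= 200 * e by clear -he e0; lra.
have := ascent_step r0 rle1 y0 y1 h0 h200 b4 Hs Hb ry yrh2 pots.
move=> step.
apply: (@ascent_slack R rho q b s sg (enorm t / h) B (6 * (200 * e) / rho) r0 _ q0 qr _ b4 _ _ _ _ _ step).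
- by rewrite rD.
- by rewrite (_ : 4 = 2 * 2)%N // exprM rD qD.
- rewrite sqr_sqrtr; first ring.
  rewrite subr_ge0 -real_normK ?num_real // exprn_ile1 //.
  apply: le_trans (dotv_norm_le _ _) _.
  by rewrite !(@enorm_eq _ _ _ 1) ?expr1n // mulr1.
- by move: pot0; rewrite /potential /= -/s -/b -/rho; clear; lra.
- exact: divr_ge0 (mulr_ge0 (ler0n _ _) (mulr_ge0 (ler0n _ _) (ltW e0))) (ltW r0).
- rewrite eE ler_pdivrMr //; rewrite exprS.
  have : 0 < rho * rho ^+ 2 by rewrite mulr_gt0 // exprn_gt0.
  by clear; lra.
- have eD : 600 * e <= 6 * (200 * e) / rho.
    rewrite ler_pdivlMr //; have : e * rho <= e * 1 by rewrite ler_pM2l.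
    by clear -e0; lra.
  rewrite rD -lerBlDl; apply: le_trans eD.
  have h20 : 0 < h ^+ 2 by rewrite exprn_gt0.
  have Q : (enorm t / h) ^+ 2 - 2 * M * B + (M ^+ 2 - H ^+ 2) <= 600 * e.
    rewrite -(ler_pM2l h20); apply: le_trans (_ : _ <= 600 * e * h ^+ 2) _; last by clear; lra.
    apply: le_trans quad; rewrite le_eqVlt; apply/orP; left; apply/eqP.
    by rewrite -hB -(enorm_sqr t); field; rewrite gt_eqF.
  apply: (@le_trans _ _ ((1 - dotv x x) * (600 * e))); last first.
    rewrite ler_piMl ?(mulr_ge0 (ler0n _ _) (ltW e0)) //; clear -D0; lra.
  apply: le_trans (ler_wpM2l (ltW D1) Q); rewrite le_eqVlt; apply/orP; left; apply/eqP.
  rewrite -[b]HM; move: HM2 ((_ / _) ^+ 2); clear => HM2 T2; lra.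
Qed.

(** * Existence of a maximiser and the normal variation bound *)

Lemma closed_pair_enorm (R : realType) (d : nat) (K : set ('rV[R]_d * 'rV[R]_d)) :
  (forall p, (forall e : R, 0 < e -> exists2 q, K q &
     enorm (q.1 - p.1) < e /\ enorm (q.2 - p.2) < e) -> K p) -> closed K.
Proof.
move=> H p clp; apply: H => e e0.
have : nbhs p [set q : 'rV[R]_d * 'rV[R]_d | enorm (q.1 - p.1) < e /\ enorm (q.2 - p.2) < e].
  exists ([set y | enorm (y - p.1) < e], [set y | enorm (y - p.2) < e]).
    by split; apply/nbhs_enormP; exists e.
  by move=> [a b] [].
by move=> /clp[q [Kq []]]; exists q.
Qed.

Lemma continuous_dotv_pair (R : realType) (d : nat) :
  continuous (fun p : 'rV[R]_d * 'rV[R]_d => dotv p.2 p.1).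
Proof.
have coord (i : 'I_d) : continuous (fun u : 'rV[R]_d => u 0 i).
  apply: (@lipschitz_continuous_enorm _ _ _ 1) => u w; rewrite mul1r.
  apply: le_trans (norm_le_enorm _).
  have -> : w 0 i - u 0 i = (w - u) 0 i by rewrite !mxE.
  rewrite -[leRHS]/(mx_norm _) mx_normrE.
  exact: (le_bigmax _ (fun ij => `|(w - u) ij.1 ij.2|) (0, i)).
have -> : (fun p : 'rV[R]_d * 'rV[R]_d => dotv p.2 p.1) =
    \sum_(i < d) (fun p : 'rV[R]_d * 'rV[R]_d => p.2 0 i * p.1 0 i).
  by apply/funext => p; rewrite fct_sumE.
apply: (big_ind (fun f : 'rV[R]_d * 'rV[R]_d -> R => continuous f)).
- by move=> p; exact: cst_continuous.
- by move=> f g cf cg p; apply: continuousD; [exact: cf|exact: cg].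
- move=> i _ p; apply: continuousM.
    apply: (@continuous_comp _ _ _ snd (fun u : 'rV[R]_d => u 0 i)).
      exact: cvg_snd.
    exact: coord.
  apply: (@continuous_comp _ _ _ fst (fun u : 'rV[R]_d => u 0 i)).
    exact: cvg_fst.
  exact: coord.
Qed.

Lemma continuous_potential (R : realType) (d : nat) (tau : 'rV[R]_d) p :
  p.1 != 0 -> {for p, continuous (potential tau)}.
Proof.
move=> p0; have ce : {for p, continuous (fun p : 'rV[R]_d * 'rV[R]_d => enorm p.1)}.
  apply: (@continuous_comp _ _ _ fst (fun u : 'rV[R]_d => enorm u)); first exact: cvg_fst.
  by apply: (@lipschitz_continuous_enorm _ _ _ 1) => u w; rewrite mul1r;
     have := enormBB u w 0; rewrite !subr0.
have cb := @continuous_dotv_pair R d p.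
rewrite /potential; apply: continuousB; last first.
  apply: continuousD => //; apply: continuousM; first exact: cst_continuous.
  by apply: (@continuous_comp _ _ _ _ (fun t : R => t ^+ 3) _ ce); exact: exprn_continuous.
apply: continuousD.
  apply: (@continuous_comp _ _ _ snd (fun u => dotv u tau)); first exact: cvg_snd.
  exact: continuous_dotvl.
apply: continuousM.
  by apply: (@continuous_comp _ _ _ _ (fun t : R => t ^+ 2) _ cb); exact: exprn_continuous.
apply: continuousV; first by rewrite mulf_neq0 // ?enorm_eq0.
by apply: continuousM => //; exact: cst_continuous.
Qed.

Lemma normal_variation (R : realType) (d : nat) (S : set 'rV[R]_d)
    (Tan : 'rV[R]_d -> 'rV[R]_d -> Prop) (x m tau : 'rV[R]_d) :
  unit_ball_model S Tan -> S x -> dotv x x <= 83 / 100 ->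
  orthogonal_to (Tan x) m -> dotv m m = 1 -> Tan 0 tau -> dotv tau tau = 1 ->
  dotv m tau <= enorm x + 11 / 100 * enorm x ^+ 3.
Proof.
move=> model Sx D83 mx m1 T0 tau1.
have [->|x0] := eqVneq (dotv m tau) 0.
  by rewrite addr_ge0 ?enorm_ge0 // mulr_ge0 ?exprn_ge0 ?enorm_ge0 // divr_ge0 ?ler0n.
have nz y n : S y -> orthogonal_to (Tan y) n -> dotv n tau != 0 -> y != 0.
  by move=> Sy ny; apply: contra_neq => y0; apply: ny; rewrite y0.
have {}x0 : x != 0 by exact: nz x0.
rewrite leNgt; apply/negP => lt.
have tail0 (y n : 'rV[R]_d) : 0 <= dotv n y ^+ 2 / (2 * enorm y).
  by rewrite divr_ge0 ?sqr_ge0 // mulr_ge0 ?enorm_ge0.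
have pot0 : 0 < potential tau (x, m).
  by rewrite /potential /=; have := tail0 x m; move: lt; clear; lra.
(* The correction term is at most |y|^3 / 8, less than what is subtracted. *)
have potle y n : S y -> dotv y y <= 83 / 100 -> orthogonal_to (Tan y) n ->
    dotv n n = 1 -> y != 0 -> potential tau (y, n) <= dotv n tau.
  move=> Sy Dy ny n1 y0; have [b2 _] := two_sided_ball_bound model Sy ny n1 Dy.
  have r0 : 0 < enorm y by rewrite enorm_gt0.
  rewrite /potential /=.
  suff : dotv n y ^+ 2 / (2 * enorm y) <= enorm y ^+ 3 / 8.
    have : enorm y ^+ 3 <= enorm y * 1.
      by rewrite exprS ler_pM2l // enorm_sqr; move: Dy; clear; lra.
    by move: r0; clear; lra.
  rewrite ler_pdivrMr ?mulr_gt0 //; apply: le_trans b2 _.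
  by rewrite -(enorm_sqr y) le_eqVlt; apply/orP; left; apply/eqP; field.
(* The condition m . tau >= c keeps K away from the origin, where normals are orthogonal to tau and
   the potential divides by 0. At a maximiser m . tau >= 2 c, so a loss of c is affordable. *)
pose c := potential tau (x, m) / 2.
have c0 : 0 < c by rewrite divr_gt0.
have c2 : potential tau (x, m) = 2 * c by rewrite /c; field.
pose K := [set p : 'rV[R]_d * 'rV[R]_d | [/\ S p.1, enorm p.1 <= enorm x,
  orthogonal_to (Tan p.1) p.2, dotv p.2 p.2 = 1 & c <= dotv p.2 tau]].
have Kx : K (x, m).
  split=> //=; have := potle x m Sx D83 mx m1 x0; rewrite c2.
  by move: c0; clear; lra.
have KD p : K p -> dotv p.1 p.1 <= 83 / 100.
  move=> [_ px _ _ _]; apply: le_trans D83.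
  by rewrite -!enorm_sqr ler_pXn2r ?nnegrE ?enorm_ge0.
have K0 p : K p -> p.1 != 0.
  by move=> [Sp _ np _ cp]; apply: nz np _ => //; rewrite gt_eqF // (lt_le_trans c0).
have cB : compact [set n : 'rV[R]_d | enorm n <= 1].
  apply: bounded_closed_compact.
    exists 1; split=> [|M M1 n n1 /=]; first exact: num_real.
    by apply: le_trans (norm_le_enorm _) _; apply: le_trans n1 (ltW M1).
  apply: (@preimage_closed _ R (fun z => enorm z) [set t | t <= 1]).
    move=> z _; have := @continuous_enorm_dist R d 0 z.
    by under eq_fun do rewrite subr0.
  exact: closed_le.
have cK : compact K.
  apply: (subclosed_compact _ (compact_setX (ubm_compact model) cB)); last first.
    move=> [y n] [/= Sy _ _ n1 _]; split=> //=.
    by rewrite enorm_le // n1 expr1n.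
  apply: closed_pair_enorm => -[y n] /= near.
  have Sy : S y.
    have clS := compact_closed (@norm_hausdorff _ _) (ubm_compact model).
    apply: clS; apply/closureE_enorm => e /near[[y' n'] [/= Sy' _ _ _ _] [yy _]].
    by exists y'.
  (* Handles the conditions f <= a with f Lipschitz in the pair. Orthogonality is treated apart,
     since the tangent space moves with the point. *)
  have lim (f : 'rV[R]_d * 'rV[R]_d -> R) (a : R) C : 0 <= C ->
      (forall q, K q -> f q <= a) ->
      (forall q, enorm q.2 <= 1 -> f (y, n) <= f q + C * (enorm (q.1 - y) + enorm (q.2 - n))) ->
      f (y, n) <= a.
    move=> C0 fa fc; apply/ler_addgt0Pl => e e0.
    have C1 : 0 < 2 * C + 1 by move: C0; clear; lra.
    have [[y' n'] Kq /= [yy nn]] := near (e / (2 * C + 1)) (divr_gt0 e0 C1).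
    have [_ _ _ q1 _] := Kq.
    have E1 : enorm n' <= 1 by rewrite enorm_le // q1 expr1n.
    have := fc (y', n') E1 => /=; have := fa _ Kq.
    have : C * (enorm (y' - y) + enorm (n' - n)) <= C * (2 * (e / (2 * C + 1))).
      by rewrite ler_wpM2l //; move: yy nn; clear; lra.
    have : C * (2 * (e / (2 * C + 1))) <= e.
      have -> : C * (2 * (e / (2 * C + 1))) = (2 * C) * e / (2 * C + 1).
        by field; rewrite gt_eqF.
      by rewrite ler_pdivrMr // mulrC ler_pM2l // lerDl.
    by clear; lra.
  have En : enorm n <= 1.
    apply: (lim (fun q => enorm q.2) 1 1) => // [[y' n'] [/= _ _ _ n1 _]|[y' n'] /= _].
      by rewrite enorm_le // n1 expr1n.
    rewrite mul1r; have := enormB_ge n n'; rewrite (enormB n).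
    have := enorm_ge0 (y' - y); clear; lra.
  split=> //=.
  - apply: (lim (fun q => enorm q.1) _ 1) => // [[y' n'] []//|[y' n'] /= _].
    rewrite mul1r; have := enormB_ge y y'; rewrite (enormB y).
    have := enorm_ge0 (n' - n); clear; lra.
  - move=> u Tu; apply/eqP; rewrite -normr_le0; apply/ler_addgt0Pl => e e0; rewrite addr0.
    have u1 : 0 < enorm u + 1 by rewrite ltr_wpDl ?enorm_ge0.
    have e20 : 0 < e / 2 by rewrite divr_gt0.
    have [h0 h00 Hh] := ubm_tangent_near model Sy Tu e20.
    have [|[y' n'] [/= Sy' _ ny' n1 _] [yy nn]] := near (Num.min h0 (e / 2 / (enorm u + 1))).
      by rewrite lt_min h00 divr_gt0.
    move: yy nn; rewrite !lt_min => /andP[yy _] /andP[_ nn].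
    have [u' Tu' uu'] := Hh y' Sy' (ltW yy).
    have -> : dotv n u = - dotv (n' - n) u - dotv n' (u' - u).
      by rewrite !dotvE (ny' _ Tu'); ring.
    have B1 : `|dotv (n' - n) u| <= e / 2.
      apply: le_trans (dotv_norm_le _ _) _.
      apply: (@le_trans _ _ (e / 2 / (enorm u + 1) * (enorm u + 1))).
        by rewrite ler_pM ?enorm_ge0 ?lerDl // ltW.
      by rewrite divfK // gt_eqF.
    have B2 : `|dotv n' (u' - u)| <= e / 2.
      apply: le_trans (dotv_norm_le _ _) _.
      by rewrite (@enorm_eq _ _ n' 1) ?expr1n // mul1r.
    apply: le_trans (ler_normB _ _) _; rewrite normrN.
    by move: B1 B2; clear; lra.
  - have n1 : 1 <= enorm n.
      rewrite -lerN2; apply: (lim (fun q => - enorm q.2) (-1) 1) => // [[y' n'] [/= _ _ _ n1 _]|[y' n'] /= _].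
        by rewrite (@enorm_eq _ _ n' 1) ?expr1n.
      rewrite mul1r; have := enormB_ge n' n.
      have := enorm_ge0 (y' - y); clear; lra.
    by rewrite -enorm_sqr (le_anti (_ : enorm n <= 1 <= enorm n)) ?expr1n // En.
  - rewrite -lerN2; apply: (lim (fun q => - dotv q.2 tau) (- c) 1) => // [[y' n'] [/= _ _ _ _]|[y' n'] /= _].
      by rewrite lerN2.
    have : dotv (n' - n) tau <= enorm (n' - n) * 1.
      apply: le_trans (dotv_le _ _) _.
      by rewrite (@enorm_eq _ _ tau 1) ?expr1n.
    have := enorm_ge0 (y' - y); rewrite dotvBl; clear; lra.
have Kn0 : K !=set0 by exists (x, m).
have [|[y n]] := @compact_EVT_max _ R (potential tau) K Kn0 cK.
  apply: continuous_in_subspaceT => p; rewrite inE => /K0; exact: continuous_potential.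
rewrite inE => Kyn ymax.
have := ymax (x, m); rewrite inE => /(_ Kx) maxx.
have [Sy yx ny n1 cn] := Kyn; rewrite /= in Sy yx ny n1 cn.
have pot1 : 0 < potential tau (y, n) by exact: lt_le_trans maxx.
have [y' [n' [Sy' ny' n'1 yy' [ln' lpot]]]] :=
  potential_increase model Sy (K0 _ Kyn) (KD _ Kyn) ny n1 tau1 pot1 c0.
have := ymax (y', n'); rewrite inE leNgt lpot => H.
suff /H : K (y', n') by [].
split=> //=; first exact: le_trans yx.
have := potle y n Sy (KD _ Kyn) ny n1 (K0 _ Kyn).
by move: maxx ln'; rewrite c2; clear; lra.
Qed.

(** * Orthogonal projections and return to the original scale *)

Lemma rowspace_projection (R : realType) (k d : nat) (A : 'M[R]_(k, d))
    (m : 'rV[R]_d) : row_free A ->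
  exists z : 'rV[R]_k, forall w : 'rV[R]_k, dotv (m - z *m A) (w *m A) = 0.
Proof.
have dotE n (u w : 'rV[R]_n) : dotv u w = (u *m w^T) 0 0.
  by rewrite mxE; apply: eq_bigr => i _; rewrite mxE.
move=> fA; have Gu : A *m A^T \in unitmx.
  rewrite -row_free_unit; apply: inj_row_free => v vG.
  have : dotv (v *m A) (v *m A) == 0.
    by rewrite dotE trmx_mul !mulmxA -(mulmxA v) vG mul0mx mxE.
  by rewrite dotv_eq0 => /eqP vA; apply: (row_free_inj fA); rewrite vA mul0mx.
exists (m *m A^T *m invmx (A *m A^T)) => w.
rewrite dotE trmx_mul mulmxBl !mulmxA -(mulmxA _ A A^T) mulmxKV // subrr.
by rewrite mxE.
Qed.

Section ScaledModel.
Context {R : realType}.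
Variables (d k : nat) (S : set 'rV[R]_d).
Hypothesis kd : (k <= d)%N.
Hypothesis cS : compact S.
Hypothesis eS : embedded_submanifold k S.
Implicit Types (x y u n p : 'rV[R]_d).

Lemma tangent_projection x m : S x -> exists2 t, tangent_vector S x t &
  normal_vector S x (m - t).
Proof.
move=> Sx; have [A fA H] := tangent_basis kd eS Sx.
have [z Hz] := rowspace_projection m fA.
exists (z *m A); first by apply/H; exists z.
by move=> u /H[w ->].
Qed.

(** The tangent vectors need no rescaling: a homothety only multiplies velocities by a constant, and
    tangent spaces are linear. *)
Lemma scaled_model p : S p -> 0 < lfs S p ->
  unit_ball_model [set y | S (p + lfs S p *: y)]
    (fun y u => tangent_vector S (p + lfs S p *: y) u).
Proof.
move=> Sp; set L := lfs S p => L0; have Ln : L != 0 by rewrite gt_eqF.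
have subE (x y : 'rV[R]_d) : (p + L *: y) - (p + L *: x) = L *: (y - x).
  by apply/rowP => i; rewrite !mxE; ring.
have enormL u : enorm (L *: u) = L * enorm u by rewrite enormZ gtr0_norm.
have backE (s : 'rV[R]_d) : p + L *: (L^-1 *: (s - p)) = s.
  by rewrite scalerA divff // scale1r addrC subrK.
split.
- have -> : [set y | S (p + L *: y)] = (fun z => L^-1 *: (z - p)) @` S.
    apply/seteqP; split=> [y /= Sy|_ [z Sz <-] /=]; last by rewrite backE.
    by exists (p + L *: y) => //; rewrite addrAC subrr add0r scalerA mulVf // scale1r.
  apply: continuous_compact => //; apply: continuous_subspaceT => z B.
  move=> /nbhs_enormP[e e0 eB]; apply/nbhs_enormP; exists (L * e).
    by rewrite mulr_gt0.
  move=> y yz; apply: eB.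
  have -> : L^-1 *: (y - p) - L^-1 *: (z - p) = L^-1 *: (y - z).
    by apply/rowP => i; rewrite !mxE; ring.
  by rewrite enormZ gtr0_norm ?invr_gt0 // ltr_pdivrMl.
- by rewrite /= scaler0 addr0.
- by move=> x a u; exact: (tangent_vectorZ kd eS).
- by move=> x u v; exact: (tangent_vectorD kd eS).
- by move=> x m Sx; exact: tangent_projection.
- move=> x u e Sx tu e0; have [h0 h00 H] := local_tangent kd eS Sx tu e0.
  exists (h0 / L) => [|y Sy yx]; first by rewrite divr_gt0.
  by apply: H => //; rewrite subE enormL mulrC -ler_pdivlMr.
(* Rescaling turns the quadratic error e' (L h)^2 into e' L h^2, hence e / L. *)
- move=> x e Sx e0; set e' := Num.min e (e / L).
  have e'0 : 0 < e' by rewrite lt_min e0 divr_gt0.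
  have e'e : e' <= e by rewrite ge_min lexx.
  have e'L : e' * L <= e by rewrite -ler_pdivlMr // ge_min lexx orbT.
  have [h0 h00 H] := local_curves kd eS Sx e'0.
  exists (h0 / L) => [|h y u /andP[h1 h2] Sy yx tu u1]; first by rewrite divr_gt0.
  have [||s [s' [Ss Ss' Hs Hs' Hss]]] := H (L * h) _ u _ Sy _ tu u1.
  + by rewrite mulr_gt0 //= mulrC -ler_pdivlMr.
  + by rewrite subE enormL ler_pM2l.
  have scale (a : 'rV[R]_d) (b c : 'rV[R]_d) (q : R) :
      a = L *: b -> enorm a <= L * q -> enorm b <= q.
    by move=> -> ; rewrite enormL ler_pM2l.
  have e'h : L * (e' * h) <= L * (e * h) by rewrite ler_pM2l // ler_pM2r.
  exists (L^-1 *: (s - p)), (L^-1 *: (s' - p)); split; rewrite /= ?backE //.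
  + apply: (scale (s - (p + L *: y + (L * h) *: u))) => //.
      by apply/rowP => i; rewrite !mxE; field.
    by apply: le_trans Hs _; rewrite mulrCA.
  + apply: (scale (s' - (p + L *: y - (L * h) *: u))) => //.
      by apply/rowP => i; rewrite !mxE; field.
    by apply: le_trans Hs' _; rewrite mulrCA.
  + apply: (scale (s - s' - (2 * (L * h)) *: u)) => //.
      by apply/rowP => i; rewrite !mxE; field.
    apply: le_trans Hss _.
    have -> : e' * (L * h) ^+ 2 = L * ((e' * L) * h ^+ 2) by ring.
    by rewrite ler_pM2l // ler_pM2r // exprn_gt0.
- move=> x n t s Sx nx n1 x1 t0 xt Ss.
  have := @empty_ball_lfs _ _ _ _ kd cS eS p (p + L *: x) n (L * t) (p + L *: s) Sx nx n1.
  rewrite mulr_ge0 ?(ltW L0) // -/L.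
  have -> : p + L *: x - p = L *: x by rewrite addrAC subrr add0r.
  have -> : p + L *: x + (L * t) *: n - p = L *: (x + t *: n).
    by apply/rowP => i; rewrite !mxE; ring.
  rewrite !enormL subE gtr_pMr // ger_pMr //.
  move=> /(_ isT x1 xt Ss); rewrite !(dotvZr, dotvZl) => H.
  have L2 : 0 < L ^+ 2 by rewrite exprn_gt0.
  by rewrite -(ler_pM2l L2); move: H; clear; lra.
Qed.

Lemma normal_variation_lfs p x n tau : S p -> S x -> 0 < lfs S p ->
  normal_vector S x n -> dotv n n = 1 -> tangent_vector S p tau -> dotv tau tau = 1 ->
  (enorm (x - p) / lfs S p) ^+ 2 <= 83 / 100 ->
  dotv n tau <= enorm (x - p) / lfs S p + 11 / 100 * (enorm (x - p) / lfs S p) ^+ 3.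
Proof.
move=> Sp Sx L0 nx n1 tt tau1; set L := lfs S p in L0 *; have Ln : L != 0 by rewrite gt_eqF.
have xE : p + L *: (L^-1 *: (x - p)) = x.
  by rewrite scalerA divff // scale1r addrC subrK.
have <- : enorm (L^-1 *: (x - p)) = enorm (x - p) / L.
  by rewrite enormZ gtr0_norm ?invr_gt0 // mulrC.
rewrite enorm_sqr => D83; apply: (normal_variation (scaled_model Sp L0)) => //=.
- by rewrite xE.
- by rewrite xE.
- by rewrite scaler0 addr0.
Qed.

End ScaledModel.

(** * Normals at a vertex against the plane of the triangle *)

Section VertexBound.
Context {R : realType} {d : nat}.
Implicit Types (u e f n t : 'rV[R]_d) (a b c C L r : R).

(* [u] is the vector from the vertex to the circumcentre. Making the
   coefficients of [t] nonnegative costs at most the factor [c]. *)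
Lemma plane_vector_bound n u e f a b c C L : 0 < L ->
  dotv u e = dotv e e / 2 -> dotv u f = dotv f f / 2 ->
  `|dotv n e| <= dotv e e / (2 * L) -> `|dotv n f| <= dotv f f / (2 * L) ->
  0 <= c -> 0 <= C -> C <= 1 -> dotv e f <= C * (enorm e * enorm f) ->
  1 + C <= c ^+ 2 * (1 - C) ->
  dotv n (a *: e + b *: f) <= enorm u / L * c * enorm (a *: e + b *: f).
Proof.
move=> L0 ue uf ne nf c0 C0 C1 ef cC.
set t := a *: e + b *: f; set t' := `|a| *: e + `|b| *: f.
have nt : dotv n t <= dotv u t' / L.
  rewrite /t /t' !dotvDr !dotvZr ue uf.
  have B a' (g : 'rV[R]_d) : `|dotv n g| <= dotv g g / (2 * L) ->
      a' * dotv n g <= `|a'| * (dotv g g / (2 * L)).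
    move=> ng; apply: le_trans (ler_norm _) _; rewrite normrM.
    by rewrite ler_wpM2l.
  apply: le_trans (lerD (B a e ne) (B b f nf)) _.
  by rewrite le_eqVlt; apply/orP; left; apply/eqP; field; rewrite gt_eqF.
have c2 : C * (c ^+ 2 + 1) <= c ^+ 2 - 1 by move: cC; clear; lra.
have c21 : 1 <= c ^+ 2.
  have : 0 <= C * (c ^+ 2 + 1) by rewrite mulr_ge0 // addr_ge0 // sqr_ge0.
  by move: c2; clear; lra.
have tt : dotv t' t' <= c ^+ 2 * dotv t t.
  have -> : dotv t' t' = `|a| ^+ 2 * dotv e e + `|b| ^+ 2 * dotv f f +
      2 * (`|a| * `|b|) * dotv e f.
    by rewrite /t' !dotvE (dotvC f e); ring.
  have -> : dotv t t = `|a| ^+ 2 * dotv e e + `|b| ^+ 2 * dotv f f +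
      2 * (a * b) * dotv e f.
    by rewrite /t !dotvE (dotvC f e) !real_normK ?num_real //; ring.
  have Q : 0 <= (c ^+ 2 - 1) * (`|a| * enorm e - `|b| * enorm f) ^+ 2.
    by rewrite mulr_ge0 ?sqr_ge0 // subr_ge0.
  have ab0 : 0 <= `|a| * `|b| by rewrite mulr_ge0.
  have P : `|a| * `|b| * dotv e f <= C * (`|a| * enorm e * (`|b| * enorm f)).
    apply: le_trans (ler_wpM2l ab0 ef) _.
    by rewrite le_eqVlt; apply/orP; left; apply/eqP; ring.
  have XY : 0 <= `|a| * enorm e * (`|b| * enorm f).
    by rewrite !mulr_ge0 ?enorm_ge0.
  have P2 : (c ^+ 2 + 1) * (`|a| * `|b| * dotv e f) <=
      (c ^+ 2 - 1) * (`|a| * enorm e * (`|b| * enorm f)).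
    have c20 : 0 <= c ^+ 2 + 1 by rewrite addr_ge0 ?sqr_ge0.
    apply: le_trans (ler_wpM2l c20 P) _.
    by rewrite (mulrA _ C) (mulrC _ C) ler_wpM2r.
  rewrite -(enorm_sqr e) -(enorm_sqr f).
  have [ab|ab] := leP 0 (a * b).
    have -> : a * b = `|a| * `|b| by rewrite -normrM ger0_norm.
    rewrite ler_peMl //.
    have := dotv_ge0 t'; rewrite /t' !dotvE (dotvC f e) -(enorm_sqr e) -(enorm_sqr f).
    by clear; lra.
  have -> : a * b = - (`|a| * `|b|) by rewrite -normrM ltr0_norm // opprK.
  by clear -Q P2 XY; lra.
apply: le_trans nt _.
have -> : enorm u / L * c * enorm t = enorm u * (c * enorm t) / L by ring.
rewrite ler_pM2r ?invr_gt0 //.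
apply: le_trans (dotv_le _ _) _; rewrite ler_wpM2l ?enorm_ge0 //.
rewrite enorm_le ?mulr_ge0 ?enorm_ge0 // exprMn enorm_sqr.
exact: tt.
Qed.

End VertexBound.

(** The tangent balls of radius lfs(v) at v bound |n . (s - v)| by |s - v|^2 / (2 lfs(v)) at the
    other vertices. If C = cos psi, then psi is at most the angle at v, and the condition relating c
    and C reads cot (psi / 2) <= c. *)
Lemma vertex_normal_bound (R : realType) (d k : nat) (S : set 'rV[R]_d)
    (v w z o n : 'rV[R]_d) (a b c C : R) :
  (k <= d)%N -> compact S -> embedded_submanifold k S -> S v -> S w -> S z ->
  0 < lfs S v -> enorm (o - v) = enorm (o - w) -> enorm (o - v) = enorm (o - z) ->
  normal_vector S v n -> dotv n n = 1 ->
  0 <= c -> 0 <= C -> C <= 1 ->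
  dotv (w - v) (z - v) <= C * (enorm (w - v) * enorm (z - v)) ->
  1 + C <= c ^+ 2 * (1 - C) ->
  let t := a *: (w - v) + b *: (z - v) in
  dotv n t <= enorm (o - v) / lfs S v * c * enorm t.
Proof.
move=> kd cS eS Sv Sw Sz L0 ow oz nv n1 c0 C0 C1 wz cC.
have center s : enorm (o - v) = enorm (o - s) ->
    dotv (o - v) (s - v) = dotv (s - v) (s - v) / 2.
  move=> /enorm_eqP; have -> : o - s = (o - v) - (s - v) by rewrite opprB addrA subrK.
  by move: (o - v) (s - v) => A B; rewrite !dotvE (dotvC B A); clear; lra.
have bound m s : S s -> normal_vector S v m -> dotv m m = 1 ->
    dotv m (s - v) <= dotv (s - v) (s - v) / (2 * lfs S v).
  move=> Ss mv m1; rewrite ler_pdivlMr ?mulr_gt0 // mulrC.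
  apply: (empty_ball_lfs (p := v) kd cS eS Sv mv m1 (ltW L0)) => //.
    by rewrite subrr enorm0.
  rewrite addrAC subrr add0r enormZ gtr0_norm //.
  by rewrite (@enorm_eq _ _ m 1) ?expr1n // mulr1.
have boundN s : S s -> `|dotv n (s - v)| <= dotv (s - v) (s - v) / (2 * lfs S v).
  move=> Ss; rewrite ler_norml bound // andbT lerNl -dotvNl; apply: bound => //.
    by move=> u /nv nu; rewrite dotvNl nu oppr0.
  by rewrite dotvNl dotvNr opprK.
exact: (plane_vector_bound _ _ L0 (center w ow) (center z oz) (boundN w Sw) (boundN z Sz) c0 C0 C1 wz cC).
Qed.

(** * Distances from the vertices to the nearest point *)

Lemma barycentric_sqr_dist (R : realType) (d : nat) (v v' v'' o x q : 'rV[R]_d)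
    (r a b c : R) :
  enorm (o - v) = r -> enorm (o - v') = r -> enorm (o - v'') = r ->
  a + b + c = 1 -> x = a *: v + b *: v' + c *: v'' ->
  a * enorm (q - v) ^+ 2 + b * enorm (q - v') ^+ 2 + c * enorm (q - v'') ^+ 2 =
  enorm (q - x) ^+ 2 + r ^+ 2 - enorm (x - o) ^+ 2.
Proof.
move=> rv rv' rv'' abc ->.
have -> : r ^+ 2 = a * r ^+ 2 + b * r ^+ 2 + c * r ^+ 2 by rewrite -!mulrDl abc mul1r.
rewrite -{1}rv -{1}rv' -{1}rv''; have cE : c = 1 - a - b by rewrite -abc; ring.
have shift w : q - w = (q - o) + (o - w) by rewrite addrA subrK.
have xo : a *: v + b *: v' + c *: v'' - o =
    - (a *: (o - v) + b *: (o - v') + c *: (o - v'')).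
  by rewrite cE; apply/rowP => i; rewrite !mxE; ring.
have -> : q - (a *: v + b *: v' + c *: v'') =
    (q - o) - (a *: v + b *: v' + c *: v'' - o).
  by apply/rowP => i; rewrite !mxE; ring.
rewrite xo (shift v) (shift v') (shift v'') cE !enorm_sqr.
move: (q - o) (o - v) (o - v') (o - v'') => Q A B C; rewrite !dotvE.
rewrite (dotvC A Q) (dotvC B Q) (dotvC C Q) (dotvC B A) (dotvC C A) (dotvC C B).
by ring.
Qed.

Lemma weighted_mean_ge (R : realFieldType) (a b c y y' y'' m : R) :
  0 <= a -> 0 <= b -> 0 <= c -> a + b + c = 1 ->
  m <= y -> m <= y' -> m <= y'' -> m <= a * y + b * y' + c * y''.
Proof.
move=> a0 b0 c0 abc my my' my''.
have -> : m = a * m + b * m + c * m by rewrite -!mulrDl abc mul1r.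
by rewrite !lerD // ler_wpM2l.
Qed.

Lemma nearest_point_vertex_dist (R : realType) (d k : nat) (S : set 'rV[R]_d)
    (v v' v'' o x xt : 'rV[R]_d) (r a b c : R) :
  (k <= d)%N -> compact S -> embedded_submanifold k S ->
  (forall w, w \in [:: v; v'; v''] -> [/\ S w, enorm (o - w) = r & 2 * r <= lfs S w]) ->
  0 <= a -> 0 <= b -> 0 <= c -> a + b + c = 1 -> x = a *: v + b *: v' + c *: v'' ->
  0 < r -> nearest_point S x xt ->
  (forall w, w \in [:: v; v'; v''] -> enorm (w - xt) <= 2 * r) /\
  (forall u, u \in [:: v; v'; v''] ->
    (forall w, w \in [:: v; v'; v''] -> enorm (x - u) <= enorm (x - w)) ->
    enorm (u - xt) <= 13 / 10 * r).
Proof.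
move=> kd cS eS V a0 b0 c0 abc xE r0 nx.
have [vV v'V v''V] : [/\ v \in [:: v; v'; v''], v' \in [:: v; v'; v''] &
    v'' \in [:: v; v'; v'']] by rewrite !inE !eqxx !orbT.
have [_ rv _] := V v vV; have [_ rv' _] := V v' v'V; have [_ rv'' _] := V v'' v''V.
have bary q := barycentric_sqr_dist q rv rv' rv'' abc xE.
have mean q m : 0 <= m -> (forall w, w \in [:: v; v'; v''] -> m <= enorm (q - w)) ->
    m ^+ 2 <= enorm (q - x) ^+ 2 + r ^+ 2 - enorm (x - o) ^+ 2.
  move=> m0 mw; rewrite -bary; apply: weighted_mean_ge => //;
    by rewrite ler_pXn2r ?nnegrE ?enorm_ge0 //; apply: mw.
set rho := enorm (x - o) in mean *.
have rho0 : 0 <= rho by exact: enorm_ge0.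
have rhor : rho <= r.
  have := mean x 0 (lexx 0) (fun w _ => enorm_ge0 _).
  rewrite subrr enorm0 !expr0n /= add0r subr_ge0 ler_pXn2r ?nnegrE //.
  exact: ltW.
(* Chosen so that s^2 + r^2 - rho^2 = 4 r^2: closer than s to x, some vertex is closer than 2 r, so
   the medial axis is not met. *)
pose s := Num.sqrt (3 * r ^+ 2 + rho ^+ 2).
have s2 : s ^+ 2 = 3 * r ^+ 2 + rho ^+ 2.
  by rewrite sqr_sqrtr // addr_ge0 ?sqr_ge0 // mulr_ge0 ?sqr_ge0.
have s0 : 0 <= s by exact: sqrtr_ge0.
have [Sxt near] := nx.
have hs : enorm (x - xt) + s <= 2 * r.
  have r20 : 0 <= 2 * r by rewrite mulr_ge0 // ltW.
  have [xxt|h0] := eqVneq (x - xt) 0.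
    rewrite xxt enorm0 add0r -(ler_pXn2r (ltn0Sn 1)) ?nnegrE // s2.
    have : rho ^+ 2 <= r ^+ 2 by rewrite ler_pXn2r ?nnegrE // ltW.
    by clear; lra.
  have {}h0 : 0 < enorm (x - xt) by rewrite enorm_gt0.
  set h := enorm (x - xt) in h0 *; set n := h^-1 *: (x - xt).
  have n1 : dotv n n = 1 by apply: unit_scaled; rewrite -enorm_gt0.
  have xn : x = xt + h *: n.
    by rewrite scalerA divff ?gt_eqF // scale1r addrC subrK.
  have E t : enorm (xt + t *: n - x) = `|t - h|.
    have -> : xt + t *: n - x = (t - h) *: n.
      by rewrite {1}xn; apply/rowP => i; rewrite !mxE; ring.
    by rewrite enormZ (@enorm_eq _ _ n 1) ?expr1n // mulr1.
  have hs0 : 0 <= h + s by rewrite addr_ge0 // ltW.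
  have [_ far] : nearest_point S (xt + (h + s) *: n) xt.
    apply: (nearest_point_sweep cS n1 h0) => //; first by rewrite -xn.
    move=> t /andP[ht ths] med.
    have M w : w \in [:: v; v'; v''] -> 2 * r <= enorm (xt + t *: n - w).
      move=> /V[_ _ rw]; apply: le_trans rw _.
      by have := lfs_le w med; rewrite eucl_distC.
    have := mean _ _ r20 M; rewrite E => X.
    have : `|t - h| ^+ 2 < s ^+ 2.
      by rewrite ltr_pXn2r ?nnegrE // ger0_norm ?subr_ge0 // ltrBlDl.
    by move: X; rewrite s2; clear; lra.
  (* No vertex is interior to the swept ball of radius h + s, and averaging once more gives (h +
     s)^2 <= 4 r^2. *)
  have := mean (xt + (h + s) *: n) (h + s) hs0.
  have -> : enorm (xt + (h + s) *: n - x) = s.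
    by rewrite E addrAC subrr add0r ger0_norm.
  rewrite s2 => X; rewrite -(ler_pXn2r (ltn0Sn 1)) ?nnegrE //.
  apply: le_trans (X _) _; last by clear; lra.
  move=> w /V[Sw _ _]; apply: le_trans (far w Sw).
  have -> : eucl_dist (xt + (h + s) *: n) xt = `|h + s| * enorm n.
    by rewrite /eucl_dist addrAC subrr add0r enormZ.
  by rewrite (@enorm_eq _ _ n 1) ?expr1n // mulr1 ler_norm.
have tri w : enorm (w - xt) <= enorm (x - w) + enorm (x - xt).
  by have := eucl_dist_triangle x w xt; rewrite /eucl_dist (enormB w x).
split=> [w wV|u uV umin].
  have [_ rw _] := V w wV.
  have xw : enorm (x - w) <= rho + r.
    by have := eucl_dist_triangle o x w; rewrite /eucl_dist rw.
  have rs : r + rho <= s.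
    rewrite -(ler_pXn2r (ltn0Sn 1)) ?nnegrE ?addr_ge0 // ?(ltW r0) // s2.
    have : r * rho <= r * r by rewrite ler_pM2l.
    by clear; lra.
  by move: (tri w) hs xw rs; clear; lra.
have xu : enorm (x - u) <= r.
  rewrite -(ler_pXn2r (ltn0Sn 1)) ?nnegrE ?enorm_ge0 ?(ltW r0) //.
  have := mean x _ (enorm_ge0 (x - u)) umin; rewrite subrr enorm0 expr0n /= add0r.
  by have := sqr_ge0 rho; clear; lra.
(* 1.7 is below sqrt 3, and r + 2 r - 1.7 r = 1.3 r is below sqrt 2 r. *)
have sr : 17 / 10 * r <= s.
  have r1 : 0 <= 17 / 10 * r by rewrite mulr_ge0 ?divr_ge0 // ltW.
  rewrite -(ler_pXn2r (ltn0Sn 1)) ?nnegrE // s2.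
  by have := sqr_ge0 rho; have := sqr_ge0 r; clear; lra.
by move: (tri u) hs xu sr; clear; lra.
Qed.

(** * Angles between lines and flats *)

Lemma ler_sin_pi2 (R : realType) (x y : R) :
  - (pi / 2) <= x -> x <= y -> y <= pi / 2 -> sin x <= sin y.
Proof.
move=> x0; rewrite le_eqVlt => /predU1P[-> //|xy] y1.
by rewrite ltW // ltr_sin // in_itv /= ?x0 ?y1 ?(le_trans (ltW xy)) ?(le_trans x0 (ltW xy)).
Qed.

Lemma acos_le_angle (R : realType) (y theta : R) : 0 <= theta -> theta <= pi / 2 ->
  0 <= y -> y <= 1 -> 1 - y ^+ 2 <= sin theta ^+ 2 -> acos y <= theta.
Proof.
move=> t0 t1 y0 y1 H.
have yI : -1 <= y <= 1 by rewrite y1 andbT (le_trans _ y0) // lerN10.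
have cy : cos theta <= y.
  have ct : 0 <= cos theta.
    by apply: cos_ge0_pihalf; rewrite t1 andbT (le_trans _ t0) // oppr_le0 divr_ge0 ?pi_ge0.
  rewrite -(ler_pXn2r (ltn0Sn 1)) ?nnegrE //.
  by have := cos2Dsin2 theta; move: H; clear; lra.
rewrite leNgt; apply/negP => lt.
have tpi : theta <= pi.
  by apply: le_trans t1 _; rewrite ler_pdivrMr // ler_peMr ?pi_ge0 // ler1n.
have : cos (acos y) < cos theta.
  by rewrite ltr_cos // in_itv /= ?t0 ?tpi // acos_ge0 // acos_lepi.
by rewrite acosK ?in_itv //= ltNge cy.
Qed.

Lemma line_angle_bounds (R : realType) (d : nat) (u w : 'rV[R]_d) :
  0 <= line_angle u w <= pi / 2.
Proof.
rewrite /line_angle; set y := _ / _.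
have y0 : 0 <= y by rewrite divr_ge0 ?mulr_ge0 ?enorm_ge0.
have y1 : y <= 1.
  rewrite /y; have [->|uw] := eqVneq (enorm u * enorm w) 0.
    by rewrite invr0 mulr0.
  rewrite ler_pdivrMr ?mul1r; first exact: dotv_norm_le.
  by rewrite lt_def uw mulr_ge0 ?enorm_ge0.
have pi0 : 0 <= (pi / 2 : R) by rewrite divr_ge0 ?pi_ge0.
rewrite acos_ge0 ?y1 ?andbT ?(le_trans _ y0) ?lerN10 //=.
by apply: acos_le_angle => //; rewrite sin_pihalf expr1n gerBl sqr_ge0.
Qed.

(** Line angles never exceed pi / 2, so a witness is asked for only below that value. If F or G
    contains no line, the supremum or infimum is over the empty set and equals 0, which the sign of
    theta covers. *)
Lemma directed_angle_le (R : realType) (d : nat) (F G : set 'rV[R]_d) (theta : R) :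
  0 <= theta ->
  (forall u, line_direction F u -> theta < pi / 2 ->
    exists2 w, line_direction G w & line_angle u w <= theta) ->
  directed_angle F G <= theta.
Proof.
move=> t0 H; have [[u0 Fu0]|F0] := pselect (line_direction F !=set0); last first.
  rewrite /directed_angle (_ : [set _ | _ in _] = set0) ?sup0 //.
  by apply/seteqP; split=> // _ [u Fu <-]; case: F0; exists u.
apply: ge_sup; first by exists (inf [set line_angle u0 w | w in line_direction G]), u0.
move=> _ [u Fu <-].
have lb w : line_direction G w -> inf [set line_angle u w | w in line_direction G] <= line_angle u w.
  move=> Gw; apply: ge_inf; last by exists w.
  by exists 0 => _ [z _ <-]; have /andP[] := line_angle_bounds u z.
have [tlt|tge] := ltP theta (pi / 2).
  by have [w Gw le] := H u Fu tlt; apply: le_trans le; exact: lb.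
have [[w Gw]|G0] := pselect (line_direction G !=set0).
  by apply: le_trans (lb w Gw) (le_trans _ tge); have /andP[] := line_angle_bounds u w.
rewrite (_ : [set _ | _ in _] = set0) ?inf0 //.
by apply/seteqP; split=> // _ [w Gw <-]; case: G0; exists w.
Qed.

Section OrthogonalFlats.
Context {R : realType} {d : nat}.
Implicit Types (p q u w n : 'rV[R]_d).

(** A common form for the two flats of the theorem: the rows of A are two edges of the triangle, or
    a basis of the tangent space. *)
Definition orthogonal_flat k p (A : 'M[R]_(k, d)) : set 'rV[R]_d :=
  [set q | (q - p) *m A^T = 0].

Lemma orthogonal_flat_direction k p (A : 'M[R]_(k, d)) u :
  line_direction (orthogonal_flat p A) u <-> u != 0 /\ u *m A^T = 0.
Proof.
split=> [[u0 [q qF]]|[u0 uA]]; last first.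
  split=> //; exists p => t /=.
  by rewrite /orthogonal_flat /= addrAC subrr add0r -scalemxAl uA scaler0.
split=> //; have q0 := qF 0; have q1 := qF 1.
rewrite /orthogonal_flat /= scale0r addr0 in q0.
rewrite /orthogonal_flat /= scale1r in q1.
have -> : u = (q + u - p) - (q - p) by apply/rowP => i; rewrite !mxE; ring.
by rewrite mulmxBl q0 q1 subrr.
Qed.

Lemma mulmx_tr_eq0 k (A : 'M[R]_(k, d)) u :
  u *m A^T = 0 <-> forall z : 'rV[R]_k, dotv u (z *m A) = 0.
Proof.
have dotE m (a b : 'rV[R]_m) : dotv a b = (a *m b^T) 0 0.
  by rewrite mxE; apply: eq_bigr => i _; rewrite mxE.
split=> [uA z|H]; first by rewrite dotE trmx_mul mulmxA uA mul0mx mxE.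
apply/eqP; rewrite -dotv_eq0 -[X in dotv _ X]trmxK; apply/eqP.
have := H (u *m A^T); rewrite !dotE trmx_mul trmxK mulmxA.
by rewrite trmx_mul trmxK !mulmxA.
Qed.

(** Rank and nullity give one description of the flat; since [flat_dim] chooses a description, any
    other must be shown to have the same kernel as direction space. *)
Lemma flat_dim_orthogonal k p (A : 'M[R]_(k, d)) : row_free A ->
  flat_dim (orthogonal_flat p A) = (d - k)%N.
Proof.
move=> fA; pose f := linfun (mulmxr A^T : 'rV[R]_d -> 'rV[R]_k).
have dimK : \dim (lker f) = (d - k)%N.
  have := limg_ker_dim f fullv; rewrite capfv.
  have -> : (f @: fullv)%VS = fullv.
    apply/vspaceP => y; rewrite memvf.
    have /row_freeP[B AB] := fA; have -> : y = f (y *m B^T).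
      by rewrite lfunE /= -mulmxA -trmx_mul AB trmx1 mulmx1.
    by rewrite memv_img // memvf.
  rewrite !dimvf /dim /= !mul1n => /(congr1 (subn^~ k)) /=.
  by rewrite addnK.
rewrite /flat_dim; apply: xget_unique => [|m [q [L [<- E]]]].
  exists p, (lker f); split=> //; apply/seteqP; split=> [q /= qA|_ [u /= + <-]].
    exists (q - p); last by rewrite addrC subrK.
    by rewrite /= memv_ker lfunE /= qA.
  by rewrite memv_ker lfunE /orthogonal_flat /= => /eqP uA; rewrite addrAC subrr add0r.
rewrite -dimK; congr (\dim _); apply/vspaceP => u.
have Ep : orthogonal_flat p A p by rewrite /orthogonal_flat /= subrr mul0mx.
rewrite memv_ker lfunE /=; move: Ep; rewrite E => -[u0 /= Lu0 pE].
have qF w : w \in L -> (q + w - p) *m A^T = 0.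
  by move=> Lw; have : orthogonal_flat p A (q + w) by rewrite E; exists w.
have qp : (q - p) *m A^T = 0 by have := qF 0 (mem0v L); rewrite addr0.
apply/idP/eqP => [Lu|uA].
  by have := qF u Lu; rewrite addrAC mulmxDl qp add0r.
have : orthogonal_flat p A (p + u).
  by rewrite /orthogonal_flat /= addrAC subrr add0r.
rewrite E => -[w /= Lw] /eqP; rewrite -pE -addrA (inj_eq (addrI q)) => /eqP wE.
by rewrite (_ : u = w - u0) ?memvB // wE addrAC subrr add0r.
Qed.

End OrthogonalFlats.

Lemma line_angleC (R : realType) (d : nat) (u w : 'rV[R]_d) :
  line_angle u w = line_angle w u.
Proof. by rewrite /line_angle dotvC (mulrC (enorm u)). Qed.

Lemma line_angle_projection (R : realType) (d : nat) (u w t : 'rV[R]_d) (theta : R) :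
  0 <= theta -> theta < pi / 2 -> u = w + t -> dotv w t = 0 -> u != 0 ->
  dotv t t <= sin theta ^+ 2 * dotv u u -> w != 0 /\ line_angle u w <= theta.
Proof.
move=> t0 t1 uE wt u0 H.
have uu : dotv u u = dotv w w + dotv t t.
  by rewrite uE !dotvE (dotvC t w) wt; ring.
have uw : dotv u w = dotv w w by rewrite uE dotvDl (dotvC t w) wt addr0.
have ct : 0 < cos theta.
  by apply: cos_gt0_pihalf; rewrite t1 andbT (lt_le_trans _ t0) // oppr_lt0 divr_gt0 // pi_gt0.
have uu0 : 0 < dotv u u by rewrite lt_def dotv_ge0 dotv_eq0 u0.
have w0 : w != 0.
  apply/eqP => w0; move: H; rewrite uu w0 dotv0l add0r => H.
  move: uu0; rewrite uu w0 dotv0l add0r => tt0.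
  have : 0 < cos theta ^+ 2 * dotv t t by rewrite mulr_gt0 // exprn_gt0.
  have -> : cos theta ^+ 2 = 1 - sin theta ^+ 2.
    by rewrite -(cos2Dsin2 theta) addrK.
  by move: H; clear; lra.
split=> //; rewrite /line_angle uw ger0_norm ?dotv_ge0 // -(enorm_sqr w).
have nw : 0 < enorm w by rewrite enorm_gt0.
have nu : 0 < enorm u by rewrite enorm_gt0.
have -> : enorm w ^+ 2 / (enorm u * enorm w) = enorm w / enorm u.
  by field; rewrite !gt_eqF.
apply: acos_le_angle => //; first exact: ltW.
- by rewrite divr_ge0 // ltW.
- by rewrite ler_pdivrMr // mul1r enorm_le ?(ltW nu) // enorm_sqr uu lerDl dotv_ge0.
- rewrite expr_div_n !enorm_sqr.
  have -> : 1 - dotv w w / dotv u u = dotv t t / dotv u u.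
    by rewrite uu; field; rewrite -uu gt_eqF.
  by rewrite ler_pdivrMr.
Qed.

(** If k > 2, the flat of B is the smaller one and its lines are projected along the row space of A.
    If k = 2, the dimensions agree and [flat_angle] starts from the flat of A; the partner of a line
    is then the line of the flat of B that projects onto it. *)
Lemma orthogonal_flat_angle (R : realType) (d k : nat) (A : 'M[R]_(2, d))
    (B : 'M[R]_(k, d)) (p q : 'rV[R]_d) (theta : R) :
  (2 <= k)%N -> (k <= d)%N -> row_free A -> row_free B -> 0 <= theta ->
  (theta < pi / 2 -> forall n (z : 'rV[R]_2), n *m B^T = 0 -> dotv n n = 1 ->
     dotv (z *m A) (z *m A) = 1 -> dotv n (z *m A) <= sin theta) ->
  flat_angle (orthogonal_flat p A) (orthogonal_flat q B) <= theta.
Proof.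
move=> k2 kd fA fB t0 H.
have proj u (z : 'rV[R]_2) : theta < pi / 2 -> u *m B^T = 0 -> u != 0 ->
    dotv u (z *m A) = dotv (z *m A) (z *m A) ->
    dotv (z *m A) (z *m A) <= sin theta ^+ 2 * dotv u u.
  move=> t1 uB u0 uz; have [z0|z0] := eqVneq (z *m A) 0.
    by rewrite z0 dotv0l mulr_ge0 ?sqr_ge0 ?dotv_ge0.
  have nu : 0 < enorm u by rewrite enorm_gt0.
  have nz : 0 < enorm (z *m A) by rewrite enorm_gt0.
  have := H t1 ((enorm u)^-1 *: u) ((enorm (z *m A))^-1 *: z).
  rewrite -!scalemxAl uB scaler0 !unit_scaled // => /(_ erefl erefl erefl).
  rewrite dotvZl dotvZr uz -!enorm_sqr => X.
  have {}X : enorm (z *m A) <= sin theta * enorm u.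
    rewrite -ler_pdivrMr //; apply: le_trans X; rewrite le_eqVlt.
    by apply/orP; left; apply/eqP; field; rewrite !gt_eqF.
  rewrite -exprMn ler_pXn2r ?nnegrE ?(ltW nz) //.
  exact: le_trans (ltW nz) X.
rewrite /flat_angle !flat_dim_orthogonal //; case: ifP => kk; last first.
  apply: directed_angle_le => // u /orthogonal_flat_direction[u0 uB] t1.
  have [z zu] := rowspace_projection u fA; set w := u - z *m A.
  have uE : u = w + z *m A by rewrite subrK.
  have wz : dotv w (z *m A) = 0 by exact: zu.
  have uz : dotv u (z *m A) = dotv (z *m A) (z *m A) by rewrite uE dotvDl wz add0r.
  have [w0 wle] := line_angle_projection t0 t1 uE wz u0 (proj u z t1 uB u0 uz).
  exists w => //; apply/orthogonal_flat_direction; split=> //.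
  exact/mulmx_tr_eq0.
have kE : k = 2.
  by apply/eqP; rewrite eqn_leq k2 andbT; move: kk; rewrite leq_sub2lE.
subst k; apply: directed_angle_le => // m /orthogonal_flat_direction[m0 mA] t1.
have sin1 : sin theta < 1.
  have ct : 0 < cos theta.
    by apply: cos_gt0_pihalf; rewrite t1 andbT (lt_le_trans _ t0) // oppr_lt0 divr_gt0 // pi_gt0.
  rewrite ltNge; apply/negP => s1.
  have : 0 < cos theta ^+ 2 by rewrite exprn_gt0.
  have : 1 <= sin theta ^+ 2 by rewrite -(expr1n _ 2) ler_pXn2r ?nnegrE // (le_trans ler01).
  by have := cos2Dsin2 theta; clear; lra.
(* A nonzero plane vector annihilated by B^T would be its own normal partner, against sin theta <
   1. *)
have ABu : A *m B^T \in unitmx.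
  rewrite -row_free_unit; apply: inj_row_free => z zAB.
  apply/eqP; rewrite -(inj_eq (row_free_inj fA)) mul0mx; apply/negP => /negP zA.
  have := proj (z *m A) z t1 _ zA erefl; rewrite -mulmxA zAB => /(_ erefl).
  rewrite leNgt => /negP; apply.
  have zz : 0 < dotv (z *m A) (z *m A) by rewrite lt_def dotv_ge0 dotv_eq0 zA.
  rewrite gtr_pMl // expr2.
  have [s0|s0] := leP 0 (sin theta); first by rewrite mulr_ilt1.
  have : 0 <= sin theta.
    apply: sin_ge0_pi; rewrite t0 /= (le_trans (ltW t1)) //.
    by rewrite ler_pdivrMr // ler_peMr ?pi_ge0 // ler1n.
  by rewrite leNgt s0.
pose z := - (m *m B^T *m invmx (A *m B^T)); set u := m + z *m A.
have uB : u *m B^T = 0.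
  by rewrite mulmxDl -mulmxA /z mulNmx mulmxKV // subrr.
have mz : dotv m (z *m A) = 0 by exact: (mulmx_tr_eq0 A m).1.
have u0 : u != 0.
  rewrite -dotv_eq0 /u !dotvE (dotvC (z *m A)) mz addr0 add0r gt_eqF //.
  by rewrite ltr_wpDr ?dotv_ge0 // lt_def dotv_ge0 dotv_eq0 m0.
have uz : dotv u (z *m A) = dotv (z *m A) (z *m A) by rewrite dotvDl mz add0r.
have [_ le] := line_angle_projection t0 t1 (erefl u) mz u0 (proj u z t1 uB u0 uz).
exists u; last by rewrite line_angleC.
exact/orthogonal_flat_direction.
Qed.

(** * Comparison of the cubic bound with eta *)

Lemma asin_le_acos (R : realType) (y z : R) : 0 <= y -> 0 <= z ->
  y ^+ 2 + z ^+ 2 <= 1 -> asin y <= acos z.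
Proof.
move=> y0 z0 yz.
have le1 (a b : R) : 0 <= a -> a ^+ 2 + b ^+ 2 <= 1 -> a <= 1.
  move=> a0 ab; rewrite -(ler_pXn2r (ltn0Sn 1)) ?nnegrE ?ler01 // expr1n.
  by apply: le_trans ab; rewrite lerDl sqr_ge0.
have y1 : y <= 1 by exact: le1 yz.
have z1 : z <= 1 by apply: (le1 _ y) => //; rewrite addrC.
have yI : -1 <= y <= 1 by rewrite y1 andbT (le_trans _ y0) // lerN10.
have zI : -1 <= z <= 1 by rewrite z1 andbT (le_trans _ z0) // lerN10.
have pi20 : 0 <= (pi / 2 : R) by rewrite divr_ge0 ?pi_ge0.
rewrite leNgt; apply/negP => lt.
have : sin (acos z) < sin (asin y).
  rewrite ltr_sin // in_itv /=; last by rewrite asin_geNpi2 // asin_lepi2.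
  rewrite (le_trans _ (acos_ge0 zI)) ?oppr_le0 //=.
  exact: le_trans (ltW lt) (asin_lepi2 yI).
rewrite asinK ?in_itv //= sin_acos //; apply/negP; rewrite -leNgt.
rewrite -(ler_pXn2r (ltn0Sn 1)) ?nnegrE ?sqrtr_ge0 // sqr_sqrtr.
  by move: yz; clear; lra.
by rewrite subr_ge0 expr_le1.
Qed.

(* With [D = 1 - w^2] the second inequality amounts to [(1 - w) g(w) >= 0], where
   [g(w) = -1 + 3w - 0.9284 (w^2 + w^3) + 0.0484 (w^4 + w^5)]. *)
Lemma eta1_margin (R : realFieldType) (D w : R) : 0 <= D -> 0 < w ->
  w ^+ 2 = 1 - D -> D <= 2 * w ->
  D <= 83 / 100 /\
  D * (1 + 11 / 100 * D) ^+ 2 + (1 - D / (2 * w)) ^+ 2 <= 1.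
Proof.
move=> D0 w0 w2 Dw.
have w1 : w <= 1.
  by rewrite -(ler_pXn2r (ltn0Sn 1)) ?nnegrE ?(ltW w0) // expr1n w2; move: D0; clear; lra.
(* Slightly below sqrt 2 - 1, the positive root of w^2 + 2 w = 1. *)
have [c cE] : exists c : R, c = 414 / 1000 by exists (414 / 1000).
have c0 : 0 <= c by rewrite cE; clear; lra.
have wl : c <= w.
  rewrite leNgt; apply/negP => lt.
  have : w ^+ 2 <= c * w by rewrite expr2 ler_pM2r // ltW.
  by rewrite w2; move: Dw lt; rewrite cE; clear; lra.
have DE : D = 1 - w ^+ 2 by rewrite w2; ring.
have q1 : 0 <= (w - c) * (1 - w) by rewrite mulr_ge0 // subr_ge0.
have q2 : 0 <= w * ((w - c) * (1 - w)) by rewrite mulr_ge0 // ltW.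
split.
  have : c * c <= w * w by rewrite ler_pM.
  by rewrite -!expr2 w2 cE; clear; lra.
set g := -1 + 3 * w - 9284 / 10000 * (w ^+ 2 + w ^+ 3) +
  484 / 10000 * (w ^+ 4 + w ^+ 5).
have g0 : 0 <= g.
  have p4 : 0 <= w ^+ 4 + w ^+ 5 by rewrite addr_ge0 // exprn_ge0 // ltW.
  by move: q1 q2 p4 wl; rewrite cE /g; clear; lra.
have f0 : 0 <= (1 - w) * g by apply: mulr_ge0 => //; rewrite subr_ge0.
have E : D / w - D ^+ 2 / (4 * w ^+ 2) - D * (1 + 11 / 100 * D) ^+ 2 =
    D / (4 * w ^+ 2) * ((1 - w) * g).
  by rewrite /g DE; field; rewrite gt_eqF.
have : 0 <= D / w - D ^+ 2 / (4 * w ^+ 2) - D * (1 + 11 / 100 * D) ^+ 2.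
  by rewrite E; clearbody g; rewrite mulr_ge0 // divr_ge0 // mulr_ge0 // sqr_ge0.
have -> : (1 - D / (2 * w)) ^+ 2 = 1 - D / w + D ^+ 2 / (4 * w ^+ 2).
  by field; rewrite gt_eqF.
by clear; lra.
Qed.

(** Here w <= 1 - D / 2, and (1 + 11/100 D)^2 (1 - D / 2) <= 1 in this range; 62/100 lies just above
    (sqrt 5 - 1) / 2, where the domain of eta_2 ends. *)
Lemma eta2_margin (R : realFieldType) (D w : R) : 0 <= D -> 0 < w ->
  w ^+ 2 = 1 - D -> D <= 62 / 100 -> D * (1 + 11 / 100 * D) ^+ 2 <= D / w.
Proof.
move=> D0 w0 w2 D62; rewrite ler_pdivlMr // -(mulrA D) ler_piMr //.
have wD : w <= 1 - D / 2.
  rewrite -(ler_pXn2r (ltn0Sn 1)) ?nnegrE ?(ltW w0) //; last by move: D62; clear; lra.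
  by rewrite w2; have := sqr_ge0 D; clear; lra.
apply: (@le_trans _ _ ((1 + 11 / 100 * D) ^+ 2 * (1 - D / 2))).
  by rewrite ler_wpM2l // sqr_ge0.
have D2 : D * D <= 62 / 100 * D by rewrite ler_wpM2r.
have D3 : 0 <= D * (D * D) by rewrite !mulr_ge0.
by move: D0 (mulr_ge0 D0 D0) D2 D3; clear; lra.
Qed.

(** The domain of eta_1 continues past the point where it reaches pi / 2, and there the cubic may
    exceed 1; the bound by pi / 2 confines delta to the useful range. *)
Lemma eta_bound_ge (R : realType) (m : nat) (delta : R) :
  eta_defined m delta -> eta_bound m delta <= pi / 2 ->
  delta ^+ 2 <= 83 / 100 /\ asin (delta + 11 / 100 * delta ^+ 3) <= eta_bound m delta.
Proof.
rewrite /eta_defined /eta_bound => -[d0 + +]; set D := delta ^+ 2.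
have D0 : 0 <= D by exact: sqr_ge0.
have s50 : 0 <= Num.sqrt 5 :> R by exact: sqrtr_ge0.
have s52 : Num.sqrt 5 ^+ 2 = 5 :> R by rewrite sqr_sqrtr.
have s5 : Num.sqrt 5 <= 224 / 100 :> R.
  rewrite -(ler_pXn2r (ltn0Sn 1)) ?nnegrE ?divr_ge0 ?ler0n // s52; clear; lra.
have s5l : 2 <= Num.sqrt 5 :> R.
  rewrite -(ler_pXn2r (ltn0Sn 1)) ?nnegrE // s52; clear; lra.
have G0 : 0 <= delta + 11 / 100 * delta ^+ 3.
  by rewrite addr_ge0 // mulr_ge0 ?divr_ge0 ?ler0n ?exprn_ge0.
have G2 : (delta + 11 / 100 * delta ^+ 3) ^+ 2 = D * (1 + 11 / 100 * D) ^+ 2.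
  by rewrite /D; ring.
have sq a : 0 <= a -> delta < Num.sqrt a -> D < a.
  by move=> a0; rewrite -(ltr_pXn2r (ltn0Sn 1)) ?nnegrE ?sqrtr_ge0 // sqr_sqrtr.
case: ifP => _ dd.
  have D5 : D < 4 * Num.sqrt 5 - 8 by apply: sq => //; move: s5l; clear; lra.
  have D1 : 0 < 1 - D by move: D5 s5; clear; lra.
  rewrite /eta1 -/D; set w := Num.sqrt (1 - D).
  have w0 : 0 < w by rewrite sqrtr_gt0.
  have w2 : w ^+ 2 = 1 - D by rewrite sqr_sqrtr // ltW.
  have y0 : 0 <= D / (2 * w) by rewrite divr_ge0 // mulr_ge0 // ltW.
  (* D = 4 sqrt 5 - 8 is where the argument of arccos reaches -1. *)
  have y2 : D / (2 * w) <= 2.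
    rewrite ler_pdivrMr ?mulr_gt0 // mulrA -(ler_pXn2r (ltn0Sn 1)) ?nnegrE //; last first.
      by rewrite !mulr_ge0 // ltW.
    have : (D + 8) ^+ 2 <= (4 * Num.sqrt 5) ^+ 2.
      rewrite ler_pXn2r ?nnegrE ?mulr_ge0 ?addr_ge0 //; move: D5; clear; lra.
    have -> : (2 * 2 * w) ^+ 2 = 16 * w ^+ 2 by ring.
    by rewrite exprMn s52 w2; clear; lra.
  move=> le; have yI : -1 <= 1 - D / (2 * w) <= 1 by move: y0 y2; clear => *; apply/andP; split; lra.
  have c0 : 0 <= 1 - D / (2 * w).
    rewrite -[1 - _](@acosK R) ?in_itv //=; apply: cos_ge0_pihalf.
    by rewrite le andbT (le_trans _ (acos_ge0 yI)) // oppr_le0 divr_ge0 ?pi_ge0.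
  have Dw : D <= 2 * w.
    by move: c0; rewrite subr_ge0 ler_pdivrMr ?mul1r // mulr_gt0.
  have [D83 mar] := eta1_margin D0 w0 w2 Dw; split=> //.
  by apply: asin_le_acos => //; rewrite G2.
have D5 : D < (Num.sqrt 5 - 1) / 2 by apply: sq => //; move: s5l; clear; lra.
have D62 : D <= 62 / 100 by move: D5 s5; clear; lra.
have D1 : 0 < 1 - D by move: D62; clear; lra.
rewrite /eta2 -/D; set w := Num.sqrt (1 - D).
have w0 : 0 < w by rewrite sqrtr_gt0.
have w2 : w ^+ 2 = 1 - D by rewrite sqr_sqrtr // ltW.
have mar := eta2_margin D0 w0 w2 D62; move=> _; split; first by move: D62; clear; lra.
have y1 : D / w <= 1.
  rewrite ler_pdivrMr // mul1r -(ler_pXn2r (ltn0Sn 1)) ?nnegrE ?(ltW w0) // w2.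
  have : (D + 1 / 2) ^+ 2 <= (Num.sqrt 5 / 2) ^+ 2.
    rewrite ler_pXn2r ?nnegrE ?divr_ge0 ?addr_ge0 ?divr_ge0 //; move: D5; clear; lra.
  by rewrite expr_div_n s52; clear; lra.
apply: asin_le_acos => //.
by rewrite G2 sqr_sqrtr ?subr_ge0 //; move: mar; clear; lra.
Qed.

(** * Composition of angles, and the angles of the triangle *)

Lemma asin_ge0 (R : realType) (y : R) : 0 <= y -> y <= 1 -> 0 <= asin y.
Proof.
move=> y0 y1; have yI : -1 <= y <= 1 by rewrite y1 andbT (le_trans _ y0) // lerN10.
rewrite leNgt; apply/negP => lt.
have : sin (asin y) < sin 0.
  have pi20 : 0 <= (pi / 2 : R) by rewrite divr_ge0 ?pi_ge0.
  rewrite ltr_sin // in_itv /=; last by rewrite oppr_le0 pi20.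
  by rewrite asin_geNpi2 // asin_lepi2.
by rewrite asinK ?in_itv // sin0 ltNge y0.
Qed.

(* The normal part of n at p meets t only in its normal part, and the tangential
   part of n only in its tangential part: this is the angle addition formula. *)
Lemma angle_composition (R : realType) (d k : nat) (S : set 'rV[R]_d)
    (p n t : 'rV[R]_d) (al be : R) :
  (k <= d)%N -> embedded_submanifold k S -> S p ->
  dotv n n = 1 -> dotv t t = 1 -> 0 <= al -> 0 <= be -> al + be <= pi / 2 ->
  (forall tau, tangent_vector S p tau -> dotv tau tau = 1 -> dotv n tau <= sin al) ->
  (forall m, normal_vector S p m -> dotv m m = 1 -> dotv m t <= sin be) ->
  dotv n t <= sin (al + be).
Proof.
move=> kd eS Sp n1 t1 al0 be0 albe Hn Ht.
have pi2 : - (pi / 2) <= 0 :> R by rewrite oppr_le0 divr_ge0 ?pi_ge0.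
have [nT TnT NnT] := tangent_projection kd eS n Sp.
have [tT TtT NtT] := tangent_projection kd eS t Sp.
set nN := n - nT in NnT; set tN := t - tT in NtT.
have nE : n = nN + nT by rewrite subrK.
have tE : t = tN + tT by rewrite subrK.
clearbody nN tN.
have unit_split (a b : 'rV[R]_d) : dotv a b = 0 -> dotv (a + b) (a + b) = 1 ->
    enorm b <= 1 /\ enorm a = cos (asin (enorm b)).
  move=> ab; rewrite !dotvE (dotvC b a) ab addr0 add0r -!enorm_sqr => s1.
  have b1 : enorm b <= 1.
    rewrite -(ler_pXn2r (ltn0Sn 1)) ?nnegrE ?enorm_ge0 // expr1n -s1 lerDr.
    exact: sqr_ge0.
  split=> //; rewrite cos_asin; last first.
    by rewrite b1 andbT (le_trans _ (enorm_ge0 _)) // lerN10.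
  by rewrite -s1 addrK sqrtr_sqr ger0_norm ?enorm_ge0.
have [nT1 nN1] := unit_split _ _ (NnT _ TnT) (etrans (congr2 _ (esym nE) (esym nE)) n1).
have tNT : dotv tT tN = 0 by rewrite dotvC; exact: NtT.
have tE' : t = tT + tN by rewrite addrC.
have [tN1 tT1] := unit_split _ _ tNT (etrans (congr2 _ (esym tE') (esym tE')) t1).
have asin_le (y th : R) : 0 <= y -> y <= 1 -> 0 <= th -> th <= pi / 2 ->
    y <= sin th -> asin y <= th.
  move=> y0 y1 th0 th1 yth; have yI : -1 <= y <= 1.
    by rewrite y1 andbT (le_trans _ y0) // lerN10.
  rewrite leNgt; apply/negP => lt; move: yth; rewrite leNgt => /negP; apply.
  rewrite -[ltRHS](@asinK R) ?in_itv //= ltr_sin // in_itv /=.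
    by rewrite (le_trans pi2 th0).
  by rewrite asin_geNpi2 // asin_lepi2.
have a1 : asin (enorm nT) <= al.
  apply: asin_le => //; first by apply: le_trans albe; rewrite lerDl.
  have [->|n0] := eqVneq nT 0.
    rewrite enorm0; apply: sin_ge0_pi; rewrite al0 /=.
    apply: (@le_trans _ _ (pi / 2)); first by apply: le_trans albe; rewrite lerDl.
    by rewrite ler_pdivrMr // ler_peMr ?pi_ge0 // ler1n.
  have := Hn _ (tangent_vectorZ kd eS (enorm nT)^-1 Sp TnT) (unit_scaled n0).
  rewrite nE dotvDl !dotvZr (NnT _ TnT) mulr0 add0r -enorm_sqr.
  by rewrite expr2 mulKf // enorm_eq0.
have b1 : asin (enorm tN) <= be.
  apply: asin_le => //; first by apply: le_trans albe; rewrite lerDr.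
  have [->|n0] := eqVneq tN 0.
    rewrite enorm0; apply: sin_ge0_pi; rewrite be0 /=.
    apply: (@le_trans _ _ (pi / 2)); first by apply: le_trans albe; rewrite lerDr.
    by rewrite ler_pdivrMr // ler_peMr ?pi_ge0 // ler1n.
  have := Ht _ (orthogonal_toZ (enorm tN)^-1 NtT) (unit_scaled n0).
  rewrite tE dotvDr !dotvZl (NtT _ TtT) mulr0 addr0 -enorm_sqr.
  by rewrite expr2 mulKf // enorm_eq0.
have -> : dotv n t = dotv nN tN + dotv nT tT.
  by rewrite nE tE !dotvE (NnT _ TtT) (dotvC nT tN) (NtT _ TnT) !(addr0, add0r).
have a0 : 0 <= asin (enorm nT) by rewrite asin_ge0 ?enorm_ge0.
have b0 : 0 <= asin (enorm tN) by rewrite asin_ge0 ?enorm_ge0.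
apply: (@le_trans _ _ (sin (asin (enorm nT) + asin (enorm tN)))); last first.
  by apply: ler_sin_pi2 => //; [rewrite (le_trans pi2) // addr_ge0|rewrite lerD].
rewrite sinD !asinK ?in_itv /= ?nT1 ?tN1 ?andbT ?(le_trans (lerN10 _) (enorm_ge0 _)) //.
rewrite -nN1 -tT1 addrC.
by rewrite lerD // dotv_le.
Qed.

(** By the law of cosines a, b, c are the cosines of the angles of a triangle; the identity
    expresses that the angles add up to pi. *)
Lemma triangle_cosines (R : realFieldType) (l m g a b c : R) :
  0 < l -> 0 < m -> 0 < g ->
  a = (l ^+ 2 + m ^+ 2 - g ^+ 2) / (2 * (l * m)) ->
  b = (l ^+ 2 + g ^+ 2 - m ^+ 2) / (2 * (l * g)) ->
  c = (m ^+ 2 + g ^+ 2 - l ^+ 2) / (2 * (m * g)) ->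
  a ^+ 2 + b ^+ 2 + c ^+ 2 + 2 * a * b * c = 1.
Proof. by move=> l0 m0 g0 -> -> ->; field; rewrite !gt_eqF. Qed.

(** Used with s = sin (phi / 2). With C = 1 - 2 s^2 = cos phi, the values C, s, s satisfy the
    identity exactly, so three larger cosines would violate it. *)
Lemma small_angle_dichotomy (R : realFieldType) (s a b c : R) : 0 <= s ->
  2 * s ^+ 2 <= 1 -> a ^+ 2 + b ^+ 2 + c ^+ 2 + 2 * a * b * c = 1 ->
  [\/ a <= 1 - 2 * s ^+ 2, b <= s | c <= s].
Proof.
move=> s0 s1 abc.
have [|aa] := leP a (1 - 2 * s ^+ 2); first by constructor 1.
have [|bb] := leP b s; first by constructor 2.
have [|cc] := leP c s; first by constructor 3.
exfalso; set C := 1 - 2 * s ^+ 2 in aa.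
have C0 : 0 <= C by rewrite subr_ge0.
have a2 : C * C < a * a by rewrite ltr_pM.
have b2 : s * s <= b * b by rewrite ler_pM // ltW.
have c2 : s * s <= c * c by rewrite ler_pM // ltW.
have bc : s * s <= b * c by rewrite ler_pM // ltW.
have abc2 : C * (s * s) <= a * (b * c) by rewrite ler_pM ?mulr_ge0 // ltW.
by move: a2 b2 c2 abc2 abc; rewrite /C; clear; lra.
Qed.

Lemma cubic_margin_le1 (R : realFieldType) (delta : R) : 0 <= delta ->
  delta ^+ 2 <= 83 / 100 -> delta + 11 / 100 * delta ^+ 3 <= 1.
Proof.
move=> d0 d2; have d1 : delta <= 916 / 1000.
  rewrite leNgt; apply/negP => lt.
  have : delta * (916 / 1000) <= delta * delta by rewrite ler_wpM2l // ltW.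
  by rewrite -expr2; move: lt d2; clear; lra.
have : delta * delta ^+ 2 <= delta * (83 / 100) by rewrite ler_wpM2l.
by rewrite -exprS; move: d1; clear; lra.
Qed.

Lemma eta_bound_ge0 (R : realType) (m : nat) (delta : R) :
  eta_defined m delta -> 0 <= eta_bound m delta.
Proof.
move=> def; have [le|/ltW] := leP (eta_bound m delta) (pi / 2); last first.
  by apply: le_trans; rewrite divr_ge0 ?pi_ge0.
have [d0 _] := def; have [d83] := eta_bound_ge def le; apply: le_trans.
apply: asin_ge0; last exact: cubic_margin_le1.
by rewrite addr_ge0 // mulr_ge0 ?divr_ge0 ?ler0n ?exprn_ge0.
Qed.

Section VertexCase.
Context {R : realType}.
Variables (d k : nat) (S : set 'rV[R]_d).
Hypothesis kd : (k <= d)%N.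
Hypothesis cS : compact S.
Hypothesis eS : embedded_submanifold k S.

(** Angles are composed at p: from xt to p the normals turn by at most arcsin of the cubic bound,
    and at p they meet the plane at an angle of sine at most kappa c. *)
Lemma vertex_case (p w z o xt n : 'rV[R]_d) (a b r kappa delta c C : R)
    (t := a *: (w - p) + b *: (z - p)) :
  S p -> S w -> S z -> S xt ->
  enorm (o - p) = r -> enorm (o - w) = r -> enorm (o - z) = r ->
  0 < r -> r <= kappa * lfs S p -> 0 < lfs S p ->
  enorm (xt - p) <= delta * lfs S p ->
  eta_defined (d - k) delta -> asin_defined (kappa * c) ->
  0 < kappa -> 0 <= c -> 0 <= C -> C <= 1 ->
  dotv (w - p) (z - p) <= C * (enorm (w - p) * enorm (z - p)) ->
  1 + C <= c ^+ 2 * (1 - C) ->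
  normal_vector S xt n -> dotv n n = 1 -> dotv t t = 1 ->
  eta_bound (d - k) delta + asin (kappa * c) < pi / 2 ->
  dotv n t <= sin (eta_bound (d - k) delta + asin (kappa * c)).
Proof.
move=> Sp Sw Sz Sxt op ow oz r0 rk L0 xtp etad asind k0 c0 C0 C1 wz cC nxt n1 t1 lt.
have [d0 _] := etad.
have [_ kc1] := andP asind.
have kc0 : 0 <= kappa * c by rewrite mulr_ge0 // ltW.
have be0 : 0 <= asin (kappa * c) by exact: asin_ge0.
have [|d83 ale] := eta_bound_ge etad.
  by apply: le_trans (ltW lt); rewrite lerDl.
have g1 := cubic_margin_le1 d0 d83.
set g := delta + 11 / 100 * delta ^+ 3 in ale g1.
have g0 : 0 <= g.
  by rewrite /g addr_ge0 // mulr_ge0 ?divr_ge0 ?ler0n ?exprn_ge0.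
have al0 : 0 <= asin g by exact: asin_ge0.
have sum_le : asin g + asin (kappa * c) <= eta_bound (d - k) delta + asin (kappa * c).
  by rewrite lerD2r.
apply: (@le_trans _ _ (sin (asin g + asin (kappa * c)))); last first.
  apply: ler_sin_pi2 => //; last exact: ltW.
  rewrite (le_trans (_ : _ <= 0)) ?addr_ge0 // oppr_le0 divr_ge0 ?pi_ge0 //.
apply: (angle_composition kd eS Sp n1 t1 al0 be0).
- exact: le_trans sum_le (ltW lt).
- move=> tau Ttau tau1; rewrite asinK; last first.
    by rewrite in_itv /= g1 andbT (le_trans (lerN10 _) g0).
  set rho := enorm (xt - p) / lfs S p.
  have rho0 : 0 <= rho by rewrite divr_ge0 ?enorm_ge0 // ltW.
  have rd : rho <= delta by rewrite ler_pdivrMr.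
  have rd2 : rho ^+ 2 <= delta ^+ 2 by rewrite ler_pXn2r ?nnegrE.
  have rd3 : rho ^+ 3 <= delta ^+ 3 by rewrite ler_pXn2r ?nnegrE.
  apply: le_trans (normal_variation_lfs kd cS eS Sp Sxt L0 nxt n1 Ttau tau1 _) _.
    exact: le_trans rd2 d83.
  by rewrite -/rho /g lerD // ler_wpM2l // divr_ge0 ?ler0n.
- move=> m Nm m1; rewrite asinK; last first.
    by rewrite in_itv /= kc1 andbT (le_trans (lerN10 _) kc0).
  have ow' : enorm (o - p) = enorm (o - w) by rewrite op ow.
  have oz' : enorm (o - p) = enorm (o - z) by rewrite op oz.
  have := vertex_normal_bound a b kd cS eS Sp Sw Sz L0 ow' oz' Nm m1 c0 C0 C1 wz cC.
  rewrite /= -/t (@enorm_eq _ _ t 1) ?expr1n // mulr1 op => /le_trans; apply.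
  by rewrite ler_wpM2r // ler_pdivrMr.
Qed.

End VertexCase.

(** The half-angle formula cot(psi)^2 = (1 + C) / (1 - C); psi <= pi / 4 makes C nonnegative. *)
Lemma half_angle_cot (R : realType) (psi : R) : 0 < psi -> psi <= pi / 4 ->
  0 <= cot psi /\ (let C := cos (psi + psi) in
  [/\ 0 <= C, C <= 1 & 1 + C <= cot psi ^+ 2 * (1 - C)]).
Proof.
move=> p0 p4; have pi0 := pi_gt0 R.
have s0 : 0 < sin psi by apply: sin_gt0_pi; rewrite p0 /=; move: p4 pi0; clear; lra.
have c0 : 0 <= cos psi.
  by apply: cos_ge0_pihalf; apply/andP; split; move: p0 p4 pi0; clear; lra.
split; first by rewrite /cot divr_ge0 // ltW.
have CE : cos (psi + psi) = 1 - 2 * sin psi ^+ 2.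
  by rewrite cosD -!expr2; have := cos2Dsin2 psi; clear; lra.
split.
- by apply: cos_ge0_pihalf; apply/andP; split; move: p0 p4 pi0; clear; lra.
- exact: cos_le1.
- rewrite CE /cot expr_div_n.
  have -> : cos psi ^+ 2 / sin psi ^+ 2 * (1 - (1 - 2 * sin psi ^+ 2)) =
      2 * cos psi ^+ 2 by field; rewrite gt_eqF.
  by have := cos2Dsin2 psi; clear; lra.
Qed.

Lemma dotv_cosine (R : realType) (d : nat) (p w z : 'rV[R]_d) :
  p != w -> p != z ->
  dotv (w - p) (z - p) =
    (enorm (w - p) ^+ 2 + enorm (z - p) ^+ 2 - enorm (z - w) ^+ 2) /
    (2 * (enorm (w - p) * enorm (z - p))) * (enorm (w - p) * enorm (z - p)).
Proof.
move=> pw pz.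
have lw : enorm (w - p) != 0 by rewrite enorm_eq0 subr_eq0 eq_sym.
have lz : enorm (z - p) != 0 by rewrite enorm_eq0 subr_eq0 eq_sym.
have -> (X l m : R) : l != 0 -> m != 0 -> X / (2 * (l * m)) * (l * m) = X / 2.
  by move=> l0 m0; field; rewrite l0 m0.
all: rewrite // !enorm_sqr.
have -> : z - w = (z - p) - (w - p) by rewrite opprB addrA subrK.
by move: (z - p) (w - p) => A B; rewrite !dotvE (dotvC B A); field.
Qed.

Lemma nearest_vertex_case (R : realType) (d k : nat) (S : set 'rV[R]_d)
    (v v' v'' o x xt n : 'rV[R]_d) (r kappa phi a b c al be ga theta : R)
    (t := al *: v + be *: v' + ga *: v'') :
  (k <= d)%N -> compact S -> embedded_submanifold k S ->
  (forall w, w \in [:: v; v'; v''] ->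
    [/\ S w, enorm (o - w) = r & r <= kappa * lfs S w]) ->
  0 < kappa -> kappa <= 1 / 2 -> 0 < r ->
  v != v' -> v != v'' -> v' != v'' ->
  0 <= a -> 0 <= b -> 0 <= c -> a + b + c = 1 -> x = a *: v + b *: v' + c *: v'' ->
  nearest_point S x xt ->
  enorm (x - v) <= enorm (x - v') -> enorm (x - v) <= enorm (x - v'') ->
  0 < phi -> phi <= pi / 3 ->
  eta_defined (d - k) (Num.sqrt 2 * kappa) -> asin_defined (kappa * cot (phi / 2)) ->
  eta_defined (d - k) (2 * kappa) -> asin_defined (kappa * cot (pi / 4 - phi / 4)) ->
  eta_bound (d - k) (Num.sqrt 2 * kappa) + asin (kappa * cot (phi / 2)) <= theta ->
  eta_bound (d - k) (2 * kappa) + asin (kappa * cot (pi / 4 - phi / 4)) <= theta ->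
  theta < pi / 2 ->
  normal_vector S xt n -> dotv n n = 1 -> al + be + ga = 0 -> dotv t t = 1 ->
  dotv n t <= sin theta.
Proof.
move=> kd cS eS V k0 k12 r0 vv' vv'' v'v'' a0 b0 c0 abc xE nx near1 near2 p0 p3.
move=> eta1 asin1 eta2 asin2 th1 th2 thlt Nn n1 sum0 t1.
have [vV v'V v''V] : [/\ v \in [:: v; v'; v''], v' \in [:: v; v'; v''] &
    v'' \in [:: v; v'; v'']] by rewrite !inE !eqxx !orbT.
have pi0 := pi_gt0 R.
have Lpos w : w \in [:: v; v'; v''] -> 0 < lfs S w.
  by move=> /V[_ _ rw]; rewrite -(pmulr_rgt0 _ k0) (lt_le_trans r0).
have V' w : w \in [:: v; v'; v''] -> [/\ S w, enorm (o - w) = r & 2 * r <= lfs S w].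
  move=> wV; have [Sw rw rL] := V w wV; split=> //.
  have : kappa * lfs S w <= 1 / 2 * lfs S w by rewrite ler_pM2r // Lpos.
  by move: rL; clear; lra.
have [far nearv] := nearest_point_vertex_dist kd cS eS V' a0 b0 c0 abc xE r0 nx.
have Sxt : S xt by case: nx.
have dist2 w : w \in [:: v; v'; v''] -> enorm (xt - w) <= 2 * kappa * lfs S w.
  move=> wV; rewrite enormB; apply: le_trans (far w wV) _.
  by have [_ _] := V w wV; rewrite -mulrA ler_pM2l.
have dist1 : enorm (xt - v) <= Num.sqrt 2 * kappa * lfs S v.
  rewrite enormB; apply: le_trans (nearv v vV _) _.
    by move=> w; rewrite !inE => /or3P[] /eqP ->.
  have [_ _ rv] := V v vV; rewrite -(mulrA (Num.sqrt 2)).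
  apply: (ler_pM (divr_ge0 (ler0n _ _) (ler0n _ _)) (ltW r0)) => //.
  rewrite -(ler_pXn2r (ltn0Sn 1)) ?nnegrE ?divr_ge0 ?ler0n ?sqrtr_ge0 //.
  by rewrite sqr_sqrtr //; clear; lra.
have psi1 : phi / 2 <= pi / 4 by move: p3 pi0; clear; lra.
have psi10 : 0 < phi / 2 by rewrite divr_gt0.
have psi2 : pi / 4 - phi / 4 <= pi / 4 by move: p0; clear; lra.
have psi20 : 0 < pi / 4 - phi / 4 by move: p3 pi0; clear; lra.
have [cot1 [C10 C11 C1]] := half_angle_cot psi10 psi1.
have [cot2 [C20 C21 C2]] := half_angle_cot psi20 psi2.
set s := sin (phi / 2).
have C1E : cos (phi / 2 + phi / 2) = 1 - 2 * s ^+ 2.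
  by rewrite cosD -!expr2 /s; have := cos2Dsin2 (phi / 2); clear; lra.
(* Twice the angle in the second cotangent is pi / 2 - phi / 2, the threshold for the other two
   vertices. *)
have C2E : cos (pi / 4 - phi / 4 + (pi / 4 - phi / 4)) = s.
  have -> : pi / 4 - phi / 4 + (pi / 4 - phi / 4) = pi / 2 - phi / 2 by field.
  by rewrite cosB cos_pihalf sin_pihalf mul0r mul1r add0r.
have sin_th B : 0 <= B -> B <= theta -> sin B <= sin theta.
  move=> B0 Bth; apply: ler_sin_pi2 => //; last exact: ltW.
  by rewrite (le_trans _ B0) // oppr_le0 divr_ge0 ?pi_ge0.
pose l := enorm (v' - v); pose m := enorm (v'' - v); pose g := enorm (v'' - v').
have l0 : 0 < l by rewrite enorm_gt0 subr_eq0 eq_sym.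
have m0 : 0 < m by rewrite enorm_gt0 subr_eq0 eq_sym.
have g0 : 0 < g by rewrite enorm_gt0 subr_eq0 eq_sym.
have cosines := triangle_cosines l0 m0 g0 erefl erefl erefl.
have s0 : 0 <= s by rewrite -C2E.
have s1 : 2 * s ^+ 2 <= 1 by rewrite -subr_ge0 -C1E.
have [Sv ov rv] := V v vV; have [Sv' ov' rv'] := V v' v'V.
have [Sv'' ov'' rv''] := V v'' v''V.
have B0 (delta y : R) : eta_defined (d - k) delta -> asin_defined y -> 0 <= y ->
    0 <= eta_bound (d - k) delta + asin y.
  by move=> ed /andP[_ y1] y0; rewrite addr_ge0 ?eta_bound_ge0 ?asin_ge0.
have B10 := B0 _ _ eta1 asin1 (mulr_ge0 (ltW k0) cot1).
have B20 := B0 _ _ eta2 asin2 (mulr_ge0 (ltW k0) cot2).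
have lg : enorm (v - v') = l by rewrite enormB.
have mg : enorm (v - v'') = m by rewrite enormB.
have gg : enorm (v' - v'') = g by rewrite enormB.
(* A large enough angle at v allows the sharper distance known for the nearest vertex; at the other
   vertices only the distance 2 r is available, but the angle is larger. *)
case: (small_angle_dichotomy s0 s1 cosines) => cle.
- have tE : t = be *: (v' - v) + ga *: (v'' - v).
    rewrite /t (_ : al = - be - ga); last by move: sum0; clear; lra.
    by apply/rowP => i; rewrite !mxE; ring.
  apply: (le_trans _ (sin_th _ B10 th1)); rewrite C1E in C10 C11 C1.
  rewrite tE in t1 *; apply: (vertex_case kd cS eS Sv Sv' Sv'' Sxt ov ov' ov'' r0 rv
    (Lpos v vV) dist1 eta1 asin1 k0 cot1 C10 C11 _ C1 Nn n1 t1 (le_lt_trans th1 thlt)).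
  by rewrite dotv_cosine // -/l -/m -/g ler_wpM2r // mulr_ge0 // ltW.
- have tE : t = al *: (v - v') + ga *: (v'' - v').
    rewrite /t (_ : be = - al - ga); last by move: sum0; clear; lra.
    by apply/rowP => i; rewrite !mxE; ring.
  apply: (le_trans _ (sin_th _ B20 th2)); rewrite C2E in C20 C21 C2.
  rewrite tE in t1 *; apply: (vertex_case kd cS eS Sv' Sv Sv'' Sxt ov' ov ov'' r0 rv'
    (Lpos v' v'V) (dist2 v' v'V) eta2 asin2 k0 cot2 C20 C21 _ C2 Nn n1 t1 (le_lt_trans th2 thlt)).
  rewrite dotv_cosine //; last by rewrite eq_sym.
  by rewrite lg -/m -/g ler_wpM2r // mulr_ge0 // ltW.
- have tE : t = al *: (v - v'') + be *: (v' - v'').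
    rewrite /t (_ : ga = - al - be); last by move: sum0; clear; lra.
    by apply/rowP => i; rewrite !mxE; ring.
  apply: (le_trans _ (sin_th _ B20 th2)); rewrite C2E in C20 C21 C2.
  rewrite tE in t1 *; apply: (vertex_case kd cS eS Sv'' Sv Sv' Sxt ov'' ov ov' r0 rv''
    (Lpos v'' v''V) (dist2 v'' v''V) eta2 asin2 k0 cot2 C20 C21 _ C2 Nn n1 t1 (le_lt_trans th2 thlt)).
  rewrite dotv_cosine 1?eq_sym //.
  by rewrite mg gg -/l ler_wpM2r // mulr_ge0 // ltW.
Qed.

(** * The two flats of the theorem, and the choice of the nearest vertex *)

Lemma lfs_ge0 (R : realType) (d : nat) (S : set 'rV[R]_d) p : 0 <= lfs S p.
Proof.
have [[m Mm]|M0] := pselect (medial_axis S !=set0).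
  apply: lb_le_inf; first by exists (eucl_dist p m), m.
  by move=> _ [q _ <-]; exact: eucl_dist_ge0.
rewrite /lfs (_ : [set _ | _ in _] = set0) ?inf0 //.
by apply/seteqP; split=> // _ [q Mq <-]; case: M0; exists q.
Qed.

(** Measured from a point equidistant to the vertices, equality of distances to v and w becomes
    orthogonality to w - v. *)
Lemma triangle_normal_flatE (R : realType) (d : nat) (v v' v'' o : 'rV[R]_d) (r : R)
    (A : 'M[R]_(2, d)) :
  eucl_dist o v = r -> eucl_dist o v' = r -> eucl_dist o v'' = r ->
  (forall z : 'rV[R]_2, z *m A = z 0 0 *: (v' - v) + z 0 1 *: (v'' - v)) ->
  triangle_normal_flat v v' v'' = orthogonal_flat o A.
Proof.
move=> rv rv' rv'' zA.
have equi q w : eucl_dist o w = r ->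
    (eucl_dist q v = eucl_dist q w) <-> dotv (q - o) (w - v) = 0.
  move=> rw; have : eucl_dist o v = eucl_dist o w by rewrite rv rw.
  rewrite /eucl_dist => /enorm_eqP; have split_o z : q - z = (q - o) + (o - z).
    by rewrite addrA subrK.
  have -> : w - v = (o - v) - (o - w) by apply/rowP => i; rewrite !mxE; ring.
  rewrite (split_o v) (split_o w) => E.
  rewrite (enorm_eqP (q - o + (o - v)) (q - o + (o - w))).
  move: E; move: (q - o) (o - v) (o - w) => Q B C; rewrite !dotvE.
  by rewrite (dotvC B Q) (dotvC C Q) => E; split; move: E; clear; lra.
apply/seteqP; split=> q /=.
  move=> [/(equi q v' rv') e1 /(equi q v'' rv'') e2].
  by apply/mulmx_tr_eq0 => z; rewrite zA dotvDr !dotvZr e1 e2 !mulr0 addr0.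
move=> /mulmx_tr_eq0 H; split; apply/equi => //.
  by have := H (delta_mx 0 0); rewrite zA !mxE /= scale1r scale0r addr0.
by have := H (delta_mx 0 1); rewrite zA !mxE /= scale1r scale0r add0r.
Qed.

Lemma normal_flatE (R : realType) (d k : nat) (S : set 'rV[R]_d) (p : 'rV[R]_d)
    (B : 'M[R]_(k, d)) :
  (forall u, tangent_vector S p u <-> exists z : 'rV[R]_k, u = z *m B) ->
  normal_flat S p = orthogonal_flat p B.
Proof.
move=> HB; apply/seteqP; split=> q /=.
  move=> H; apply/mulmx_tr_eq0 => z.
  have := H (p + z *m B); rewrite (addrC p) addrK; apply.
  by exists (z *m B); rewrite 1?addrC //; apply/HB; exists z.
move=> /mulmx_tr_eq0 H _ [u /HB[z ->] <-].
by rewrite addrAC subrr add0r; exact: H.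
Qed.

Unset Implicit Arguments.

Theorem lemma9 (R : realType) (d k : nat) (hk : (2 <= k)%N) (hkd : (k < d)%N)
  (S : set 'rV[R]_d) (hS : bounded_smooth_manifold k S)
  (v v' v'' : 'rV[R]_d) (hv : S v) (hv' : S v') (hv'' : S v'')
  (htau : nondegenerate_triangle v v' v'')
  (r : R) (hr : is_circumradius v v' v'' r)
  (kappa : R) (hkappa : kappa <= 1 / 2)
  (hlfs : r <= kappa * lfs S v) (hlfs' : r <= kappa * lfs S v')
  (hlfs'' : r <= kappa * lfs S v'')
  (x : 'rV[R]_d) (hx : triangle v v' v'' x)
  (xt : 'rV[R]_d) (hxt : nearest_point S x xt)
  (phi : R) (hphi0 : 0 < phi) (hphi1 : phi <= pi / 3)
  (heta1 : eta_defined (d - k) (Num.sqrt 2 * kappa))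
  (hasin1 : asin_defined (kappa * cot (phi / 2)))
  (heta2 : eta_defined (d - k) (2 * kappa))
  (hasin2 : asin_defined (kappa * cot (pi / 4 - phi / 4))) :
  flat_angle (triangle_normal_flat v v' v'') (normal_flat S xt)
  <= Num.max
       (eta_bound (d - k) (Num.sqrt 2 * kappa) + asin (kappa * cot (phi / 2)))
       (eta_bound (d - k) (2 * kappa) + asin (kappa * cot (pi / 4 - phi / 4))).
Proof.
have kd : (k <= d)%N by exact: ltnW.
have [cS eS] := hS; have [ctr [_ [rv rv' rv'']]] := hr.
pose A : 'M[R]_(2, d) := \matrix_(i < 2, j < d) (if i == 0 then v' - v else v'' - v) 0 j.
have zA (z : 'rV[R]_2) : z *m A = z 0 0 *: (v' - v) + z 0 1 *: (v'' - v).
  rewrite mulmx_sum_row !big_ord_recl big_ord0 addr0.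
  have -> : lift ord0 ord0 = 1 :> 'I_2 by exact/val_inj.
  by congr (_ *: _ + _ *: _); apply/rowP => j; rewrite !mxE.
have fA : row_free A.
  apply: inj_row_free => z; rewrite zA => z0.
  have /freeP/(_ (fun i => z 0 i)) := htau : free [tuple v' - v; v'' - v].
  rewrite !big_ord_recl big_ord0 addr0 /=.
  have -> : lift ord0 ord0 = 1 :> 'I_2 by exact/val_inj.
  by move=> /(_ z0) H; apply/rowP => i; rewrite mxE H.
have zA0 (z0 z1 : R) : z0 *: (v' - v) + z1 *: (v'' - v) = 0 -> z0 = 0 /\ z1 = 0.
  move=> H; pose z : 'rV[R]_2 := \row_i (if i == 0 then z0 else z1).
  have : z *m A = 0 by rewrite zA !mxE.
  rewrite -(mul0mx _ A) => /(row_free_inj fA) /rowP zz.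
  by have := zz 0; have := zz 1; rewrite !mxE.
have vv' : v != v'.
  apply/eqP => E; have [] := zA0 1 0; last by move/eqP; rewrite oner_eq0.
  by rewrite E subrr scaler0 scale0r addr0.
have vv'' : v != v''.
  apply/eqP => E; have [] := zA0 0 1; last by move=> _ /eqP; rewrite oner_eq0.
  by rewrite E subrr scaler0 scale0r addr0.
have v'v'' : v' != v''.
  apply/eqP => E; have [] := zA0 1 (-1); last by move/eqP; rewrite oner_eq0.
  by rewrite E scaleN1r scale1r subrr.
have r0 : 0 < r.
  rewrite lt_def -rv eucl_dist_ge0 andbT; apply/eqP => r0.
  move/eqP: vv'; apply; have := r0; rewrite rv -rv' => r0'.
  have ov : ctr = v by apply/eqP; rewrite -subr_eq0 -enorm_eq0; apply/eqP.
  by apply/eqP; rewrite -{1}ov -subr_eq0 -enorm_eq0; apply/eqP.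
have k0 : 0 < kappa.
  have := lt_le_trans r0 hlfs; rewrite ltNge => /negP H.
  by rewrite ltNge; apply/negP => k0; apply: H; rewrite mulr_le0_ge0 // lfs_ge0.
have [B fB HB] := tangent_basis kd eS hxt.1.
rewrite (triangle_normal_flatE rv rv' rv'' zA) (normal_flatE HB).
set b1 := _ + asin _; set b2 := _ + asin _.
have cot0 y : 0 < y -> y <= pi / 4 -> 0 <= kappa * cot y.
  by move=> y0 y4; rewrite mulr_ge0 ?(ltW k0) //; case: (half_angle_cot y0 y4).
have b10 : 0 <= b1.
  have [_ s1] := andP hasin1.
  rewrite addr_ge0 ?eta_bound_ge0 ?asin_ge0 // cot0 ?divr_gt0 //.
  by have := pi_gt0 R; move: hphi1; clear; lra.
apply: orthogonal_flat_angle => //; first by rewrite le_max b10.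
move=> tlt n z nB n1 t1; set theta := Num.max b1 b2 in tlt *.
have th1 : b1 <= theta by rewrite le_max lexx.
have th2 : b2 <= theta by rewrite le_max lexx orbT.
have Nn : normal_vector S xt n.
  by move=> u /HB[w ->]; apply: (mulmx_tr_eq0 B n).1.
have [a [b [c [a0 b0 c0 abc xE]]]] := hx.
have V w : w \in [:: v; v'; v''] -> [/\ S w, enorm (ctr - w) = r & r <= kappa * lfs S w].
  by rewrite !inE => /or3P[] /eqP ->.
(* With coefficients of sum 0 a vector of the plane has a form symmetric in the vertices, which can
   then be permuted to put the one nearest to x first. *)
pose al := - z 0 0 - z 0 1.
have tE : z *m A = al *: v + z 0 0 *: v' + z 0 1 *: v''.
  by rewrite zA /al; apply/rowP => i; rewrite !mxE; ring.
have sum0 : al + z 0 0 + z 0 1 = 0 by rewrite /al; ring.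
clearbody al; rewrite tE in t1 *.
have perm (p p' p'' : 'rV[R]_d) : {subset [:: p; p'; p''] <= [:: v; v'; v'']} ->
    forall w, w \in [:: p; p'; p''] ->
    [/\ S w, enorm (ctr - w) = r & r <= kappa * lfs S w].
  by move=> sub w /sub; exact: V.
have main p p' p'' (wp wp' wp'' zp zp' zp'' : R) :
    {subset [:: p; p'; p''] <= [:: v; v'; v'']} ->
    p != p' -> p != p'' -> p' != p'' -> 0 <= wp -> 0 <= wp' -> 0 <= wp'' ->
    wp + wp' + wp'' = 1 -> x = wp *: p + wp' *: p' + wp'' *: p'' ->
    enorm (x - p) <= enorm (x - p') -> enorm (x - p) <= enorm (x - p'') ->
    zp + zp' + zp'' = 0 ->
    al *: v + z 0 0 *: v' + z 0 1 *: v'' = zp *: p + zp' *: p' + zp'' *: p'' ->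
    dotv n (al *: v + z 0 0 *: v' + z 0 1 *: v'') <= sin theta.
  move=> sub pp' pp'' p'p'' w0 w0' w0'' ww xp np np' zz tp.
  rewrite tp in t1 *.
  exact: (nearest_vertex_case kd cS eS (perm _ _ _ sub) k0 hkappa r0 pp' pp'' p'p''
    w0 w0' w0'' ww xp hxt np np' hphi0 hphi1 heta1 hasin1 heta2 hasin2 th1 th2 tlt
    Nn n1 zz t1).
have [n12|/ltW n21] := leP (enorm (x - v)) (enorm (x - v')).
  have [n13|/ltW n31] := leP (enorm (x - v)) (enorm (x - v'')).
    by apply: (main v v' v'' a b c al (z 0 0) (z 0 1)).
  apply: (main v'' v v' c a b (z 0 1) al (z 0 0)) => //; rewrite 1?eq_sym //.
  - by move=> w; rewrite !inE => /or3P[] ->; rewrite ?orbT.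
  - by rewrite -abc; ring.
  - by rewrite xE addrC addrA.
  - exact: le_trans n12.
  - by rewrite -sum0; ring.
  - by rewrite addrC addrA.
have [n23|/ltW n32] := leP (enorm (x - v')) (enorm (x - v'')).
  apply: (main v' v v'' b a c (z 0 0) al (z 0 1)) => //; rewrite 1?eq_sym //.
  - by move=> w; rewrite !inE => /or3P[] ->; rewrite ?orbT.
  - by rewrite -abc; ring.
  - by rewrite xE (addrC (a *: v)).
  - by rewrite -sum0; ring.
  - by rewrite (addrC (al *: v)).
apply: (main v'' v v' c a b (z 0 1) al (z 0 0)) => //; rewrite 1?eq_sym //.
- by move=> w; rewrite !inE => /or3P[] ->; rewrite ?orbT.
- by rewrite -abc; ring.
- by rewrite xE addrC addrA.
- exact: le_trans n21.
- by rewrite -sum0; ring.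
- by rewrite addrC addrA.
Qed.
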